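(* Let $A$ and $B$ be Artin algebras. Then the following hold. (1) $\mathrm{Grigdim}(A\times B)=\min\{\mathrm{Grigdim}\,A,\ \mathrm{Grigdim}\,B\}$. (2) If $k$ is a perfect field and $A$ and $B$ are finite-dimensional $k$-algebras, then $\mathrm{Grigdim}(A\otimes_k B)\geq \min\{\mathrm{Grigdim}\,A,\ \mathrm{Grigdim}\,B\}$. (3) If $A$ and $B$ are Morita equivalent, then $\mathrm{Grigdim}\,A=\mathrm{Grigdim}\,B$.
   Context: For an Artin algebra $A$, let $A\text{-mod}$ be the category of finitely generated left $A$-modules, $A\text{-proj}$ its full subcategory of projective modules, and $D$ the standard duality. For a module $M$, $\mathrm{add}\,M$ is the smallest full subcategory of the module category containing $M$ and closed under finite direct sums and direct summands. A module $G\in A\text{-mod}$ is Gorenstein projective if there is an exact sequence $\cdots\to P^{-1}\to P^0\xrightarrow{d^0}P^1\to\cdots$ in $A\text{-proj}$ which stays exact after applying $\mathrm{Hom}_A(-,P)$ for each $P$ in $A\text{-proj}$, such that $G\cong\mathrm{Ker}\,d^0$. A module $M\in A\text{-mod}$ is a generator if $A\in\mathrm{add}\,M$; a Gorenstein projective generator is a module that is both a generator and Gorenstein projective. For finitely generated modules $T$ and $X$ over an Artin algebra, the $T$-dominant dimension of $X$ is $$T\text{-}\mathrm{domdim}\,X=\sup\{n \mid \text{there is an exact sequence } 0\to X\to T^0\to T^1\to\cdots\to T^{n-1} \text{ with } T^i\in\mathrm{add}\,T \text{ for all } 0\le i\le n-1\}$$ (the last map is not required to be surjective). The Gorenstein rigidity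 dimension of an Artin algebra $A$ is $$\mathrm{Grigdim}\,A=\sup\{DM\text{-}\mathrm{domdim}\,\Gamma \mid M \text{ is a Gorenstein projective generator in } A\text{-mod and } \Gamma=\mathrm{End}_A(M)\}\in\mathbb{N}\cup\{\infty\}.$$ Here $\Gamma=\mathrm{Hom}_A(M,M)$ and $DM\cong\mathrm{Hom}_A(M,D(A_A))$ are regarded as $\Gamma$-modules on the same side, namely via precomposition with endomorphisms of $M$. *)

(* Defs.v *)
From HB Require Import structures.
From mathcomp Require Import all_boot all_order all_algebra separable.
From mathcomp Require Import boolp classical_sets constructive_ereal.

Set Implicit Arguments.
Unset Strict Implicit.
Unset Printing Implicit Defensive.

Import Order.TTheory GRing.Theory Num.Theory.
Local Open Scope ring_scope.

(* Modules are left modules [lmodType A].  Rings are [pzRingType], so that the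
   zero ring is allowed (it occurs as the endomorphism ring of the zero module).
   Types of homomorphisms get their [eqType] and [choiceType] structures from
   the classical axioms of [boolp]. *)

Section Hom.
Variable A : pzRingType.
Implicit Types M N P : lmodType A.

Definition hom M N : Type := {linear M -> N}.

HB.instance Definition _ M N := gen_eqMixin (hom M N).
HB.instance Definition _ M N := gen_choiceMixin (hom M N).

Definition hom_fun M N (f : hom M N) : M -> N := (f : {linear M -> N}).
Coercion hom_fun : hom >-> Funclass.

Lemma hom_ext M N (f g : hom M N) : (forall x, f x = g x) -> f = g.
Proof.
move=> /funext fg; case: f g fg => [f [[f1] [f2]]] [g [[g1] [g2]]] /= fg.
rewrite /hom_fun /= in fg; subst g.
by rewrite (Prop_irrelevance f1 g1) (Prop_irrelevance f2 g2).
Qed.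

Definition hom_id M : hom M M := idfun : {linear M -> M}.
Definition hom_comp M N P (g : hom N P) (f : hom M N) : hom M P :=
  ((g : {linear N -> P}) \o (f : {linear M -> N})) : {linear M -> P}.

Lemma homD M N (f : hom M N) : {morph f : x y / x + y}.
Proof. exact: (raddfD (f : {linear M -> N})). Qed.
Lemma homZ M N (f : hom M N) a : {morph f : x / a *: x}.
Proof. exact: (linearZ_LR (f : {linear M -> N}) a). Qed.

Section HomZmod.
Variables M N : lmodType A.

Definition hom_zero : hom M N := (\0 : M -> N) : {linear M -> N}.
Definition hom_add (f g : hom M N) : hom M N :=
  ((f : {linear M -> N}) \+ (g : {linear M -> N})) : {linear M -> N}.
Definition hom_opp (f : hom M N) : hom M N :=
  (\- (f : {linear M -> N})) : {linear M -> N}.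

Fact hom_addA : associative hom_add.
Proof. by move=> f g h; apply: hom_ext => x; apply: addrA. Qed.
Fact hom_addC : commutative hom_add.
Proof. by move=> f g; apply: hom_ext => x; apply: addrC. Qed.
Fact hom_add0 : left_id hom_zero hom_add.
Proof. by move=> f; apply: hom_ext => x; apply: add0r. Qed.
Fact hom_addN : left_inverse hom_zero hom_opp hom_add.
Proof. by move=> f; apply: hom_ext => x; apply: addNr. Qed.

HB.instance Definition _ :=
  GRing.isZmodule.Build (hom M N) hom_addA hom_addC hom_add0 hom_addN.
End HomZmod.

(* End_A(M), where the product f * g is "first f, then g".  With this
   convention precomposition makes Hom_A(M, X) and D M LEFT modules over
   End_A(M), and on End_A(M) itself it is the left regular action. *)
Definition endR M : Type := hom M M.
HB.instance Definition _ M := GRing.Zmodule.on (endR M).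

Section EndRing.
Variable M : lmodType A.
Definition end_mul (f g : endR M) : endR M := hom_comp g f.
Fact end_mulA : associative end_mul.
Proof. by move=> f g h; apply: hom_ext. Qed.
Fact end_mul1 : left_id (hom_id M : endR M) end_mul.
Proof. by move=> f; apply: hom_ext. Qed.
Fact end_1mul : right_id (hom_id M : endR M) end_mul.
Proof. by move=> f; apply: hom_ext. Qed.
Fact end_mulDl : left_distributive end_mul +%R.
Proof. by move=> f g h; apply: hom_ext => x; apply: homD. Qed.
Fact end_mulDr : right_distributive end_mul +%R.
Proof. by move=> f g h; apply: hom_ext. Qed.
HB.instance Definition _ := GRing.Zmodule_isPzRing.Build (endR M)
  end_mulA end_mul1 end_1mul end_mulDl end_mulDr.
End EndRing.

Definition exact_pair M N P (f : hom M N) (g : hom N P) : Prop :=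
  forall y, g y = 0 <-> exists x, f x = y.

Definition surjective M N (f : hom M N) : Prop := forall y, exists x, f x = y.

Definition fin_gen M : Prop :=
  exists (n : nat) (e : 'I_n -> M),
    forall m, exists c : 'I_n -> A, m = \sum_i c i *: e i.

Definition projective P : Prop :=
  forall M N (g : hom M N) (f : hom P N), surjective g ->
    exists h : hom P M, forall x, g (h x) = f x.

Definition injective_module J : Prop :=
  forall M N (g : hom M N) (f : hom M J), injective g ->
    exists h : hom N J, forall x, h (g x) = f x.

Record submodule M (N : set M) : Prop := Submodule {
  submodule0 : N 0;
  submoduleD : forall x y, N x -> N y -> N (x + y);
  submoduleZ : forall a x, N x -> N (a *: x) }.

Definition injective_envelope M J (phi : hom M J) : Prop :=
  [/\ injective_module J, injective phi &
      forall N : set J, submodule N ->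
        (forall x, N (phi x) -> phi x = 0) -> forall y, N y -> y = 0].

Inductive add_of (T : lmodType A) : lmodType A -> Prop :=
| add_self : add_of T T
| add_sum (X Y : lmodType A) : add_of T X -> add_of T Y -> add_of T (X * Y)%type
| add_summand (X Y Z : lmodType A) (f : hom Z (X * Y)%type) :
    bijective f -> add_of T Z -> add_of T X.

Definition gorenstein_projective G : Prop :=
  fin_gen G /\
  exists (P : int -> lmodType A) (d : forall i, hom (P i) (P (i + 1))),
    [/\ forall i, fin_gen (P i) /\ projective (P i),
        forall i, exact_pair (d i) (d (i + 1)),
        (* exactness of Hom_A(P, Q) *)
        forall Q, fin_gen Q -> projective Q ->
          forall i (f : hom (P (i + 1)) Q),
            (forall x, f (d i x) = 0) <->
            exists g : hom (P (i + 1 + 1)) Q, forall y, g (d (i + 1) y) = f y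
      & (* G is isomorphic to Ker d^0 *)
        exists u : hom G (P 0), injective u /\ exact_pair u (d 0)].

Definition is_generator M : Prop := fin_gen M /\ add_of M A^o.

(* 0 -> X -> T^0 -> ... -> T^(n-1) exact with all T^i in add T; the terms and
   maps of the sequences E and d beyond index n - 1 play no role. *)
Definition has_copresentation (T X : lmodType A) (n : nat) : Prop :=
  exists (E : nat -> lmodType A) (e : hom X (E 0%N))
         (d : forall i, hom (E i) (E i.+1)),
    [/\ forall i, (i < n)%N -> add_of T (E i),
        (0 < n)%N -> injective e,
        (1 < n)%N -> exact_pair e (d 0%N)
      & forall i, (i.+2 < n)%N -> exact_pair (d i) (d i.+1)].

(* Elements of N u {oo} are represented in [\bar int], and suprema are least
   upper bounds there; [0] is only the value of [supremum] on the empty set. *)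
Definition domdim (T X : lmodType A) : \bar int :=
  supremum 0%E
    [set v | exists2 n : nat, has_copresentation T X n & v = (n%:Z)%:E].

End Hom.

Record algebraOver (R : comPzRingType) (A : pzRingType) := AlgebraOver {
  alg_map :> {rmorphism R -> A};
  alg_central : forall r a, alg_map r * a = a * alg_map r }.

Definition restr_scalars (R A : pzRingType) (s : {rmorphism R -> A})
  (M : lmodType A) : Type := M.

Section Restrict.
Variables (R A : pzRingType) (s : {rmorphism R -> A}) (M : lmodType A).

HB.instance Definition _ := GRing.Zmodule.copy (restr_scalars s M) M.

Definition restrict_scale (r : R) (m : restr_scalars s M) : restr_scalars s M :=
  s r *: (m : M).
Fact restrict_scaleA a b v :
  restrict_scale a (restrict_scale b v) = restrict_scale (a * b) v.
Proof. by rewrite /restrict_scale scalerA rmorphM. Qed.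
Fact restrict_scale1 : left_id 1 restrict_scale.
Proof. by move=> v; rewrite /restrict_scale rmorph1 scale1r. Qed.
Fact restrict_scaleDr : right_distributive restrict_scale +%R.
Proof. by move=> a u v; rewrite /restrict_scale scalerDr. Qed.
Fact restrict_scaleDl v : {morph restrict_scale^~ v : a b / a + b}.
Proof. by move=> a b; rewrite /restrict_scale rmorphD scalerDl. Qed.
HB.instance Definition _ := GRing.Zmodule_isLmodule.Build R (restr_scalars s M)
  restrict_scaleA restrict_scale1 restrict_scaleDr restrict_scaleDl.
End Restrict.

Section Restrict_hom.
Variables (R A : pzRingType) (s : {rmorphism R -> A}) (M N : lmodType A).
Variable f : hom M N.
Definition restrict_fun : restr_scalars s M -> restr_scalars s N := f.
Fact restrict_fun_linear : linear restrict_fun.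
Proof.
by move=> a u v; rewrite /restrict_fun (homD f) (homZ f (s a) u).
Qed.
HB.instance Definition _ := GRing.isLinear.Build R (restr_scalars s M)
  (restr_scalars s N) *:%R restrict_fun restrict_fun_linear.
Definition restrict_hom : hom (restr_scalars s M) (restr_scalars s N) :=
  restrict_fun : {linear restr_scalars s M -> restr_scalars s N}.
End Restrict_hom.

Definition artinian (R : comPzRingType) : Prop :=
  forall I : nat -> set R^o, (forall n, submodule (I n)) ->
    (forall n, subset (I n.+1) (I n)) ->
    exists n0, forall n, (n0 <= n)%N -> I n = I n0.

Definition maximal_ideal (R : comPzRingType) (I : set R^o) : Prop :=
  [/\ submodule I, I <> setT &
      forall I' : set R^o, submodule I' -> subset I I' -> I' = I \/ I' = setT].

Definition jacobson_radical (R : comPzRingType) : set R^o :=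
  [set x | forall I : set R^o, maximal_ideal I -> I x].

(* J is an injective envelope of R / rad R; Q is a copy of R / rad R. *)
Definition dualizing_module (R : comPzRingType) (J : lmodType R) : Prop :=
  exists (Q : lmodType R) (p : hom R^o Q) (phi : hom Q J),
    [/\ surjective p, forall x, p x = 0 <-> jacobson_radical x
      & injective_envelope phi].

(* A structure of Artin algebra on the ring A: a commutative artinian base
   ring R, a central morphism R -> A making A a finitely generated R-module,
   and a module J giving the standard duality D = Hom_R(-, J). *)
Record artinAlgebra (A : pzRingType) := ArtinAlgebra {
  artin_base : comPzRingType;
  base_artinian : artinian artin_base;
  base_map :> algebraOver artin_base A;
  base_finite : fin_gen (restr_scalars base_map A^o);
  dualizer : lmodType artin_base;
  dualizerP : dualizing_module dualizer }.

Section Grigdim.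
Variables (A : pzRingType) (S : artinAlgebra A).

Definition dual (M : lmodType A) : Type := hom (restr_scalars S M) (dualizer S).

Section DualModule.
Variable M : lmodType A.
HB.instance Definition _ := GRing.Zmodule.on (dual M).

Definition dual_scale (g : endR M) (x : dual M) : dual M :=
  hom_comp x (restrict_hom S g).
Fact dual_scaleA a b v :
  dual_scale a (dual_scale b v) = dual_scale (a * b) v.
Proof. by apply: hom_ext. Qed.
Fact dual_scale1 : left_id 1 dual_scale.
Proof. by move=> v; apply: hom_ext. Qed.
Fact dual_scaleDr : right_distributive dual_scale +%R.
Proof. by move=> a u v; apply: hom_ext. Qed.
Fact dual_scaleDl v : {morph dual_scale^~ v : a b / a + b}.
Proof. by move=> a b; apply: hom_ext => x; apply: (homD v). Qed.
HB.instance Definition _ := GRing.Zmodule_isLmodule.Build (endR M) (dual M)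
  dual_scaleA dual_scale1 dual_scaleDr dual_scaleDl.
End DualModule.

(* endR M and dual M are both left modules over endR M, by precomposition. *)
Definition Grigdim : \bar int :=
  supremum 0%E
    [set v | exists2 M : lmodType A,
       gorenstein_projective M /\ is_generator M &
       v = domdim (dual M : lmodType (endR M)) ((endR M)^o : lmodType (endR M))].

End Grigdim.

Definition perfect_field (k : fieldType) : Prop :=
  forall p : {poly k}, irreducible_poly p -> separable_poly p.

Definition bilinear_map (k : pzRingType) (U V W : lmodType k)
  (t : U -> V -> W) : Prop :=
  (forall v, linear (t^~ v)) /\ (forall u, linear (t u)).

(* (C, t) is the k-algebra A (x)_k B, with t a b = a (x) b. *)
Record tensor_algebra (k : fieldType) (A B C : pzRingType)
    (iA : algebraOver k A) (iB : algebraOver k B) (iC : algebraOver k C)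
    (t : A -> B -> C) : Prop := TensorAlgebra {
  tensor_bilinear :
    @bilinear_map k (restr_scalars iA A^o) (restr_scalars iB B^o)
      (restr_scalars iC C^o) t;
  tensor_universal : forall (V : lmodType k) (f : A -> B -> V),
    @bilinear_map k (restr_scalars iA A^o) (restr_scalars iB B^o) V f ->
    exists! g : hom (restr_scalars iC C^o) V, forall a b, g (t a b) = f a b;
  tensor_one : t 1 1 = 1;
  tensor_mul : forall a a' b b', t a b * t a' b' = t (a * a') (b * b') }.

Record moduleFunctor (A B : pzRingType) := ModuleFunctor {
  fobj :> lmodType A -> lmodType B;
  fmap : forall M N : lmodType A, hom M N -> hom (fobj M) (fobj N);
  fmap_id : forall M, fmap (hom_id M) = hom_id (fobj M);
  fmap_comp : forall M N P (g : hom N P) (f : hom M N),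
    fmap (hom_comp g f) = hom_comp (fmap g) (fmap f) }.

Definition morita_equivalent (A B : pzRingType) : Prop :=
  exists (F : moduleFunctor A B) (G : moduleFunctor B A)
         (eta : forall M, hom M (G (F M))) (eps : forall N, hom (F (G N)) N),
    [/\ forall M, bijective (eta M),
        forall N, bijective (eps N),
        forall M M' (f : hom M M'),
          hom_comp (eta M') f = hom_comp (fmap G (fmap F f)) (eta M)
      & forall N N' (f : hom N N'),
          hom_comp f (eps N) = hom_comp (eps N') (fmap F (fmap G f))].

(* Main.v *)
From HB Require Import structures.
From mathcomp Require Import functions.
From mathcomp Require Import all_boot all_order all_algebra.
From mathcomp Require Import boolp classical_sets constructive_ereal.
Require Import Defs.

Set Implicit Arguments.
Unset Strict Implicit.
Unset Printing Implicit Defensive.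

Import Order.TTheory GRing.Theory Num.Theory.
Local Open Scope ring_scope.

(** Write m <= Grigdim A as the existence of a Gorenstein projective generator M
for which the module End(M) has a copresentation of length m by add(DM).  The
proof removes the endomorphism ring from this condition.  As M is a generator,
the functor Hom(M, -) is fully faithful ([homF_full], [homF_faithful]), and it
identifies add(D(A)) with add(DM) ([add_dreg_homF], [add_dual_homF]).  Hence a
copresentation of End(M) by add(DM) is the image of an injective copresentation
of M, and exactness of the image means that Ext^i(M, M) = 0 in a range of degrees:
the dominant dimension is at least n + 2 if and only if Ext^i(M, M) = 0 for
0 < i <= n ([has_copresentationP]).

The vanishing of Ext is expressed by a predicate [extv] that mentions injective
modules but neither the base ring nor the duality; this is why Artin structures
over unrelated base rings can be compared.  To produce copresentations by
summands of powers of D(A), one needs that D(A) is an injective cogenerator and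
that it satisfies the descending chain condition over the base ring R.  Both
facts reduce to the injective envelope J of R / rad R
([dualizer_cogenerator], [dualizer_dcc]).

In the same spirit, a Gorenstein projective module is a member of some class of
finitely generated modules that have no Ext^1 against projectives and that have
syzygies and cosyzygies inside the class ([gorensteinP]).  This replaces doubly
infinite complexes by closure properties: such a class may be enlarged by
extensions ([ext_closure_gp]).

By [Grigdim_extnat] each of the three claims is now a transfer of modules M, from
some rings to another one, that preserves Gorenstein projectivity, generation and
the vanishing of Ext^i(M, M).

For a product ring, inflation along a projection is both left and right adjoint to
taking a component, and both functors are exact; see [factor_transfer] for one
direction, and [product_transfer], where M x N is taken, for the other.

For a tensor product over a field k, take M (x) N.  Induction on
syzygies reduces the vanishing of Ext to degree one ([kunneth]), and there it
follows because every C-linear map M (x) N -> M' (x) N' is a finite sum of tensor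
products of maps ([hom_tensor]).  The syzygies of M (x) N are not tensor products but
extensions of such, which suffices for M (x) N to be Gorenstein projective
([tensor_gp]).

For a Morita equivalence, a fully faithful and dense functor is exact and
preserves finite generation ([ff_exact], [ff_fg]), and an equivalence is adjoint
to its inverse on both sides ([morita_transfer]). *)

(** * Linear maps, submodules and quotients *)

Section Basics.
Variable A : pzRingType.
Implicit Types M N P X Y K C : lmodType A.

Definition mkhom M N (f : M -> N) (lf : linear f) : hom M N :=
  HB.pack f (GRing.isLinear.Build A M N *:%R f lf).

Lemma hom0 M N (f : hom M N) : f 0 = 0.
Proof. exact: (raddf0 (f : {linear M -> N})). Qed.
Lemma homN M N (f : hom M N) x : f (- x) = - f x.
Proof. exact: (raddfN (f : {linear M -> N})). Qed.
Lemma homB M N (f : hom M N) x y : f (x - y) = f x - f y.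
Proof. exact: (raddfB (f : {linear M -> N})). Qed.
Lemma hom_sum M N (f : hom M N) I r (Q : pred I) (F : I -> M) :
  f (\sum_(i <- r | Q i) F i) = \sum_(i <- r | Q i) f (F i).
Proof. exact: (raddf_sum (f : {linear M -> N})). Qed.

Lemma hom_compE M N P (g : hom N P) (f : hom M N) x : hom_comp g f x = g (f x).
Proof. by []. Qed.
Lemma hom_addE M N (f g : hom M N) x : (f + g : hom M N) x = f x + g x.
Proof. by []. Qed.
Lemma hom_subE M N (f g : hom M N) x : (f - g : hom M N) x = f x - g x.
Proof. by []. Qed.
Lemma hom_zeroE M N x : (0 : hom M N) x = 0.
Proof. by []. Qed.
Lemma hom_idE M x : hom_id M x = x.
Proof. by []. Qed.
Lemma mkhomE M N (f : M -> N) (lf : linear f) x : mkhom lf x = f x.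
Proof. by []. Qed.
Definition homE := (hom_compE, hom_subE, hom_addE, hom_zeroE, hom_idE).

Lemma ex_hom M N (f : M -> N) : (forall a x y, f (a *: x + y) = a *: f x + f y) ->
  exists g : hom M N, forall x, g x = f x.
Proof. by move=> lf; exists (mkhom lf). Qed.

(** Induced maps on kernels and cokernels are obtained from their graphs, so that
no representatives have to be chosen. *)
Lemma ex_hom_rel M N (R : M -> N -> Prop) :
  (forall x, exists y, R x y) -> (forall x y y', R x y -> R x y' -> y = y') ->
  (forall a x x' y y', R x y -> R x' y' -> R (a *: x + x') (a *: y + y')) ->
  exists g : hom M N, forall x, R x (g x).
Proof.
move=> /choice [f fR] uniqR linR.
have lf : linear f by move=> a x y; apply: (uniqR (a *: x + y)) => //; apply: linR.
by exists (mkhom lf).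
Qed.

Definition short_exact K M C (u : hom K M) (p : hom M C) : Prop :=
  [/\ injective u, exact_pair u p & surjective p].

Lemma injhomP M N (f : hom M N) : (forall x, f x = 0 -> x = 0) -> injective f.
Proof.
move=> f0 x y fxy; apply/eqP; rewrite -subr_eq0; apply/eqP/f0.
by rewrite homB fxy subrr.
Qed.

Lemma injhom0 M N (f : hom M N) x : injective f -> f x = 0 -> x = 0.
Proof. by move=> fI fx; apply: fI; rewrite hom0. Qed.

Lemma exact0 K M C (u : hom K M) (p : hom M C) x : exact_pair u p -> p (u x) = 0.
Proof. by move=> e; apply/e; exists x. Qed.

Lemma factor_inj K M X (u : hom K M) (f : hom X M) : injective u ->
  (forall x, exists k, u k = f x) -> exists g : hom X K, forall x, u (g x) = f x.
Proof.
move=> uI fu; case: (@ex_hom_rel _ _ (fun x k => u k = f x)) => //.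
- by move=> x y y' <- /uI.
- by move=> a x x' y y' e e'; rewrite homD homZ e e' homD homZ.
- by move=> g gP; exists g.
Qed.

Lemma factor_surj M C Y (p : hom M C) (f : hom M Y) : surjective p ->
  (forall x, p x = 0 -> f x = 0) -> exists g : hom C Y, forall x, g (p x) = f x.
Proof.
move=> ps fp.
case: (@ex_hom_rel _ _ (fun c y => exists2 x, p x = c & f x = y)).
- by move=> c; have [x px] := ps c; exists (f x), x.
- move=> c y y' [x px <-] [x' px' <-]; apply/eqP; rewrite -subr_eq0 -homB.
  by apply/eqP/fp; rewrite homB px px' subrr.
- move=> a c c' y y' [x <- <-] [x' <- <-]; exists (a *: x + x');
  by rewrite homD homZ.
- by move=> g gP; exists g => x; have [x' px' <-] := gP (p x);
  apply/eqP; rewrite -subr_eq0 -homB; apply/eqP/fp; rewrite homB px' subrr.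
Qed.

Lemma inv_hom M N (f : hom M N) : bijective f ->
  exists g : hom N M, cancel f g /\ cancel g f.
Proof.
case=> h fK hK; have [||g gP] := @factor_inj _ _ _ f (hom_id N).
- exact: can_inj fK.
- by move=> x; exists (h x); apply: hK.
- by exists g; split=> x; [apply: (can_inj fK)|]; apply: gP.
Qed.

Section SubModule.
Variables (M : lmodType A) (N : set M) (sN : submodule N).

Lemma submoduleN x : N x -> N (- x).
Proof. by rewrite -scaleN1r; apply: submoduleZ. Qed.
Lemma submoduleB x y : N x -> N y -> N (x - y).
Proof. by move=> Nx Ny; apply: submoduleD => //; apply: submoduleN. Qed.

(** The proof that N is a submodule is an argument: it lets the module structure on
[submodT] be inferred from the type. *)
Definition subpred of submodule N : pred M := fun x => `[< N x >].
Lemma subpredP x : reflect (N x) (x \in subpred sN).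
Proof. by rewrite unfold_in; apply: asboolP. Qed.

Fact subpred_closed : submod_closed (subpred sN).
Proof.
split; first by apply/subpredP; apply: submodule0.
move=> a x y /subpredP Nx /subpredP Ny; apply/subpredP.
by apply: submoduleD => //; apply: submoduleZ.
Qed.
HB.instance Definition _ :=
  GRing.isSubmodClosed.Build A M (subpred sN) subpred_closed.

Record submodT := SubmodT { submod_val :> M; _ : submod_val \in subpred sN }.
HB.instance Definition _ := [isSub for submod_val].
HB.instance Definition _ := [Choice of submodT by <:].
HB.instance Definition _ := [SubChoice_isSubLmodule of submodT by <:].

(** Submodules are used through this statement only, without reference to the
carrier type. *)
Lemma ex_submodule : exists (K : lmodType A) (u : hom K M),
  injective u /\ forall x, N x <-> exists k, u k = x.
Proof.
have lv : linear (val : submodT -> M) by move=> a x y; rewrite linearP.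
exists submodT, (mkhom lv); split; first exact: val_inj.
move=> x; split=> [Nx|[k <-]]; last by apply/subpredP/valP.
by have /subpredP xN := Nx; exists (SubmodT xN).
Qed.
End SubModule.
End Basics.

Section Quotient.
Variables (A : pzRingType) (M : lmodType A) (N : set M) (sN : submodule N).

(** Cosets are represented by canonical elements. *)
Definition qcanon (x : M) : M := xget 0 [set y | N (x - y)].

Lemma qcanonP x : N (x - qcanon x).
Proof.
rewrite /qcanon; case: xgetP => [y _ //|/(_ x)] /=.
by rewrite subrr => /(_ (submodule0 sN)).
Qed.

Lemma eq_qcanon x y : N (x - y) -> qcanon x = qcanon y.
Proof.
move=> Nxy; congr xget; apply/seteqP; split=> z /= Nz.
  by rewrite -[y - z](subrKA x) addrC -opprB; apply: submoduleB.
by rewrite -[x - z](subrKA y); apply: submoduleD.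
Qed.

Lemma qcanonK x : qcanon (qcanon x) == qcanon x.
Proof. by apply/eqP/esym/eq_qcanon/qcanonP. Qed.

Record quotT := QuotT { quot_val : M; _ : qcanon quot_val == quot_val }.
HB.instance Definition _ := [isSub for quot_val].
HB.instance Definition _ := [Choice of quotT by <:].

Definition quot_mk x := QuotT (qcanonK x).

Lemma quot_mkP x y : N (x - y) -> quot_mk x = quot_mk y.
Proof. by move=> /eq_qcanon e; apply: val_inj. Qed.
Lemma quot_valK q : quot_mk (quot_val q) = q.
Proof. by apply: val_inj => /=; case: q => q /= /eqP. Qed.
Lemma quot_mk_val x : N (x - quot_val (quot_mk x)).
Proof. exact: qcanonP. Qed.

Definition quot_add p q := quot_mk (quot_val p + quot_val q).
Definition quot_opp p := quot_mk (- quot_val p).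
Definition quot_scale a p := quot_mk (a *: quot_val p).

Lemma quot_mkD x y : quot_mk (x + y) = quot_add (quot_mk x) (quot_mk y).
Proof.
by apply: quot_mkP; rewrite opprD addrACA; apply: submoduleD => //; apply: quot_mk_val.
Qed.
Lemma quot_mkN x : quot_mk (- x) = quot_opp (quot_mk x).
Proof.
by apply: quot_mkP; rewrite -opprD; apply: submoduleN => //; apply: quot_mk_val.
Qed.
Lemma quot_mkZ a x : quot_mk (a *: x) = quot_scale a (quot_mk x).
Proof.
by apply: quot_mkP; rewrite -scalerBr; apply: submoduleZ => //; apply: quot_mk_val.
Qed.

Lemma quot_ind (P : quotT -> Prop) : (forall x, P (quot_mk x)) -> forall q, P q.
Proof. by move=> h q; rewrite -[q]quot_valK. Qed.

Fact quot_addA : associative quot_add.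
Proof.
elim/quot_ind=> x; elim/quot_ind=> y; elim/quot_ind=> z.
by rewrite -!quot_mkD addrA.
Qed.
Fact quot_addC : commutative quot_add.
Proof.
by elim/quot_ind=> x; elim/quot_ind=> y; rewrite -!quot_mkD addrC.
Qed.
Fact quot_add0 : left_id (quot_mk 0) quot_add.
Proof. by elim/quot_ind=> x; rewrite -!quot_mkD add0r. Qed.
Fact quot_addN : left_inverse (quot_mk 0) quot_opp quot_add.
Proof. by elim/quot_ind=> x; rewrite -quot_mkN -!quot_mkD addNr. Qed.
HB.instance Definition _ :=
  GRing.isZmodule.Build quotT quot_addA quot_addC quot_add0 quot_addN.

Lemma quot_mk_add x y : quot_mk x + quot_mk y = quot_mk (x + y).
Proof. by rewrite quot_mkD. Qed.

Fact quot_scaleA a b v : quot_scale a (quot_scale b v) = quot_scale (a * b) v.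
Proof. by elim/quot_ind: v => x; rewrite -!quot_mkZ scalerA. Qed.
Fact quot_scale1 : left_id 1 quot_scale.
Proof. by elim/quot_ind=> x; rewrite -!quot_mkZ scale1r. Qed.
Fact quot_scaleDr : right_distributive quot_scale +%R.
Proof.
move=> a; elim/quot_ind=> x; elim/quot_ind=> y.
by rewrite quot_mk_add -!quot_mkZ quot_mk_add scalerDr.
Qed.
Fact quot_scaleDl v : {morph quot_scale^~ v : a b / a + b}.
Proof.
by elim/quot_ind: v => x a b; rewrite -!quot_mkZ !quot_mk_add scalerDl.
Qed.
HB.instance Definition _ := GRing.Zmodule_isLmodule.Build A quotT
  quot_scaleA quot_scale1 quot_scaleDr quot_scaleDl.

Lemma ex_quotient : exists (C : lmodType A) (p : hom M C),
  surjective p /\ forall x, p x = 0 <-> N x.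
Proof.
have lp : linear (quot_mk : M -> quotT).
  by move=> a x y; rewrite quot_mkD quot_mkZ.
exists quotT, (mkhom lp); split; first by elim/quot_ind=> x; exists x.
move=> x; split=> [/(congr1 quot_val) e|Nx]; last first.
  by apply: (quot_mkP (y := 0)); rewrite subr0.
have := submoduleB sN (quot_mk_val x) (quot_mk_val 0).
by rewrite e sub0r opprK subrK.
Qed.
End Quotient.

Section SES.
Variable A : pzRingType.
Implicit Types M N P X Y K C I : lmodType A.

Lemma ker_submodule M N (f : hom M N) : submodule [set x | f x = 0].
Proof.
split=> /=; first exact: hom0.
  by move=> x y fx fy; rewrite homD fx fy addr0.
by move=> a x fx; rewrite homZ fx scaler0.
Qed.

Lemma im_submodule M N (f : hom M N) : submodule [set y | exists x, f x = y].
Proof.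
split=> /=; first by exists 0; exact: hom0.
  by move=> _ _ [x <-] [y <-]; exists (x + y); rewrite homD.
by move=> a _ [x <-]; exists (a *: x); rewrite homZ.
Qed.

Lemma ex_kernel M N (f : hom M N) :
  exists K (u : hom K M), injective u /\ exact_pair u f.
Proof.
by have [K [u [uI uP]]] := ex_submodule (ker_submodule f); exists K, u.
Qed.

Lemma ex_coker M N (f : hom M N) :
  exists C (p : hom N C), exact_pair f p /\ surjective p.
Proof.
have [C [p [ps pP]]] := ex_quotient (im_submodule f); exists C, p; split=> //.
Qed.

Lemma ex_image M N (f : hom M N) : exists K (q : hom M K) (u : hom K N),
  [/\ surjective q, injective u & forall x, u (q x) = f x].
Proof.
have [K [u [uI uP]]] := ex_submodule (im_submodule f).
have [q qP] : exists q : hom M K, forall x, u (q x) = f x.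
  by apply: factor_inj => // x; apply/uP; exists x.
exists K, q, u; split=> // k; have [x fx] : exists x, f x = u k by apply/uP; exists k.
by exists x; apply: uI; rewrite qP.
Qed.

Definition hom_fst M N : hom (M * N)%type M := mkhom (fun a (x y : (M * N)%type) => erefl (a *: x + y).1).
Definition hom_snd M N : hom (M * N)%type N := mkhom (fun a (x y : (M * N)%type) => erefl (a *: x + y).2).
Fact pair_linear X M N (f : hom X M) (g : hom X N) :
  linear (fun x => (f x, g x) : (M * N)%type).
Proof. by move=> a x y; rewrite !homD !homZ. Qed.
Definition hom_pair X M N (f : hom X M) (g : hom X N) : hom X (M * N)%type :=
  mkhom (pair_linear f g).
Fact copair_linear X M N (f : hom M X) (g : hom N X) :
  linear (fun x : (M * N)%type => f x.1 + g x.2).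
Proof.
by move=> a x y /=; rewrite !homD !homZ scalerDr addrACA.
Qed.
Definition hom_copair X M N (f : hom M X) (g : hom N X) : hom (M * N)%type X :=
  mkhom (copair_linear f g).
Definition hom_inl M N : hom M (M * N)%type := hom_pair (hom_id M) (0 : hom M N).
Definition hom_inr M N : hom N (M * N)%type := hom_pair (0 : hom N M) (hom_id N).

Lemma hom_fstE M N x : hom_fst M N x = x.1.
Proof. by []. Qed.
Lemma hom_sndE M N x : hom_snd M N x = x.2.
Proof. by []. Qed.
Lemma hom_pairE X M N (f : hom X M) (g : hom X N) x : hom_pair f g x = (f x, g x).
Proof. by []. Qed.
Lemma hom_copairE X M N (f : hom M X) (g : hom N X) x :
  hom_copair f g x = f x.1 + g x.2.
Proof. by []. Qed.
Lemma hom_inlE M N x : hom_inl M N x = (x, 0).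
Proof. by []. Qed.
Lemma hom_inrE M N x : hom_inr M N x = (0, x).
Proof. by []. Qed.

Lemma hom_scaler_linear M (x : M) : linear (fun a : A^o => (a : A) *: x).
Proof. by move=> a b c; rewrite scalerDl scalerA. Qed.
(** The isomorphism of M with Hom(A, M). *)
Definition hom_at M (x : M) : hom A^o M := mkhom (hom_scaler_linear x).
Lemma hom_atE M (x : M) a : hom_at x a = (a : A) *: x.
Proof. by []. Qed.

End SES.
Definition pairE := (hom_fstE, hom_sndE, hom_pairE, hom_copairE, hom_inlE, hom_inrE, hom_atE).

Lemma pair_short_exact (A : pzRingType) (X Y : lmodType A) : short_exact (hom_inl X Y) (hom_snd X Y).
Proof.
split.
- by move=> x y; rewrite !pairE => -[].
- move=> [x y]; rewrite pairE /=; split=> [->|[z]]; first by exists x.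
  by case.
- by move=> y; exists (0, y).
Qed.

(** * Vanishing of Ext groups *)

Section Ext.
Variable A : pzRingType.
Implicit Types M N P X Y K C I : lmodType A.

Definition lifts X I C (p : hom I C) :=
  forall f : hom X C, exists h : hom X I, forall x, p (h x) = f x.
Definition extends X' X (u : hom X' X) Y :=
  forall f : hom X' Y, exists g : hom X Y, forall x, g (u x) = f x.

(** Ext^1(X, Y) = 0, tested on embeddings of Y into injective modules. *)
Definition ext1 X Y := forall I C (u : hom Y I) (p : hom I C),
  injective_module I -> short_exact u p -> lifts X p.

(** Ext^i(X, Y) = 0 for 0 < i <= n, by dimension shifting.  Quantifying over all
embeddings of Y into injective modules makes this independent of choices;
[extvS] shows that a single embedding is enough to establish it. *)
Fixpoint extv n X Y : Prop := match n with
  | 0 => True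
  | n.+1 => ext1 X Y /\ forall I C (u : hom Y I) (p : hom I C),
      injective_module I -> short_exact u p -> extv n X C
  end.

Definition enough_injectives := forall Y : lmodType A,
  exists I C (u : hom Y I) (p : hom I C), injective_module I /\ short_exact u p.

(** Y' is a direct summand of Y + I for an injective I.  Cokernels of embeddings
into injective modules are determined up to this relation. *)
Definition stable_retract Y' Y := exists I (a : hom Y' Y) (b : hom Y Y')
  (s : hom Y' I) (t : hom I Y'),
  injective_module I /\ forall y, y = b (a y) + t (s y).

Definition retract Y' Y := exists (a : hom Y' Y) (b : hom Y Y'), cancel a b.

(** A form of the lemma of Schanuel.  The maps a, b and s extend to maps aI, bI and sI
of the injective modules, and the defect id - bI aI - u' t sI vanishes on Y';
it therefore factors through C', where it exhibits C' as a stable retract of C. *)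
Lemma stable_coker Y' I' C' (u' : hom Y' I') (p' : hom I' C')
    Y I C (u : hom Y I) (p : hom I C) :
    injective_module I -> injective_module I' ->
    short_exact u p -> short_exact u' p' -> stable_retract Y' Y ->
  exists (a : hom C' C) (b : hom C C') (bI : hom I I') (w : hom C' I'),
    (forall i, p' (bI i) = b (p i)) /\ forall c, c = b (a c) + p' (w c).
Proof.
move=> iI iI' [uI ue ps] [uI' ue' ps'] [I0 [a [b [s [t [iI0 ab]]]]]].
have [aI aIE] := iI _ _ u' (hom_comp u a) uI'.
have [bI bIE] := iI' _ _ u (hom_comp u' b) uI.
have [sI sIE] := iI0 _ _ u' s uI'.
have [|a' a'E] := factor_surj (p := p') (f := hom_comp p aI) ps'.
  by move=> x /ue' [y <-]; rewrite !homE aIE homE (exact0 _ ue).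
have [|b' b'E] := factor_surj (p := p) (f := hom_comp p' bI) ps.
  by move=> x /ue [y <-]; rewrite !homE bIE homE (exact0 _ ue').
pose z : hom I' I' := hom_id I' - hom_comp bI aI - hom_comp u' (hom_comp t sI).
have zE i : z i = i - bI (aI i) - u' (t (sI i)) by [].
have [|w wE] := factor_surj (p := p') (f := z) ps'.
  move=> x /ue' [y <-]; rewrite zE aIE homE bIE sIE homE.
  by rewrite -!homB -addrA -opprD -ab subrr hom0.
exists a', b', bI, w; split=> [i|c]; first by rewrite b'E.
have [i <-] := ps' c; rewrite a'E wE zE homE b'E homE.
by rewrite !homB (exact0 _ ue') subr0 addrC subrK.
Qed.

Lemma lifts_stable X Y' I' C' (u' : hom Y' I') (p' : hom I' C')
    Y I C (u : hom Y I) (p : hom I C) :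
    injective_module I -> injective_module I' ->
    short_exact u p -> short_exact u' p' -> stable_retract Y' Y ->
  lifts X p -> lifts X p'.
Proof.
move=> iI iI' su su' st lp f.
have [a [b [bI [w [bE cE]]]]] := stable_coker iI iI' su su' st.
have [h hE] := lp (hom_comp a f).
exists (hom_comp bI h + hom_comp w f) => x.
by rewrite !homE homD bE hE homE -cE.
Qed.

Lemma stable_coker_retract Y' I' C' (u' : hom Y' I') (p' : hom I' C')
    Y I C (u : hom Y I) (p : hom I C) :
    injective_module I -> injective_module I' ->
    short_exact u p -> short_exact u' p' -> stable_retract Y' Y ->
  stable_retract C' C.
Proof.
move=> iI iI' su su' st.
have [a [b [bI [w [_ cE]]]]] := stable_coker iI iI' su su' st.
by exists I', a, b, w, p'.
Qed.

Lemma injective_retract I I' : retract I' I -> injective_module I ->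
  injective_module I'.
Proof.
move=> [a [b ab]] iI M N g f gI; have [h hE] := iI _ _ g (hom_comp a f) gI.
by exists (hom_comp b h) => x; rewrite ?homE hE -[RHS]ab homE.
Qed.

Lemma injective_pair I I' : injective_module I -> injective_module I' ->
  injective_module (I * I')%type.
Proof.
move=> iI iI' M N g f gI.
have [h hE] := iI _ _ g (hom_comp (hom_fst I I') f) gI.
have [h' h'E] := iI' _ _ g (hom_comp (hom_snd I I') f) gI.
by exists (hom_pair h h') => x; rewrite pairE hE h'E !homE !pairE; case: (f x).
Qed.

Hypothesis enough : enough_injectives.

Lemma inj_zero : exists I : lmodType A, injective_module I.
Proof. by have [I [_ [_ [_ [iI _]]]]] := enough A^o; exists I. Qed.

Lemma retract_stable Y' Y : retract Y' Y -> stable_retract Y' Y.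
Proof.
case=> a [b ab]; have [I iI] := inj_zero.
exists I, a, b, 0, 0; split=> // y.
by rewrite ab !homE addr0.
Qed.

Lemma retract_refl Y : retract Y Y.
Proof. by exists (hom_id Y), (hom_id Y). Qed.

Lemma extv_stable n X Y' Y : stable_retract Y' Y -> extv n X Y -> extv n X Y'.
Proof.
elim: n Y' Y => [//|n IH] Y' Y st [e1 e2].
have [I [C [u [p [iI su]]]]] := enough Y.
split=> [I' C' u' p' iI' su' | I' C' u' p' iI' su'].
  by apply: (lifts_stable iI iI' su su' st); apply: e1 iI su.
by apply: IH (e2 _ _ _ _ iI su); apply: (stable_coker_retract iI iI' su su' st).
Qed.

Lemma extv_retract n X Y' Y : retract Y' Y -> extv n X Y -> extv n X Y'.
Proof. by move/retract_stable; apply: extv_stable. Qed.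

Lemma extvS n X Y I C (u : hom Y I) (p : hom I C) :
  injective_module I -> short_exact u p -> lifts X p -> extv n X C ->
  extv n.+1 X Y.
Proof.
move=> iI su lp eC; have st := retract_stable (retract_refl Y).
split=> [I' C' u' p' iI' su' | I' C' u' p' iI' su'].
  exact: (lifts_stable iI iI' su su' st).
by apply: extv_stable eC; apply: (stable_coker_retract iI iI' su su' st).
Qed.

Lemma extvW n X Y : extv n.+1 X Y -> extv n X Y.
Proof.
elim: n Y => [//|n IH] Y [e1 e2]; split=> // I C u p iI su.
exact: IH (e2 _ _ _ _ iI su).
Qed.

Lemma extv_le m n X Y : (m <= n)%N -> extv n X Y -> extv m X Y.
Proof.
elim: n => [|n IH]; first by rewrite leqn0 => /eqP ->.
by rewrite leq_eqVlt => /orP [/eqP -> //|/IH h /extvW].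
Qed.

Lemma projective_lifts P I C (p : hom I C) : projective P -> surjective p ->
  lifts P p.
Proof. by move=> pP ps f; apply: pP. Qed.

Lemma extv_projective n P Y : projective P -> extv n P Y.
Proof.
move=> pP; elim: n Y => [//|n IH] Y; split=> // I C u p _ [_ _ ps].
exact: projective_lifts.
Qed.

(** Extending f to a map from X to I leaves an induced map X'' -> C as obstruction;
a lift of the latter to I corrects the extension into Y. *)
Lemma ext1_extends X' X X'' (v : hom X' X) (q : hom X X'') Y :
  short_exact v q -> ext1 X'' Y -> extends v Y.
Proof.
move=> [vI ve qs] e f; have [I [C [u [p [iI su]]]]] := enough Y.
have [uI ue ps] := su; have [g gE] := iI _ _ v (hom_comp u f) vI.
have [|f' f'E] := factor_surj (p := q) (f := hom_comp p g) qs.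
  move=> x /ve [y <-]; rewrite ?homE gE; exact: (exact0 _ ue).
have [h hE] := e _ _ _ _ iI su f'.
have [|r rE] := @factor_inj _ _ _ _ u (g - hom_comp h q) uI.
  move=> x; apply/ue; rewrite ?homE homB hE f'E.
  by rewrite !homE subrr.
exists r => x; apply: uI; rewrite rE !homE.
by rewrite (exact0 x ve) hom0 subr0 gE !homE.
Qed.

(** A converse of [ext1_extends]: Ext^1(X'', Y) sits between the cokernel of
Hom(X, Y) -> Hom(X', Y) and Ext^1(X, Y). *)
Lemma extends_ext1 X' X X'' (v : hom X' X) (q : hom X X'') Y :
  short_exact v q -> ext1 X Y -> extends v Y -> ext1 X'' Y.
Proof.
move=> [vI ve qs] e ex I C u p iI su f; have [uI ue ps] := su.
have [h hE] := e _ _ _ _ iI su (hom_comp f q).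
have [|k kE] := @factor_inj _ _ _ _ u (hom_comp h v) uI.
  move=> x; apply/ue; rewrite homE hE !homE.
  by rewrite ?homE (exact0 _ ve) hom0.
have [k' k'E] := ex k.
have [|r rE] := factor_surj (p := q) (f := h - hom_comp u k') qs.
  move=> x /ve [y <-]; rewrite ?homE k'E kE.
  by rewrite ?homE subrr.
exists r => x; have [y <-] := qs x.
by rewrite rE !homE homB (exact0 _ ue) subr0 hE homE.
Qed.

Lemma extv1 X Y : extv 1 X Y <-> ext1 X Y.
Proof. by split=> [[]|e]. Qed.

(** The long exact sequence in the first variable; the assumption on extensions of
maps accounts for its beginning. *)
Lemma extv_quotient n X' X X'' (v : hom X' X) (q : hom X X'') Y :
  short_exact v q -> extv n.+1 X Y -> extv n X' Y -> extends v Y ->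
  extv n.+1 X'' Y.
Proof.
move=> sv; elim: n Y => [|n IH] Y eX eX' ex.
  by apply/extv1/(extends_ext1 sv) => //; apply/extv1.
split=> [|I C u p iI su]; first by apply: (extends_ext1 sv) => //; case: eX.
apply: IH; first exact: eX.2 iI su.
  exact: eX'.2 iI su.
move=> f; have [h hE] := eX'.1 _ _ _ _ iI su f.
have [vI _ _] := sv; have [g gE] := iI _ _ v h vI.
by exists (hom_comp p g) => x; rewrite ?homE gE hE.
Qed.

Lemma ext1_extension X' X X'' (v : hom X' X) (q : hom X X'') Y :
  short_exact v q -> ext1 X' Y -> ext1 X'' Y -> ext1 X Y.
Proof.
move=> [vI ve qs] e' e'' I C u p iI su f.
have [h hE] := e' _ _ _ _ iI su (hom_comp f v).
have [g gE] := iI _ _ v h vI.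
have [|r rE] := factor_surj (p := q) (f := f - hom_comp p g) qs.
  move=> x /ve [y <-]; rewrite ?homE gE hE.
  by rewrite ?homE subrr.
have [k kE] := e'' _ _ _ _ iI su r.
exists (g + hom_comp k q) => x.
by rewrite !homE homD kE rE !homE addrC subrK.
Qed.

Lemma extv_extension n X' X X'' (v : hom X' X) (q : hom X X'') Y :
  short_exact v q -> extv n X' Y -> extv n X'' Y -> extv n X Y.
Proof.
move=> sv; elim: n Y => [//|n IH] Y [e1' e2'] [e1 e2].
split; first exact: ext1_extension sv e1' e1.
move=> I C u p iI su; apply: IH; [exact: e2' iI su | exact: e2 iI su].
Qed.

(** Both groups are isomorphic to Ext^2(N, Y). *)
Lemma ext1_shift L Q N (v : hom L Q) (q : hom Q N) Y I C (u : hom Y I) (p : hom I C) :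
  projective Q -> short_exact v q -> injective_module I -> short_exact u p ->
  ext1 N C -> ext1 L Y.
Proof.
move=> pQ sv iI su e I' C' u' p' iI' su'.
have st := retract_stable (retract_refl Y).
apply: (lifts_stable iI iI' su su' st) => f.
have [g gE] := ext1_extends sv e f.
have [h hE] := pQ _ _ p g (let: And3 _ _ ps := su in ps).
by exists (hom_comp h v) => x; rewrite ?homE hE gE.
Qed.

Lemma extv_syzygy n L Q N (v : hom L Q) (q : hom Q N) Y :
  projective Q -> short_exact v q -> extv n.+1 N Y -> extv n L Y.
Proof.
move=> pQ sv; elim: n Y => [//|n IH] Y eN; split.
  have [I [C [u [p [iI su]]]]] := enough Y.
  by apply: (ext1_shift pQ sv iI su); have [] := eN.2 _ _ _ _ iI su.
by move=> I C u p iI su; apply: IH; apply: eN.2 iI su.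
Qed.

End Ext.

(** * Finitely generated modules, projective modules and generators *)

Section FgProj.
Variable A : pzRingType.
Implicit Types M N P X Y K C I : lmodType A.

Lemma fg_surj M N (p : hom M N) : surjective p -> fin_gen M -> fin_gen N.
Proof.
move=> ps [n [e eP]]; exists n, (p \o e) => y; have [x <-] := ps y.
have [c ->] := eP x; exists c; rewrite hom_sum.
by apply: eq_bigr => i _; rewrite homZ.
Qed.

Lemma fg_extension K M C (u : hom K M) (p : hom M C) :
  short_exact u p -> fin_gen K -> fin_gen C -> fin_gen M.
Proof.
move=> [uI ue ps] [n [e eP]] [n' [e' e'P]].
have [g gE] := choice (fun i => ps (e' i)).
exists (n + n')%N, (fun i => match fintype.split i with inl j => u (e j) | inr j => g j end).
move=> x; have [c' c'E] := e'P (p x).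
have /ue [k kE] : p (x - \sum_i c' i *: g i) = 0.
  rewrite homB c'E hom_sum; apply/eqP; rewrite subr_eq0; apply/eqP.
  by apply: eq_bigr => i _; rewrite homZ gE.
have [c cE] := eP k.
exists (fun i => match fintype.split i with inl j => c j | inr j => c' j end).
rewrite big_split_ord /=.
under eq_bigr => i _ do rewrite (unsplitK (inl i)).
under [X in _ = _ + X]eq_bigr => i _ do rewrite (unsplitK (inr i)).
under eq_bigr => i _ do rewrite -homZ.
by rewrite -hom_sum -cE kE subrK.
Qed.

Lemma fg_pair M N : fin_gen M -> fin_gen N -> fin_gen (M * N)%type.
Proof. exact: fg_extension (pair_short_exact M N). Qed.

Lemma fg_self : fin_gen (A^o : lmodType A).
Proof.
exists 1%N, (fun => 1) => m; exists (fun => m).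
by rewrite big_ord1 -[LHS]mulr1.
Qed.

Lemma projective_self : projective (A^o : lmodType A).
Proof.
move=> M N g f gs; have [x xE] := gs (f 1); exists (hom_at x) => a.
by rewrite pairE homZ xE -homZ -[_ *: _]/(_ * _) mulr1.
Qed.

(** A module has a dual basis exactly if it is finitely generated and projective. *)
Definition dual_basis P n (e : 'I_n -> P) (xi : 'I_n -> hom P A^o) :=
  forall x, x = \sum_i (xi i x : A) *: e i.

Lemma dual_basis_fg P n (e : 'I_n -> P) xi : dual_basis e xi -> fin_gen P.
Proof. by move=> db; exists n, e => x; exists (fun i => xi i x). Qed.

Lemma dual_basis_projective P n (e : 'I_n -> P) xi :
  dual_basis e xi -> projective P.
Proof.
move=> db M N g f gs; have [z zE] := choice (fun i => gs (f (e i))).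
exists (\sum_i hom_comp (hom_at (z i)) (xi i)) => x.
have -> : (\sum_i hom_comp (hom_at (z i)) (xi i) : hom P M) x =
    \sum_i (xi i x : A) *: z i.
  by elim/big_rec2: _ => // i y h _ <-; rewrite !homE pairE.
rewrite {2}(db x) !hom_sum; apply: eq_bigr => i _.
by rewrite !homZ zE.
Qed.

Definition free n : lmodType A := {ffun 'I_n -> A^o}.

Section Comb.
Variables (M : lmodType A) (n : nat) (e : 'I_n -> M).
Fact comb_linear : linear (fun c : free n => \sum_i (c i : A) *: e i).
Proof.
move=> a c d; rewrite scaler_sumr -big_split /=; apply: eq_bigr => i _.
by rewrite !ffunE scalerDl scalerA.
Qed.
Definition comb : hom (free n) M := mkhom comb_linear.
End Comb.
Lemma combE M n (e : 'I_n -> M) c : comb e c = \sum_i (c i : A) *: e i.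
Proof. by []. Qed.

Fact coord_linear n (i : 'I_n) : linear (fun c : free n => c i).
Proof. by move=> a c d; rewrite !ffunE. Qed.
Definition hom_coord n (i : 'I_n) : hom (free n) A^o := mkhom (coord_linear i).

Lemma free_dual_basis n :
  dual_basis (fun i => [ffun j => (i == j)%:R] : free n) (@hom_coord n).
Proof.
move=> c; apply/ffunP => j; rewrite sum_ffunE (bigD1 j) //= big1 => [|i ij].
  by rewrite !ffunE eqxx addr0 -[RHS]/(_ * _) mulr1.
by rewrite !ffunE (negPf ij) scaler0.
Qed.

Lemma fg_cover M : fin_gen M -> exists P (q : hom P M),
  [/\ fin_gen P, projective P & surjective q].
Proof.
case=> n [e eP]; exists (free n), (comb e); split.
- exact: dual_basis_fg (@free_dual_basis n).
- exact: dual_basis_projective (@free_dual_basis n).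
- move=> x; have [c ->] := eP x; exists [ffun i => c i]; rewrite combE.
  by apply: eq_bigr => i _; rewrite ffunE.
Qed.

Lemma projective_dual_basis P : fin_gen P -> projective P ->
  exists n (e : 'I_n -> P) xi, dual_basis e xi.
Proof.
move=> [n [e eP]] pP.
have [|s sE] := pP _ _ (comb e) (hom_id P).
  move=> x; have [c ->] := eP x; exists [ffun i => c i]; rewrite combE.
  by apply: eq_bigr => i _; rewrite ffunE.
exists n, e, (fun i => hom_comp (hom_coord i) s) => x.
by rewrite -[LHS]sE combE; apply: eq_bigr => i _; rewrite homE.
Qed.

Lemma projective_pair P P' : projective P -> projective P' ->
  projective (P * P')%type.
Proof.
move=> pP pP' M N g f gs.
have [h hE] := pP _ _ g (hom_comp f (hom_inl P P')) gs.
have [h' h'E] := pP' _ _ g (hom_comp f (hom_inr P P')) gs.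
exists (hom_copair h h') => x; rewrite pairE homD hE h'E !homE !pairE -homD.
by case: x => x y; congr (f (_, _)); rewrite /= ?addr0 ?add0r.
Qed.

(** A generator is detected by this property, which, unlike membership of A in
add M, is visibly preserved by equivalences and left adjoints. *)
Definition separates_at M X := forall Y (h : hom X Y),
  (forall (f : hom M X) m, h (f m) = 0) -> forall x, h x = 0.
Definition separates M := forall X, separates_at M X.
(** The form of the generator property that supplies explicit elements, from
which a linear map is recovered from its effect on Hom(M, -). *)
Definition unit_trace M := exists n (a : 'I_n -> hom M A^o) (m : 'I_n -> M),
  \sum_i a i (m i) = 1 :> A.

Lemma add_of_separates M T : add_of M T -> separates_at M T.
Proof.
elim=> {T} [|X Y _ IHX _ IHY|X Y Z f fB _ IH] W h h0.
- by move=> x; have := h0 (hom_id M) x.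
- move=> [x y]; have := IHX _ (hom_comp h (hom_inl _ _)) (fun f m =>
    h0 (hom_comp (hom_inl _ _) f) m) x.
  have := IHY _ (hom_comp h (hom_inr _ _)) (fun f m =>
    h0 (hom_comp (hom_inr _ _) f) m) y.
  rewrite !homE !pairE => e1 e2.
  have -> : (x, y) = (x, 0) + (0, y) :> (X * Y)%type.
    by congr (_, _); rewrite /= ?addr0 ?add0r.
  by rewrite homD e1 e2 addr0.
- have [g [fK gK]] := inv_hom fB => x.
  have := IH _ (hom_comp h (hom_comp (hom_fst _ _) f)) (fun f' m =>
    h0 (hom_comp (hom_comp (hom_fst _ _) f) f') m) (g (x, 0)).
  by rewrite !homE gK pairE.
Qed.

Lemma separates_self M : separates_at M A^o -> separates M.
Proof.
move=> s X Y h h0 x.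
have := s _ (hom_comp h (hom_at x)) (fun f m => h0 (hom_comp (hom_at x) f) m) 1.
by rewrite homE pairE scale1r.
Qed.

(** The projection of A onto its quotient by the trace ideal of M kills all
images of M, so it is zero. *)
Lemma separates_trace M : separates_at M A^o -> unit_trace M.
Proof.
pose N : set (A^o : lmodType A) := fun y =>
  exists n (a : 'I_n -> hom M A^o) (m : 'I_n -> M), \sum_i a i (m i) = y.
have sN : submodule N.
  split; first by exists 0%N, (fun=> 0), (fun=> 0); rewrite big_ord0.
    move=> _ _ [n [a [m <-]]] [n' [a' [m' <-]]]; exists (n + n')%N.
    exists (fun i => match fintype.split i with inl j => a j | inr j => a' j end).
    exists (fun i => match fintype.split i with inl j => m j | inr j => m' j end).
    rewrite big_split_ord /=; congr (_ + _); apply: eq_bigr => i _.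
      by rewrite (unsplitK (inl i)).
    by rewrite (unsplitK (inr i)).
  move=> b _ [n [a [m <-]]]; exists n, a, (fun i => b *: m i).
  by rewrite scaler_sumr; apply: eq_bigr => i _; rewrite homZ.
have [Q [p [ps pP]]] := ex_quotient sN.
move=> /(_ Q p) s; apply/pP/s => f m; apply/pP.
by exists 1%N, (fun=> f), (fun=> m); rewrite big_ord1.
Qed.

(** Some finite power of M maps onto A, and this surjection splits. *)
Lemma trace_add_of M : unit_trace M -> add_of M A^o.
Proof.
case=> n [a [m am]].
have [T [q [t [aT qt]]]] : exists T (q : hom T A^o) t,
    add_of M T /\ q t = \sum_i a i (m i).
  elim: n a m {am} => [|n IH] a m.
    by exists M, 0, 0; split; [apply: add_self|rewrite big_ord0 homE].
  have [T [q [t [aT qt]]]] := IH (fun i => a (widen_ord (leqnSn n) i))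
    (fun i => m (widen_ord (leqnSn n) i)).
  exists (T * M)%type, (hom_copair q (a ord_max)), (t, m ord_max).
  split; first by apply: add_sum => //; apply: add_self.
  by rewrite pairE /= qt big_ord_recr.
have {am}qt : q t = 1 by rewrite qt am.
have qK b : q ((b : A) *: t) = b by rewrite homZ qt -[_ *: _]/(_ * _) mulr1.
have [K [u [uI ue]]] := ex_kernel q.
have [|r rE] := @factor_inj _ _ _ _ u (hom_id T - hom_comp (hom_at t) q) uI.
  by move=> x; apply/ue; rewrite !homE pairE homB qK subrr.
apply: (@add_summand _ _ _ K _ (hom_pair q r)) aT.
exists (fun z => (z.1 : A) *: t + u z.2) => [x|[b k]].
  by rewrite pairE /= rE !homE pairE addrC subrK.
have e1 : q ((b : A) *: t + u k) = b by rewrite homD qK (exact0 _ ue) addr0.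
rewrite pairE e1; congr (_, _); apply: uI.
by rewrite rE !homE pairE /= e1 addrC addKr.
Qed.

Lemma generatorP M : is_generator M <-> fin_gen M /\ separates M.
Proof.
split=> [[fM aM]|[fM sM]]; split=> //.
  by apply/separates_self/add_of_separates.
by apply/trace_add_of/separates_trace.
Qed.

Lemma generator_trace M : is_generator M -> unit_trace M.
Proof. by move=> [_ /add_of_separates /separates_trace]. Qed.
End FgProj.

(** * Gorenstein projective modules *)

Section GP.
Variable A : pzRingType.
Implicit Types M N P X Y K C I Q : lmodType A.

(** The existence of a class with these properties replaces a complete resolution:
its members have syzygies and cosyzygies in the class, and the vanishing of Ext^1
into projectives is what makes the spliced complex exact under Hom(-, Q). *)
Definition gp_class (F : lmodType A -> Prop) := forall X, F X ->
  [/\ fin_gen X,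
      exists P X' (u : hom X P) (p : hom P X'),
        [/\ fin_gen P, projective P, short_exact u p & F X'],
      exists P X' (u : hom X' P) (p : hom P X),
        [/\ fin_gen P, projective P, short_exact u p & F X']
    & forall Q, fin_gen Q -> projective Q -> ext1 X Q].

Definition gp X := exists2 F, gp_class F & F X.

Lemma gp_gp_class : gp_class gp.
Proof.
move=> X [F cF FX]; have [fX [P [X' [u [p [? ? ? FX']]]]] [P' [X'' [u' [p' [? ? ? FX'']]]]] e] := cF _ FX.
split=> //; first by exists P, X', u, p; split=> //; exists F.
by exists P', X'', u', p'; split=> //; exists F.
Qed.

Lemma projective_extends_ext1 K P X (u : hom K P) (p : hom P X) Y :
  projective P -> short_exact u p -> extends u Y -> ext1 X Y.
Proof.
move=> pP su; apply: (extends_ext1 su); apply/extv1; exact: extv_projective.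
Qed.

Lemma int_pred_ex (i : int) : exists j : int, i = j + 1.
Proof. by exists (i - 1); rewrite subrK. Qed.

(** The kernels of the differentials of a complete resolution form a suitable
class. *)
Lemma gorenstein_gp X : gorenstein_projective X -> gp X.
Proof.
move=> [_ [P [d [fpP ex hex [u0 [u0I u0e]]]]]].
pose F Y := exists i (u : hom Y (P i)), injective u /\ exact_pair u (d i).
exists F; last by exists 0, u0.
have right Y i (u : hom Y (P i)) : injective u -> exact_pair u (d i) ->
    exists Y' (p : hom (P i) Y'), short_exact u p /\ F Y'.
  move=> uI ue; have [Y' [q [v [qs vI qv]]]] := ex_image (d i).
  exists Y', q; split.
    split=> // x; split=> [qx|/ue dx]; first by apply/ue; rewrite -qv qx hom0.
    by apply: vI; rewrite qv dx hom0.
  exists (i + 1), v; split=> // y; split=> [/ex [x xE]|[x <-]].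
    by exists (q x); rewrite qv.
  by have [z <-] := qs x; rewrite qv; apply/ex; exists z.
have left Y i (u : hom Y (P (i + 1))) : injective u -> exact_pair u (d (i + 1)) ->
    exists Y' (v : hom Y' (P i)) (p : hom (P i) Y), [/\ short_exact v p,
      exact_pair v (d i), (forall x, u (p x) = d i x) & F Y'].
  move=> uI ue; have [Y' [v [vI ve]]] := ex_kernel (d i).
  have [|p pE] := @factor_inj _ _ _ _ u (d i) uI.
    by move=> x; apply/ue/ex; exists x.
  exists Y', v, p; split=> //; last by exists i, v.
  split=> //.
    move=> x; split=> [px|/ve dx]; first by apply/ve; rewrite -pE px hom0.
    by apply: uI; rewrite pE dx hom0.
  move=> y; have /ex [x xE] : d (i + 1) (u y) = 0 by apply/ue; exists y.
  by exists x; apply: uI; rewrite pE.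
have FE Y : F Y -> exists i (u : hom Y (P (i + 1))), injective u /\ exact_pair u (d (i + 1)).
  by move=> [j]; have [i ->] := int_pred_ex j; exists i.
(* exactness of Hom(-, Q) will be used at P (i + 1), two places to the left *)
have FE3 Y : F Y -> exists i (u : hom Y (P (i + 1 + 1 + 1))),
    injective u /\ exact_pair u (d (i + 1 + 1 + 1)).
  move=> [i]; have [j ->] := int_pred_ex i; have [k ->] := int_pred_ex j.
  by have [l ->] := int_pred_ex k; exists l.
move=> Y FY; have [i [u [uI ue]]] := FE3 _ FY.
have [Y' [v [p [svp ve pE FY']]]] := left _ _ _ uI ue.
split; first by have [_ _ ps] := svp; apply: fg_surj ps (fpP _).1.
- have [Z [q [sq FZ]]] := right _ _ _ uI ue.
  by exists (P (i + 1 + 1 + 1)), Z, u, q; split=> //; case: (fpP (i + 1 + 1 + 1)).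
- by exists (P (i + 1 + 1)), Y', v, p; split=> //; case: (fpP (i + 1 + 1)).
move=> Q fQ pQ; apply: (projective_extends_ext1 (fpP (i + 1 + 1)).2 svp) => f.
have [vI _ _] := svp.
have [_ [_ [p' [[_ _ p's] _ p'E _]]]] := left _ _ _ vI ve.
have [|g gE] := (hex Q fQ pQ i (hom_comp f p')).1.
  move=> x; rewrite homE; have -> : p' (d i x) = 0; last exact: hom0.
  by apply: vI; rewrite p'E hom0; apply: exact0 (ex i).
by exists g => y; have [x <-] := p's y; rewrite p'E gE homE.
Qed.

Section Splice.
Variables (F : lmodType A -> Prop) (Xs : int -> lmodType A).
Hypothesis cF : gp_class F.
Hypothesis FXs : forall i, F (Xs i).
Hypothesis step : forall i, exists P (up : hom (Xs i) P * hom P (Xs (i + 1))),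
  [/\ fin_gen P, projective P & short_exact up.1 up.2].
Hypothesis enough : enough_injectives A.

Let P i := projT1 (cid (step i)).
Let up i := projT1 (cid (projT2 (cid (step i)))).
Let upP i : [/\ fin_gen (P i), projective (P i) & short_exact (up i).1 (up i).2] :=
  projT2 (cid (projT2 (cid (step i)))).
Let d i : hom (P i) (P (i + 1)) := hom_comp (up (i + 1)).1 (up i).2.

(** The short exact sequences Xs i -> P i -> Xs (i + 1), spliced, form a complete
resolution of Xs 0. *)
Lemma gp_splice : gorenstein_projective (Xs 0).
Proof.
split; first by have [] := cF (FXs 0).
have sE i : short_exact (up i).1 (up i).2 by case: (upP i).
exists P, d; split.
- by move=> i; case: (upP i).
- move=> i y; rewrite /d homE; have [_ e ps] := sE (i + 1).
  have [vI _ _] := sE (i + 1 + 1); split=> [e0|[x <-]].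
    have /e [z zE] : (up (i + 1)).2 y = 0 by apply: (injhom0 vI).
    have [_ _ ps'] := sE i; have [x xE] := ps' z.
    by exists x; rewrite homE xE.
  by rewrite homE (exact0 _ e) hom0.
- move=> Q fQ pQ i f; rewrite /d; split=> [f0|[g gE] x]; last first.
    rewrite -gE !homE; have [_ e _] := sE (i + 1).
    by rewrite (exact0 _ e) hom0 hom0.
  have [_ e ps] := sE (i + 1); have [_ _ ps'] := sE i.
  have [|h hE] := factor_surj (p := (up (i + 1)).2) (f := f) ps.
    by move=> x /e [z <-]; have [w <-] := ps' z; have := f0 w; rewrite homE.
  have [_ _ _ e1] := cF (FXs (i + 1 + 1 + 1)).
  have [g gE] := ext1_extends enough (sE (i + 1 + 1)) (e1 Q fQ pQ) h.
  by exists g => y; rewrite homE gE hE.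
- have [vI _ _] := sE (0 + 1); have [uI e _] := sE 0.
  exists (up 0).1; split=> // y; rewrite /d homE; split=> [dy|[x <-]].
    by apply/e; apply: (injhom0 vI).
  by rewrite (exact0 _ e) hom0.
Qed.
End Splice.

(** Cosyzygies are iterated to the right and syzygies to the left. *)
Lemma gp_gorenstein X : enough_injectives A -> gp X -> gorenstein_projective X.
Proof.
move=> enough [F cF FX].
pose T := {Y : lmodType A | F Y}.
pose R (Y Y' : lmodType A) := exists P (up : hom Y P * hom P Y'),
  [/\ fin_gen P, projective P & short_exact up.1 up.2].
have [f fP] : {f : T -> T & forall y, R (sval y) (sval (f y))}.
  apply: (choice (P := fun y y' => R (sval y) (sval y'))) => -[Y FY]; have [_ [P [Y' [u [p [? ? ? FY']]]]] _ _] := cF _ FY.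
  by exists (exist _ Y' FY'), P, (u, p).
have [g gP] : {g : T -> T & forall y, R (sval (g y)) (sval y)}.
  apply: (choice (P := fun y y' => R (sval y') (sval y))) => -[Y FY]; have [_ _ [P [Y' [u [p [? ? ? FY']]]]] _] := cF _ FY.
  by exists (exist _ Y' FY'), P, (u, p).
pose x0 : T := exist _ X FX.
pose Xs (i : int) := match i with
  | Posz n => sval (iter n f x0) | Negz n => sval (iter n.+1 g x0) end.
apply: (@gp_splice F Xs cF _ _ enough).
  by case=> n; [exact: (svalP (iter n f x0))|exact: (svalP (iter n.+1 g x0))].
case=> n; last case: n => [|n].
- have -> : Posz n + 1 = Posz n.+1 by rewrite -addn1.
  exact: fP.
- exact: (gP x0).
- have -> : Negz n.+1 + 1 = Negz n.
    by rewrite !NegzE -[n.+2]addn1 PoszD opprD addrNK.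
  exact: (gP (iter n.+1 g x0)).
Qed.

Lemma gorensteinP X : enough_injectives A -> gorenstein_projective X <-> gp X.
Proof.
by move=> e; split; [apply: gorenstein_gp | apply: gp_gorenstein].
Qed.

Inductive ext_closure (F : lmodType A -> Prop) : lmodType A -> Prop :=
| ext_base X : F X -> ext_closure F X
| ext_step X' X X'' (v : hom X' X) (q : hom X X'') : short_exact v q ->
    ext_closure F X' -> ext_closure F X'' -> ext_closure F X.

(** The horseshoe lemma for cosyzygies; Ext^1(X'', P') = 0 is used to extend u'
from X' to X. *)
Lemma coker_horseshoe X' X X'' (v : hom X' X) (q : hom X X'')
    P' P'' Y' Y'' (u' : hom X' P') (p' : hom P' Y') (u'' : hom X'' P'')
    (p'' : hom P'' Y'') : enough_injectives A -> ext1 X'' P' ->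
    short_exact v q -> short_exact u' p' -> short_exact u'' p'' ->
  exists Y (u : hom X (P' * P'')%type) (p : hom (P' * P'')%type Y)
    (a : hom Y' Y) (b : hom Y Y''), short_exact u p /\ short_exact a b.
Proof.
move=> enough e1 svq [u'I u'e p's] [u''I u''e p''s].
have [w wE] := ext1_extends enough svq e1 u'; have [vI ve qs] := svq.
pose U := hom_pair w (hom_comp u'' q); have UE x : U x = (w x, u'' (q x)) by [].
have Uker x z : U x = (z, 0) -> exists2 y, x = v y & z = u' y.
  rewrite UE => -[<- /(injhom0 u''I) /ve [y <-]]; exists y => //.
have [Y [p [pe ps]]] := ex_coker U.
have Uv y : U (v y) = (u' y, 0) by rewrite UE (exact0 _ ve) hom0 wE.
have [|a aE] := factor_surj (p := p') (f := hom_comp p (hom_inl P' P'')) p's.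
  by move=> x /u'e [y <-]; rewrite homE pairE -Uv (exact0 _ pe).
have [|b bE] := factor_surj (p := p) (f := hom_comp p'' (hom_snd P' P'')) ps.
  by move=> x /pe [y <-]; rewrite homE pairE UE (exact0 _ u''e).
exists Y, U, p, a, b; split; split=> //.
- apply: injhomP => x /Uker [y -> /esym]; move/(injhom0 u'I) ->; exact: hom0.
- apply: injhomP => x; have [z <-] := p's x; rewrite aE homE pairE.
  by move=> /pe [t /Uker [y _ ->]]; rewrite (exact0 _ u'e).
- move=> c; split=> [|[x <-]]; last first.
    have [z <-] := p's x; rewrite aE homE pairE bE homE pairE /=; exact: hom0.
  have [[z1 z2] <-] := ps c; rewrite bE homE pairE /= => /u''e [t].
  have [x <-] := qs t => z2E; exists (p' (z1 - w x)).
  rewrite aE homE pairE; apply/eqP; rewrite -subr_eq0 -homB; apply/eqP/pe.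
  by exists (- x); rewrite UE !homN z2E; congr (_, _); rewrite /= ?sub0r // addrAC subrr add0r.
- move=> y; have [x xE] := p''s y; exists (p (0, x)).
  by rewrite bE homE pairE.
Qed.

(** The horseshoe lemma for syzygies. *)
Lemma ker_horseshoe X' X X'' (v : hom X' X) (q : hom X X'')
    P' P'' K' K'' (k' : hom K' P') (r' : hom P' X') (k'' : hom K'' P'')
    (r'' : hom P'' X'') : projective P'' ->
    short_exact v q -> short_exact k' r' -> short_exact k'' r'' ->
  exists K (k : hom K (P' * P'')%type) (r : hom (P' * P'')%type X)
    (a : hom K' K) (b : hom K K''), short_exact k r /\ short_exact a b.
Proof.
move=> pP [vI ve qs] [k'I k'e r's] [k''I k''e r''s].
have [w wE] := pP _ _ q r'' qs.
pose U := hom_copair (hom_comp v r') w; have UE x : U x = v (r' x.1) + w x.2 by [].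
have [K [k [kI ke]]] := ex_kernel U.
have [|a aE] := @factor_inj _ _ _ _ k (hom_comp (hom_inl P' P'') k') kI.
  by move=> x; apply/ke; rewrite UE homE pairE /= (exact0 _ k'e) !hom0 addr0.
have kK z : r'' (k z).2 = 0.
  have := exact0 z ke; rewrite UE => /(congr1 (hom_fun q)).
  by rewrite homD (exact0 _ ve) add0r wE hom0.
have [|b bE] := @factor_inj _ _ _ _ k'' (hom_comp (hom_snd P' P'') k) k''I.
  by move=> z; apply/k''e; rewrite homE pairE.
exists K, k, U, a, b; split; split=> //.
- move=> x; have [t tE] := r''s (q x).
  have /ve [y yE] : q (x - w t) = 0 by rewrite homB wE tE subrr.
  have [s sE] := r's y; exists (s, t); rewrite UE /= sE yE subrK //.
- apply: injhomP => x /(congr1 (hom_fun k)); rewrite aE homE pairE hom0 => -[/(injhom0 k'I)] //.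
- move=> z; split=> [bz|[y <-]]; last first.
    by apply: k''I; rewrite bE homE pairE aE homE pairE hom0.
  have := exact0 z ke; have := bE z; rewrite bz hom0 homE pairE UE => <-.
  rewrite hom0 addr0 => /(injhom0 vI) /k'e [y yE]; exists y; apply: kI.
  rewrite aE homE pairE yE; have := bE z; rewrite bz hom0 homE pairE.
  by case: (k z) => z1 z2 /= <-.
- move=> y; have /ve [x xE] : q (w (k'' y)) = 0 by rewrite wE (exact0 _ k''e).
  have [s sE] := r's x.
  have /ke [z zE] : U (- s, k'' y) = 0 by rewrite UE /= !homN sE xE addNr.
  by exists z; apply: k''I; rewrite bE homE pairE zE.
Qed.

(** It is enough that syzygies and cosyzygies lie in the extension closure, because
the horseshoe lemmas take care of extensions. *)
Lemma ext_closure_gp F : enough_injectives A ->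
  (forall X, F X ->
  [/\ fin_gen X,
      exists P X' (u : hom X P) (p : hom P X'),
        [/\ fin_gen P, projective P, short_exact u p & ext_closure F X'],
      exists P X' (u : hom X' P) (p : hom P X),
        [/\ fin_gen P, projective P, short_exact u p & ext_closure F X']
    & forall Q, fin_gen Q -> projective Q -> ext1 X Q]) ->
  gp_class (ext_closure F).
Proof.
move=> enough cF X; elim=> {X} [X /cF //|X' X X'' v q svq _
  [fX' [P' [Y' [u' [p' [fP' pP' s1' F1']]]]] [Q' [Z' [k' [r' [fQ' pQ' s2' F2']]]]] e'] _
  [fX'' [P'' [Y'' [u'' [p'' [fP'' pP'' s1'' F1'']]]]] [Q'' [Z'' [k'' [r'' [fQ'' pQ'' s2'' F2'']]]]] e'']].
split.
- exact: fg_extension svq fX' fX''.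
- have [Y [u [p [a [b [sup sab]]]]]] :=
    coker_horseshoe enough (e'' P' fP' pP') svq s1' s1''.
  exists (P' * P'')%type, Y, u, p; split=> //.
  + exact: fg_pair.
  + exact: projective_pair.
  + exact: ext_step sab _ _.
- have [K [k [r [a [b [skr sab]]]]]] := ker_horseshoe pQ'' svq s2' s2''.
  exists (Q' * Q'')%type, K, k, r; split=> //.
  + exact: fg_pair.
  + exact: projective_pair.
  + exact: ext_step sab _ _.
- move=> Q fQ pQ; apply: ext1_extension svq _ _; [exact: e'|exact: e''].
Qed.

Lemma gp_extension X' X X'' (v : hom X' X) (q : hom X X'') :
  enough_injectives A -> short_exact v q -> gp X' -> gp X'' -> gp X.
Proof.
move=> enough svq g' g''; exists (ext_closure gp); last first.
  by apply: ext_step svq _ _; apply: ext_base.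
apply: ext_closure_gp => // Y gY; have [? [P [X1 [u [p [? ? ? ?]]]]]
  [P' [X2 [u' [p' [? ? ? ?]]]]] ?] := gp_gp_class gY.
split=> //; first by exists P, X1, u, p; split=> //; apply: ext_base.
by exists P', X2, u', p'; split=> //; apply: ext_base.
Qed.

(** The third isomorphism theorem for a composite of monomorphisms. *)
Lemma coker_comp X Y Z W V (i : hom X Y) (j : hom Y Z) (k : hom Y W) (l : hom W V) :
  short_exact i j -> short_exact k l ->
  exists C (p : hom W C) (a : hom Z C) (b : hom C V),
    short_exact (hom_comp k i) p /\ short_exact a b.
Proof.
move=> [iI ie js] [kI ke ls]; have [C [p [pe ps]]] := ex_coker (hom_comp k i).
have [|a aE] := factor_surj (p := j) (f := hom_comp p k) js.
  by move=> y /ie [x <-]; rewrite homE -[k (i x)]homE (exact0 _ pe).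
have [|b bE] := factor_surj (p := p) (f := l) ps.
  by move=> y /pe [x <-]; rewrite homE (exact0 _ ke).
exists C, p, a, b; split; split=> //.
- by move=> x y; rewrite !homE => /kI /iI.
- apply: injhomP => z; have [y <-] := js z; rewrite aE homE => /pe [x].
  by rewrite homE => /kI <-; rewrite (exact0 _ ie).
- move=> c; split=> [|[z <-]]; last first.
    by have [y <-] := js z; rewrite aE homE bE (exact0 _ ke).
  have [w <-] := ps c; rewrite bE => /ke [y <-].
  by exists (j y); rewrite aE homE.
- by move=> y; have [x <-] := ls y; exists (p x); rewrite bE.
Qed.

(** The third isomorphism theorem for a composite of epimorphisms. *)
Lemma ker_comp L Y X K W (i : hom L Y) (j : hom Y X) (k : hom K W) (l : hom W Y) :
  short_exact i j -> short_exact k l ->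
  exists C (u : hom C W) (a : hom K C) (b : hom C L),
    short_exact u (hom_comp j l) /\ short_exact a b.
Proof.
move=> [iI ie js] [kI ke ls]; have [C [u [uI ue]]] := ex_kernel (hom_comp j l).
have [|a aE] := @factor_inj _ _ _ _ u k uI.
  by move=> x; apply/ue; rewrite homE (exact0 _ ke) hom0.
have [|b bE] := @factor_inj _ _ _ _ i (hom_comp l u) iI.
  by move=> x; apply/ie; have := exact0 x ue; rewrite !homE.
exists C, u, a, b; split; split=> //.
- by move=> y; have [x <-] := js y; have [w <-] := ls x; exists w; rewrite homE.
- by move=> x y /(congr1 (hom_fun u)); rewrite !aE => /kI.
- move=> c; split=> [bc|[x <-]]; last first.
    by apply: iI; rewrite bE homE aE (exact0 _ ke) hom0.
  have /ke [x xE] : l (u c) = 0 by rewrite -[LHS]homE -bE bc hom0.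
  by exists x; apply: uI; rewrite aE.
- move=> y; have [w wE] := ls (i y).
  have /ue [c cE] : hom_comp j l w = 0 by rewrite homE wE (exact0 _ ie).
  by exists c; apply: iI; rewrite bE homE cE.
Qed.

End GP.

(** * Descending chain conditions *)

Section Dcc.
Variable A : pzRingType.
Implicit Types M X Y C : lmodType A.

(** Stated with minimal elements of families, and relative to a subset K, so that one
can argue along a filtration of a single module. *)
Definition dcc_in M (K : set M) := forall F : set M -> Prop,
  (forall N, F N -> submodule N) -> (forall N x, F N -> N x -> K x) ->
  (exists N, F N) ->
  exists2 N, F N & forall N', F N' -> (forall x, N' x -> N x) -> forall x, N x -> N' x.
Definition dcc M := dcc_in (fun _ : M => True).

Lemma dcc_inW M (K K' : set M) : (forall x, K' x -> K x) -> dcc_in K -> dcc_in K'.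
Proof. by move=> KK' dK F sF FK; apply: dK => // N x FN /(FK _ _ FN) /KK'. Qed.

Lemma dcc_zero M (K : set M) : (forall x, K x -> x = 0) -> dcc_in K.
Proof.
move=> K0 F sF FK [N FN]; exists N => // N' FN' _ x /(FK _ _ FN) /K0 ->.
exact: (submodule0 (sF _ FN')).
Qed.

(** Take a minimal image f(N) in the family and then, among the members whose image
is no larger, one with a minimal intersection with the kernel of f. *)
Lemma dcc_ker M M' (K : set M) (K' : set M') (f : hom M M') :
  (forall x, K x -> K' (f x)) -> dcc_in K' ->
  dcc_in (fun x => K x /\ f x = 0) -> dcc_in K.
Proof.
move=> fK dK' dker F sF FK [N FN].
pose im (N : set M) : set M' := fun y => exists2 x, N x & f x = y.
have [_ [N0 FN0 ->] N0min] : exists2 L, (exists2 N, F N & L = im N) &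
    forall L', (exists2 N, F N & L' = im N) -> (forall x, L' x -> L x) ->
      forall x, L x -> L' x.
  apply: dK'; last by exists (im N), N.
    move=> _ [N' /sF sN' ->]; split.
    - by exists 0; [apply: submodule0|apply: hom0].
    - move=> _ _ [x Nx <-] [y Ny <-]; exists (x + y); last exact: homD.
      exact: submoduleD.
    - move=> a _ [x Nx <-]; exists (a *: x); last exact: homZ.
      exact: submoduleZ.
  by move=> _ _ [N' FN' ->] [x N'x <-]; apply/fK/(FK _ _ FN').
pose G (L : set M) := exists2 N, F N & (forall x, im N x -> im N0 x) /\
  L = (fun x => N x /\ f x = 0).
have [_ [N1 FN1 [N10 ->]] N1min] : exists2 L, G L & forall L', G L' ->
    (forall x, L' x -> L x) -> forall x, L x -> L' x.
  apply: dker; last by exists (fun x => N0 x /\ f x = 0), N0.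
    move=> _ [N' /sF sN' [_ ->]]; split.
    - by split; [apply: submodule0|apply: hom0].
    - move=> x y [Nx fx] [Ny fy]; split; first exact: submoduleD.
      by rewrite homD fx fy addr0.
    - move=> a x [Nx fx]; split; first exact: submoduleZ.
      by rewrite homZ fx scaler0.
  by move=> _ x [N' FN' [_ ->]] [N'x fx]; split=> //; apply: FK N'x.
exists N1 => // N' FN' N'1 x N1x.
have im' z : im N' z -> im N0 z.
  by case=> y /N'1 N1y <-; apply: N10; exists y.
have [y N'y yx] : im N' (f x).
  by apply: (N0min (im N')) => //; [exists N'|apply: N10; exists x].
have [N'xy _] : (fun x => N' x /\ f x = 0) (x - y).
  apply: (N1min (fun x => N' x /\ f x = 0)); [by exists N'|by move=> z [/N'1]|split]; first by
    apply: (submoduleB (sF _ FN1)) => //; apply: N'1.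
  by rewrite homB yx subrr.
by rewrite -[x](subrK y); apply: (submoduleD (sF _ FN') _ _).
Qed.

Lemma dcc_inj M M' (f : hom M M') : injective f -> dcc M' -> dcc M.
Proof.
move=> fI dM'; apply: (dcc_ker (f := f) _ dM') => //.
by apply: dcc_zero => x [_ /(injhom0 fI)].
Qed.

Lemma dcc_im M M' (f : hom M M') : dcc M -> dcc_in (fun y => exists x, f x = y).
Proof.
move=> dM F sF FK [N FN]; pose pre (L : set M') : set M := fun x => L (f x).
have [|//||_ [N1 FN1 ->] N1min] := dM (fun L => exists2 N, F N & L = pre N).
- move=> _ [L /sF sL ->]; split; rewrite /pre.
  + by rewrite hom0; apply: submodule0.
  + by move=> x y Lx Ly; rewrite homD; apply: submoduleD.
  + by move=> a x Lx; rewrite homZ; apply: submoduleZ.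
- by exists (pre N), N.
exists N1 => // N' FN' N'1 y N1y; have [x xy] := FK _ _ FN1 N1y; rewrite -xy.
by apply: (N1min (pre N')); [exists N'|move=> z; apply: N'1|rewrite /pre xy].
Qed.

Lemma dcc_surj M M' (f : hom M M') : surjective f -> dcc M -> dcc M'.
Proof. by move=> fs /(dcc_im (f := f)); apply: dcc_inW => x _; apply: fs. Qed.

(** The common kernels of more and more of the maps form a filtration whose steps embed
into M'. *)
Lemma dcc_family M M' n (f : 'I_n -> hom M M') : dcc M' ->
  (forall x, (forall i, f i x = 0) -> x = 0) -> dcc M.
Proof.
move=> dM' f0.
suff H (l : seq 'I_n) : dcc_in (fun x => forall i, i \notin l -> f i x = 0).
  by apply: dcc_inW (H (enum 'I_n)) => x _ i; rewrite mem_enum.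
elim: l => [|j l IH]; first by apply: dcc_zero => x h; apply: f0 => i; apply: h.
apply: (dcc_ker (f := f j) _ dM') => //; apply: dcc_inW IH => x [h fj] i il.
by case: (eqVneq i j) => [->//|ij]; apply: h; rewrite inE negb_or ij.
Qed.

Lemma dcc_free n : dcc (A^o : lmodType A) -> dcc (free A n).
Proof.
move=> dA; apply: (dcc_family (f := @hom_coord A n)) => // c c0.
by apply/ffunP => i; rewrite ffunE; apply: c0.
Qed.
End Dcc.

(** * Dualizing modules of commutative artinian rings *)

Section CommutativeArtinian.
Variable R : comPzRingType.
Hypothesis aR : artinian R.
Implicit Types (m I : set R^o) (r a b e : R).

(** A family without minimal elements would contain a strictly decreasing sequence, by
dependent choice. *)
Lemma artinian_dcc : dcc (R^o : lmodType R).
Proof.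
move=> F sF _ [I0 FI0]; apply: contrapT => nmin.
pose T := {I | F I}.
have [f fP] : {f : T -> T & forall x, subset (sval (f x)) (sval x) /\
    ~ subset (sval x) (sval (f x))}.
  apply: (choice (P := fun x y : T => subset (sval y) (sval x) /\
    ~ subset (sval x) (sval y))) => -[I FI]; apply: contrapT => h.
  apply: nmin; exists I => // I' FI' I'I x Ix; apply: contrapT => nI'x.
  by apply: h; exists (exist _ I' FI'); split=> //= /(_ _ Ix).
pose x0 : T := exist _ I0 FI0.
have [n||n0 n0P] := aR (I := fun n => sval (iter n f x0)).
- exact: sF (svalP (iter n f x0)).
- by move=> n; have [] := fP (iter n f x0).
- have [_] := fP (iter n0 f x0); apply.
  by have := n0P n0.+1 (leqnSn n0) => /= ->.
Qed.

Definition principal (a : R) : set R^o := fun y => exists b : R, y = b * a.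
Lemma principal_submodule a : submodule (principal a).
Proof.
split; first by exists 0; rewrite mul0r.
  by move=> _ _ [b ->] [c ->]; exists (b + c); rewrite mulrDl.
by move=> c _ [b ->]; exists (c * b); rewrite -mulrA.
Qed.

Definition ideal_add I a : set R^o := fun y => exists i b : R, I i /\ y = i + b * a.
Lemma ideal_add_submodule I a : submodule I -> submodule (ideal_add I a).
Proof.
move=> sI; split.
- by exists 0, 0; split; [exact: (submodule0 sI)|rewrite mul0r addr0].
- move=> _ _ [i [b [Ii ->]]] [i' [b' [Ii' ->]]]; exists (i + i'), (b + b').
  by split; [apply: (submoduleD sI Ii Ii')|rewrite mulrDl addrACA].
- move=> c _ [i [b [Ii ->]]]; exists (c * i), (c * b).
  split; first exact: (submoduleZ sI c Ii).
  by rewrite -[LHS]/(c * _) mulrDr mulrA.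
Qed.
Lemma ideal_mulr I r a : submodule I -> I a -> I (r * a).
Proof. by move=> sI; apply: (submoduleZ sI r). Qed.
Lemma ideal_mull I r a : submodule I -> I a -> I (a * r).
Proof. by rewrite mulrC; apply: ideal_mulr. Qed.

Lemma idealD I a b : submodule I -> I a -> I b -> I (a + b).
Proof. by move=> sI Ia Ib; apply: (submoduleD sI). Qed.
Lemma idealB I a b : submodule I -> I a -> I b -> I (a - b).
Proof. by move=> sI Ia Ib; apply: (submoduleB sI). Qed.

Lemma ideal1 I : submodule I -> I (1 : R) -> I = setT.
Proof.
move=> sI I1; apply/seteqP; split=> // x _.
by rewrite -[x]mulr1; apply: ideal_mulr.
Qed.

Lemma maximal_sub m : maximal_ideal m -> submodule m. Proof. by case. Qed.
Lemma maximal_not1 m : maximal_ideal m -> ~ m (1 : R).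
Proof. by case=> sm mT _ /(ideal1 sm). Qed.

Lemma maximal_inv m a : maximal_ideal m -> ~ m a ->
  exists b c, m c /\ 1 = c + b * a.
Proof.
move=> mm; have [sm _ mmax] := mm => na.
have : (ideal_add m a : set R^o) (1 : R).
  have [e|->//] : ideal_add m a = m \/ ideal_add m a = setT.
    apply: mmax; first exact: ideal_add_submodule.
    by move=> x mx; exists x, 0; rewrite mul0r addr0.
  - case: na; rewrite -e; exists 0, 1; rewrite mul1r add0r; split=> //.
    exact: (submodule0 sm).
by case=> c [b [mc e]]; exists b, c.
Qed.

Lemma maximal_prime m a b : maximal_ideal m -> m (a * b) -> ~ m a -> m b.
Proof.
move=> mm mab na; have sm := maximal_sub mm.
have [c [d [md e]]] := maximal_inv mm na.
rewrite -[b]mul1r e mulrDl; apply: idealD => //; first exact: ideal_mull.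
by rewrite -mulrA; apply: ideal_mulr.
Qed.

Lemma maximal_neq m m' : maximal_ideal m -> maximal_ideal m' -> m <> m' ->
  exists2 y : R, m' y & ~ m y.
Proof.
move=> [sm mT mmax] [sm' m'T m'max] ne; apply: contrapT => h.
have [/ne //|//] : m = m' \/ m = setT.
apply: m'max => // y m'y; apply: contrapT => nmy; apply: h; by exists y.
Qed.

(** Let L be minimal among the ideals strictly containing I, and let x be in L but not
in I.  As L / I is simple, the elements r with r x in I form a maximal ideal. *)
Lemma ex_maximal I : submodule I -> ~ I (1 : R) ->
  exists2 m, maximal_ideal m & forall x, I x -> m x.
Proof.
move=> sI nI1.
have [|||L [sL [IL [x Lx nIx]]] Lmin] := artinian_dcc
  (F := fun L => submodule L /\ (forall x, I x -> L x) /\ exists2 x, L x & ~ I x).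
- by move=> L [].
- by [].
- by exists setT; do ![split=> //]; exists (1 : R).
pose m : set R^o := fun r => I (r * x).
have sm : submodule m.
  split; rewrite /m; first by rewrite mul0r; apply: (submodule0 sI).
    by move=> r s Ir Is; rewrite mulrDl; apply: idealD.
  by move=> a r Ir; rewrite -[a *: r]/(a * r) -mulrA; apply: ideal_mulr.
exists m; last by move=> r Ir; apply: ideal_mull.
split=> //; first by move=> mT; apply: nIx; rewrite -[x]mul1r -/(m 1) mT.
move=> I' sI' mI'.
have [[a I'a nma]|h] := pselect (exists2 a, I' a & ~ m a); [right|left]; last first.
  by apply/seteqP; split=> // a I'a; apply: contrapT => nma; apply: h; exists a.
apply: ideal1 => //.
have [i [b [Ii xE]]] : ideal_add I (a * x) x.
  apply: (Lmin (ideal_add I (a * x)) _ _ x Lx).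
- split; first exact: ideal_add_submodule.
  split; first by move=> y Iy; exists y, 0; rewrite mul0r addr0.
  exists (a * x) => //; exists 0, 1; rewrite mul1r add0r; split=> //.
  exact: (submodule0 sI).
- move=> y [i [b [Ii ->]]]; apply: idealD => //; first exact: IL.
  by apply: ideal_mulr => //; apply: ideal_mulr.
have : m (1 - b * a) by rewrite /m mulrBl mul1r -mulrA {1}xE addrK.
move=> /mI' I1; rewrite -[1](subrK (b * a)); apply: idealD => //.
exact: ideal_mulr.
Qed.

(** Let (e) be minimal among the principal ideals not contained in m.  If y lies in
m' but not in m, then (y e) is again such an ideal, so e lies in (y e) and in m'. *)
Lemma socle_element m : maximal_ideal m -> exists e, ~ m e /\
  forall m', maximal_ideal m' -> m <> m' -> m' e.
Proof.
move=> mm; have [|||_ [e ne ->] emin] := artinian_dcc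
  (F := fun L => exists2 e : R, ~ m e & L = principal e).
- by move=> _ [e _ ->]; apply: principal_submodule.
- by [].
- by exists (principal 1), 1 => //; apply: maximal_not1.
exists e; split=> // m' mm' ne'; have [y m'y nmy] := maximal_neq mm mm' ne'.
have [b ->] : principal (y * e) e.
  apply: (emin (principal (y * e))).
- by exists (y * e) => // mye; apply: ne; apply: maximal_prime mye nmy.
- by move=> _ [b ->]; exists (b * y); rewrite mulrA.
- by exists 1; rewrite mul1r.
by rewrite mulrCA; apply: ideal_mull => //; exact: (maximal_sub mm').
Qed.

Variable J : lmodType R.
Hypothesis dJ : dualizing_module J.

(** The part of the socle of J that is killed by m is a simple module, spanned by the class of
the element e of [socle_element]: that class is killed by r exactly if r e lies
in every maximal ideal, which means that r is in m. *)
Lemma socle_dualizer m : maximal_ideal m -> exists j : J,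
  (forall r, r *: j = 0 <-> m r) /\
  forall x : J, (forall r, m r -> r *: x = 0) -> exists r, x = r *: j.
Proof.
move=> mm; have sm := maximal_sub mm; have [e [ne eP]] := socle_element mm.
have [Q [p [phi [ps pP [iJ phiI ess]]]]] := dJ.
exists (phi (p e)); split=> [r|x mx].
  rewrite -homZ -homZ -[_ *: _]/(r * e); split=> [/(injhom0 phiI) /pP jr|mr].
    have := jr _ mm; rewrite mulrC => /maximal_prime; exact.
  apply/eqP; have -> : p (r * e) = 0; last by rewrite hom0.
  apply/pP => m' mm'; have [<-|ne'] := pselect (m = m').
    exact: ideal_mull.
  by apply: ideal_mulr; [exact: (maximal_sub mm')|apply: eP].
have [->|x0] := pselect (x = 0); first by exists 0; rewrite scale0r.
pose N : set J := fun y => exists s : R, y = s *: x.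
have sN : submodule N.
  split; first by exists 0; rewrite scale0r.
    by move=> _ _ [s ->] [t ->]; exists (s + t); rewrite scalerDl.
  by move=> a _ [s ->]; exists (a * s); rewrite scalerA.
have [q [[s qs] q0]] : exists q, N (phi q) /\ phi q <> 0.
  apply: contrapT => h; apply: x0; apply: (ess N sN); last by exists 1; rewrite scale1r.
  by move=> q Nq; apply: contrapT => q0; apply: h; exists q.
have ns : ~ m s by move=> /mx e0; apply: q0; rewrite qs.
have [b [c [mc e1]]] := maximal_inv mm ns.
have [t tq] := ps q; pose t' : R := b * t.
have xE : x = phi (p t').
  rewrite -[LHS]scale1r e1 scalerDl mx // add0r -scalerA -qs -tq.
  by rewrite -homZ -homZ.
have rad_t' (u : R) : m u -> jacobson_radical (u * t' : R^o).
  move=> mu; apply/pP; apply: phiI.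
  by rewrite -[u * t']/(u *: (t' : R^o)) (homZ p u) (homZ phi u) -xE mx // hom0.
have t'P m' : maximal_ideal m' -> m <> m' -> m' t'.
  move=> mm' ne'; have ne2 : m' <> m by move=> e2; apply: ne'.
  have [u mu nu] := maximal_neq mm' mm ne2.
  have m'ut : m' (u * t') by have := rad_t' u mu; apply.
  exact: maximal_prime mm' m'ut nu.
have [b' [c' [mc' e2]]] := maximal_inv mm ne.
exists (t' * b'); have -> : (t' * b') *: phi (p e) = phi (p (t' * b' * e)) by rewrite -!homZ.
rewrite xE; apply/eqP; rewrite -subr_eq0 -!homB; apply/eqP; have -> : p (t' - t' * b' * e) = 0; last exact: hom0.
apply/pP => m' mm'; have [<-|ne'] := pselect (m = m').
  rewrite -mulrA -{1}[t']mulr1 -mulrBr; apply: ideal_mulr => //.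
  by rewrite e2 addrK.
apply: (idealB (maximal_sub mm')); first exact: t'P.
by apply: ideal_mulr; [exact: (maximal_sub mm')|apply: eP].
Qed.

(** The submodule generated by x has a quotient R / m, which embeds into J. *)
Lemma dualizer_cogenerator (X : lmodType R) (x : X) : x <> 0 ->
  exists h : hom X J, h x <> 0.
Proof.
move=> x0; pose I : set R^o := fun r => (r : R) *: x = 0.
have sI : submodule I := ker_submodule (hom_at x).
have nI1 : ~ I (1 : R) by rewrite /I scale1r.
have [m mm Im] := ex_maximal sI nI1.
have [j [jP _]] := socle_dualizer mm.
have [S [q [u [qs uI uq]]]] := ex_image (hom_at x).
have [|g gE] := factor_surj (p := q) (f := hom_at j) qs.
  move=> r qr; rewrite pairE; apply/jP/Im.
  by rewrite /I -[LHS]/(hom_at x r) -uq qr hom0.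
have [Q [p [phi [_ _ [iJ _ _]]]]] := dJ.
have [h hE] := iJ _ _ u g uI; exists h.
have <- : u (q 1) = x by rewrite uq pairE scale1r.
by rewrite hE gE pairE => /jP /(maximal_not1 mm).
Qed.

(** A part of Matlis duality, by which J even has finite length.  Among the ideals whose
annihilator in J satisfies the chain condition let I be minimal.  If I is not zero,
it has a functional h to J with simple image.  The annihilator of the kernel I' of h
is an extension: multiplication by an element x of I outside I' maps it to the simple
submodule Jm, and what is killed is the annihilator of I.  So I' contradicts
minimality. *)
Lemma dualizer_dcc : dcc J.
Proof.
pose ann I : set J := fun j => forall r : R, I r -> r *: j = 0.
have [|||I [sI dI] Imin] := artinian_dcc
  (F := fun I => submodule I /\ dcc_in (ann I)).
- by move=> I [].
- by [].
- exists setT; do !split=> //; apply: dcc_zero => x h.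
  by rewrite -[x]scale1r; apply: h.
suff I0 r : I r -> r = 0.
  by apply: dcc_inW dI => j _ r /I0 ->; rewrite scale0r.
move=> Ir; apply: contrapT => r0.
(* a functional on I, killing m I, whose image is simple *)
have [m [h [x [mm Ix hI hx]]]] : exists m (h : hom R^o J) (x : R),
    [/\ maximal_ideal m, I x, (forall u z : R, m u -> I z -> h (u * z) = 0) & h x <> 0].
  have [|||L [sL [y [i [Ly Ii yi]]]] Lmin] := artinian_dcc
    (F := fun L => submodule L /\ exists y i : R, [/\ L y, I i & y * i <> 0]).
  - by move=> L [].
  - by [].
  - by exists setT; do !split=> //; exists 1, r; rewrite mul1r.
  pose ay : set R^o := fun r => (r : R) * y = 0.
  have say : submodule ay := ker_submodule (hom_at (y : R^o)).
  have nay1 : ~ ay (1 : R) by rewrite /ay mul1r => y0; apply: yi; rewrite y0 mul0r.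
  have [m mm aym] := ex_maximal say nay1.
  have [h0 h0P] := dualizer_cogenerator (yi : (y * i : R^o) <> 0).
  have lh : linear (fun r : R^o => h0 (y * r : R^o)).
    move=> a b c; rewrite mulrDr homD; congr (_ + _).
    by rewrite -homZ; congr (h0 _); rewrite -[a *: b]/(a * b) mulrCA.
  exists m, (mkhom lh), i; split=> // u z mu Iz; rewrite mkhomE.
  have [e|ne] := pselect (y * (u * z) = 0); first by rewrite e hom0.
  have [b yE] : principal (u * y) y.
    apply: (Lmin (principal (u * y)) _ _ y Ly).
  - split; first exact: principal_submodule.
    exists (u * y), z; split=> //; first by exists 1; rewrite mul1r.
    by rewrite -mulrA mulrCA.
  - by move=> _ [b ->]; apply: ideal_mulr => //; apply: ideal_mulr.
  have : m (1 - b * u) by apply: aym; rewrite /ay mulrBl mul1r -mulrA -yE subrr.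
  move=> m1; case: (maximal_not1 mm); rewrite -[1](subrK (b * u)).
  apply: idealD => //; first exact: maximal_sub mm.
  by apply: ideal_mulr => //; apply: maximal_sub mm.
have sm := maximal_sub mm; have [j [jP jspan]] := socle_dualizer mm.
pose I' : set R^o := fun y => I y /\ h y = 0.
have hm (y : R) : I y -> exists s, h y = s *: j.
  move=> Iy; apply: jspan => u mu; rewrite -homZ; exact: hI.
have [s hxE] := hm x Ix.
have ns : ~ m s by move=> /jP e; apply: hx; rewrite hxE.
have [b [c [mc e1]]] := maximal_inv mm ns.
have jE : j = b *: h x.
  by rewrite hxE scalerA -[LHS]scale1r e1 scalerDl (proj2 (jP c) mc) add0r.
case: hx; suff [] : I' x by [].
apply: (Imin I') => //; last by move=> y [].
split.
  split; first by split; [apply: (submodule0 sI)|apply: hom0].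
    by move=> y z [Iy hy] [Iz hz]; split; [apply: idealD|rewrite homD hy hz addr0].
  by move=> a y [Iy hy]; split; [apply: submoduleZ|rewrite homZ hy scaler0].
(* the socle of J at m, a simple module *)
pose Jm : set J := fun y => forall u : R, m u -> u *: y = 0.
have dJm : dcc_in Jm.
  move=> F sF FJ [N FN].
  have [[N' [FN' N'0]]|hF] := pselect (exists N', F N' /\ forall y, N' y -> y = 0).
    exists N' => // N'' FN'' _ y /N'0 ->; exact: (submodule0 (sF _ FN'')).
  exists N => // N' FN' _ y /(FJ _ _ FN) /jspan [t ->].
  apply: (submoduleZ (sF _ FN') _ _).
  have [z [N'z z0]] : exists z, N' z /\ z <> 0.
    apply: contrapT => h'; apply: hF; exists N'; split=> // z N'z.
    by apply: contrapT => z0; apply: h'; exists z.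
  have [t' zE] := jspan z (FJ _ _ FN' N'z).
  have nt' : ~ m t' by move=> /jP e; apply: z0; rewrite zE.
  have [b' [c' [mc' e2]]] := maximal_inv mm nt'.
  rewrite -[j]scale1r e2 scalerDl (proj2 (jP c') mc') add0r -scalerA -zE.
  exact: (submoduleZ (sF _ FN') _ _).
have lx : linear (fun y : J => x *: y).
  by move=> a y z; rewrite scalerDr !scalerA mulrC.
apply: (dcc_ker (K' := Jm) (f := mkhom lx)) => //.
  move=> y yI' u mu; rewrite mkhomE scalerA; apply: yI'.
  by split; [apply: ideal_mulr|apply: hI].
apply: dcc_inW dI => y [yI' xy] z Iz; rewrite mkhomE in xy.
have [s' hzE] := hm z Iz.
have I'z : I' (z - s' * b * x).
  split; first by apply: idealB => //; apply: ideal_mulr.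
  by rewrite homB -[_ * _]/((s' * b) *: (x : R^o)) homZ -scalerA -jE hzE subrr.
by rewrite -[z](subrK (s' * b * x)) scalerDl yI' // add0r -scalerA xy scaler0.
Qed.
End CommutativeArtinian.

(** * The dual of the regular module *)

Section DualRegular.
Variables (A : pzRingType) (S : artinAlgebra A).
Implicit Types X Y C M N : lmodType A.
Notation R := (artin_base S).
Notation J := (dualizer S).

Lemma restrict_scaleE M (r : R) (x : restr_scalars S M) :
  r *: x = (S r *: (x : M) : M).
Proof. by []. Qed.

(** The module D(A), on which A acts from the left through its right action on
itself. *)
Definition dreg : Type := hom (restr_scalars S (A^o : lmodType A)) J.
HB.instance Definition _ := GRing.Zmodule.on dreg.

Definition dreg_scale (a : A) (f : dreg) : dreg :=
  hom_comp f (restrict_hom S (hom_at (a : A^o))).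
Lemma dreg_scaleE a f x : (dreg_scale a f : hom _ _) x = (f : hom _ _) (x * a).
Proof. by []. Qed.
Fact dreg_scaleA a b v : dreg_scale a (dreg_scale b v) = dreg_scale (a * b) v.
Proof. by apply: hom_ext => x; rewrite !dreg_scaleE mulrA. Qed.
Fact dreg_scale1 : left_id 1 dreg_scale.
Proof. by move=> v; apply: hom_ext => x; rewrite !dreg_scaleE mulr1. Qed.
Fact dreg_scaleDr : right_distributive dreg_scale +%R.
Proof. by move=> a u v; apply: hom_ext. Qed.
Fact dreg_scaleDl v : {morph dreg_scale^~ v : a b / a + b}.
Proof.
by move=> a b; apply: hom_ext => x; rewrite dreg_scaleE mulrDr (homD v).
Qed.
HB.instance Definition _ := GRing.Zmodule_isLmodule.Build A dreg
  dreg_scaleA dreg_scale1 dreg_scaleDr dreg_scaleDl.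

Definition dreg_fun (f : dreg) : hom (restr_scalars S (A^o : lmodType A)) J := f.
Lemma dreg_addE (f g : dreg) x : dreg_fun (f + g) x = dreg_fun f x + dreg_fun g x.
Proof. by []. Qed.
Lemma dreg_actE a (f : dreg) x : dreg_fun (a *: f) x = dreg_fun f (x * a).
Proof. by []. Qed.

Section ToDreg.
Variables (X : lmodType A) (h : hom (restr_scalars S X) J).
Fact to_dreg_subproof (x : X) :
  linear (fun a : restr_scalars S (A^o : lmodType A) => h ((a : A) *: x)).
Proof.
move=> r a b; rewrite restrict_scaleE.
rewrite -(homZ h) -(homD h); congr (h _).
by rewrite -[S r *: _]/(S r * _) scalerDl restrict_scaleE scalerA.
Qed.
Definition to_dreg_fun (x : X) : dreg := mkhom (to_dreg_subproof x).
Fact to_dreg_linear : linear to_dreg_fun.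
Proof.
move=> a x y; apply: hom_ext => b; rewrite -[RHS]/(h ((b * a) *: x) + h (b *: y)).
by rewrite -[LHS]/(h (b *: (a *: x + y))) scalerDr scalerA (homD h).
Qed.
(** The isomorphism Hom_R(X, J) = Hom_A(X, D(A)). *)
Definition to_dreg : hom X dreg := mkhom to_dreg_linear.
Lemma to_dregE x a : dreg_fun (to_dreg x) a = h ((a : A) *: x).
Proof. by []. Qed.
End ToDreg.

Section FromDreg.
Variables (X : lmodType A) (f : hom X dreg).
Fact from_dreg_linear : linear (fun x : restr_scalars S X => dreg_fun (f x) 1).
Proof.
move=> r x y; rewrite restrict_scaleE homD dreg_addE homZ dreg_actE mul1r.
congr (_ + _); rewrite -(homZ (dreg_fun (f x))).
by rewrite restrict_scaleE -[S r *: _]/(S r * 1) mulr1.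
Qed.
Definition from_dreg : hom (restr_scalars S X) J := mkhom from_dreg_linear.
Lemma from_dregE x : from_dreg x = dreg_fun (f x) 1.
Proof. by []. Qed.
Lemma from_dregK : to_dreg from_dreg = f.
Proof.
apply: hom_ext => x; apply: hom_ext => a.
rewrite -[LHS]/(dreg_fun (to_dreg from_dreg x) a) to_dregE from_dregE homZ.
by rewrite dreg_actE mul1r.
Qed.
End FromDreg.

Lemma dualizer_injective : injective_module J.
Proof. by have [Q [p [phi [_ _ [iJ _ _]]]]] := dualizerP S. Qed.

Lemma dreg_injective : injective_module (dreg : lmodType A).
Proof.
move=> M N g f gI.
have [h hE] := dualizer_injective (g := restrict_hom S g) (from_dreg f) gI.
exists (to_dreg h) => x; apply: hom_ext => a.
rewrite -[LHS]/(dreg_fun (to_dreg h (g x)) a) to_dregE -homZ.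
transitivity (from_dreg f ((a : A) *: x)); first exact: (hE ((a : A) *: x)).
by rewrite from_dregE homZ dreg_actE mul1r.
Qed.

Lemma dreg_cogenerator X (x : X) : x <> 0 ->
  exists f : hom X (dreg : lmodType A), f x <> 0.
Proof.
move=> x0; have [h hx] := dualizer_cogenerator (@base_artinian A S) (dualizerP S)
  (x0 : (x : restr_scalars S X) <> 0).
exists (to_dreg h) => e; apply: hx.
by have := to_dregE h x 1; rewrite scale1r e => <-.
Qed.

(** Y embeds into the product of copies of D(A) indexed by all maps from Y to D(A). *)
Lemma artin_enough_injectives : enough_injectives A.
Proof.
move=> Y; pose I : lmodType A := (hom Y (dreg : lmodType A)) -> dreg.
have lu : linear (fun y : Y => (fun f => f y) : I).
  by move=> a x y; apply/funext => f; rewrite homD homZ.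
pose u : hom Y I := mkhom lu.
have uI : injective u.
  apply: injhomP => y uy; apply: contrapT => y0.
  have [f fy] := dreg_cogenerator y0; apply: fy.
  by have := congr1 (fun i : I => i f) uy.
have [C [p [pe ps]]] := ex_coker u.
exists I, C, u, p; split=> // M N g f gI.
have lev i : linear (fun z : I => z i) by move=> a z z'.
have /choice [h hE] : forall i, exists h : hom N (dreg : lmodType A),
    forall x, h (g x) = f x i.
  by move=> i; have [h hE] := dreg_injective (hom_comp (mkhom (lev i)) f) gI; exists h.
have lh : linear (fun y : N => (fun i => h i y) : I).
  by move=> a x y; apply/funext => i; rewrite homD homZ.
by exists (mkhom lh) => x; apply/funext => i; rewrite mkhomE hE.
Qed.

Definition dccR X := dcc (restr_scalars S X).

Lemma dccR_inj X Y (f : hom X Y) : injective f -> dccR Y -> dccR X.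
Proof. exact: (dcc_inj (f := restrict_hom S f)). Qed.
Lemma dccR_surj X Y (f : hom X Y) : surjective f -> dccR X -> dccR Y.
Proof. exact: (dcc_surj (f := restrict_hom S f)). Qed.

Lemma dccR_pair X Y : dccR X -> dccR Y -> dccR (X * Y)%type.
Proof.
move=> dX dY; apply: (dcc_ker (f := restrict_hom S (hom_snd X Y)) _ dY) => //.
apply: dcc_inW (dcc_im (f := restrict_hom S (hom_inl X Y)) dX).
move=> [x y] [_ yE]; exists x; have y0 : y = 0 := yE; by rewrite y0.
Qed.

Lemma dccR_self : dccR (A^o : lmodType A).
Proof.
have [n [e eP]] := base_finite S.
apply: (dcc_surj (f := comb e)).
  by move=> x; have [c ->] := eP x; exists [ffun i => c i]; rewrite combE;
    apply: eq_bigr => i _; rewrite ffunE.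
apply: dcc_free; exact: artinian_dcc (@base_artinian A S).
Qed.

Lemma dccR_fg X : fin_gen X -> dccR X.
Proof.
case=> n [e eP]; apply: (dccR_surj (f := comb e)).
  by move=> x; have [c ->] := eP x; exists [ffun i => c i]; rewrite combE;
    apply: eq_bigr => i _; rewrite ffunE.
apply: (dcc_family (f := fun i => restrict_hom S (@hom_coord A n i)) dccR_self).
by move=> c c0; apply/ffunP => i; rewrite ffunE; apply: c0.
Qed.

(** A linear form on A is determined by its values on finitely many generators over
the base ring, so D(A) embeds into a power of J. *)
Lemma dccR_dreg : dccR (dreg : lmodType A).
Proof.
have [n [e eP]] := base_finite S.
have lev i : linear (fun f : restr_scalars S (dreg : lmodType A) => dreg_fun f (e i)).
  move=> r f g; rewrite dreg_addE restrict_scaleE dreg_actE; congr (_ + _).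
  transitivity (dreg_fun f (S r * (e i : A) : A)).
    by congr (dreg_fun f _); apply: esym; exact: (alg_central S r (e i)).
  exact: (homZ (dreg_fun f) r (e i)).
apply: (dcc_family (f := fun i => mkhom (lev i)) (dualizer_dcc (@base_artinian A S) (dualizerP S))).
move=> f f0; apply: hom_ext => x; rewrite -[LHS]/(dreg_fun f x) -[RHS]/(0 : J).
have [c ->] := eP x; rewrite hom_sum big1 // => i _.
by rewrite homZ; have -> : dreg_fun f (e i) = 0 := f0 i; rewrite scaler0.
Qed.

Notation inj_fg := (add_of (dreg : lmodType A)).

Lemma add_dreg_injective I : inj_fg I -> injective_module I.
Proof.
elim=> {I} [|X Y _ iX _ iY|X Y Z f fB _ iZ]; first exact: dreg_injective.
- exact: injective_pair.
- have [g [fK gK]] := inv_hom fB; apply: injective_retract iZ.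
  by exists (hom_comp g (hom_inl X Y)), (hom_comp (hom_fst X Y) f) => x;
    rewrite !homE gK !pairE.
Qed.

Lemma add_dreg_dcc I : inj_fg I -> dccR I.
Proof.
elim=> {I} [|X Y _ iX _ iY|X Y Z f fB _ iZ]; first exact: dccR_dreg.
- exact: dccR_pair.
- have [g [fK gK]] := inv_hom fB.
  apply: (dccR_inj (f := hom_comp g (hom_inl X Y))) iZ.
  by move=> x y; rewrite !homE => /(can_inj gK); rewrite !pairE => -[].
Qed.

(** A map from X to add D(A) with minimal kernel is injective: otherwise a further map
to D(A) that does not vanish on its kernel could be added to it. *)
Lemma dcc_embed X : dccR X -> exists I (u : hom X I), inj_fg I /\ injective u.
Proof.
move=> dX.
have [|||_ [I [u aI ->]] umin] := dX (fun L => exists I, exists2 u : hom X I,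
    inj_fg I & L = (fun x => u x = 0)).
- by move=> _ [I [u _ ->]]; exact: (ker_submodule (restrict_hom S u)).
- by [].
- by exists (fun x => (0 : hom X (dreg : lmodType A)) x = 0), dreg, 0 => //; apply: add_self.
exists I, u; split=> //; apply: injhomP => x ux; apply: contrapT => x0.
have [f fx] := dreg_cogenerator x0; apply: fx.
have : hom_pair u f x = 0.
  apply: (umin (fun x => hom_pair u f x = 0)) => //; last by move=> z [].
  by exists (I * dreg)%type, (hom_pair u f) => //; apply: add_sum => //; apply: add_self.
by case.
Qed.

(** The cokernel satisfies the chain condition again, so this step can be iterated. *)
Lemma dcc_coresolution X : dccR X -> exists I C (u : hom X I) (p : hom I C),
  [/\ inj_fg I, short_exact u p & dccR C].
Proof.
move=> dX; have [I [u [aI uI]]] := dcc_embed dX; have [C [p [pe ps]]] := ex_coker u.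
exists I, C, u, p; split=> //.
by apply: dccR_surj ps _; apply: add_dreg_dcc.
Qed.
End DualRegular.

(** * The functor Hom(M, -) *)

Section HomModule.
Variables (A : pzRingType) (M : lmodType A).
Implicit Types X Y C I : lmodType A.

(** Precomposition makes Hom(M, X) a left module over End(M). *)
Definition homM X : Type := hom M X.
HB.instance Definition _ X := GRing.Zmodule.on (homM X).

Section Lmod.
Variable X : lmodType A.
Definition homM_scale (g : endR M) (x : homM X) : homM X := hom_comp x g.
Fact homM_scaleA a b v : homM_scale a (homM_scale b v) = homM_scale (a * b) v.
Proof. exact: hom_ext. Qed.
Fact homM_scale1 : left_id 1 homM_scale.
Proof. by move=> v; apply: hom_ext. Qed.
Fact homM_scaleDr : right_distributive homM_scale +%R.
Proof. by move=> a u v; apply: hom_ext. Qed.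
Fact homM_scaleDl v : {morph homM_scale^~ v : a b / a + b}.
Proof. by move=> a b; apply: hom_ext => x; apply: (homD v). Qed.
HB.instance Definition _ := GRing.Zmodule_isLmodule.Build (endR M) (homM X)
  homM_scaleA homM_scale1 homM_scaleDr homM_scaleDl.
End Lmod.

Definition homF X : lmodType (endR M) := homM X.

Lemma homF_scaleE X (g : endR M) (x : homF X) : g *: x = hom_comp x g :> hom M X.
Proof. by []. Qed.

Section Post.
Variables (X Y : lmodType A) (f : hom X Y).
Fact homF_map_linear : linear (fun g : homF X => hom_comp f (g : hom M X) : homF Y).
Proof.
by move=> a g h; apply: hom_ext => m; rewrite homE (homD f).
Qed.
Definition homF_map : hom (homF X) (homF Y) := mkhom homF_map_linear.
Lemma homF_mapE (g : homF X) : homF_map g = hom_comp f g :> hom M Y.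
Proof. by []. Qed.
End Post.

Fact homF_self_linear : linear (fun g : homF M => (g : (endR M)^o)).
Proof. by []. Qed.
Definition from_homF_self : hom (homF M) (endR M)^o := mkhom homF_self_linear.
Fact self_homF_linear : linear (fun g : (endR M)^o => (g : homF M)).
Proof. by []. Qed.
Definition to_homF_self : hom (endR M)^o (homF M) := mkhom self_homF_linear.

Section Pair.
Variables X Y : lmodType A.
Definition homF_split : hom (homF (X * Y)%type) (homF X * homF Y)%type :=
  hom_pair (homF_map (hom_fst X Y)) (homF_map (hom_snd X Y)).
Lemma homF_split_bij : bijective homF_split.
Proof.
exists (fun z : (homF X * homF Y)%type => hom_pair (z.1 : hom M X) (z.2 : hom M Y) : homF (X * Y)%type).
  move=> g; apply: hom_ext => m.
  by rewrite -[LHS]/((hom_fun g m).1, (hom_fun g m).2); case: (hom_fun g m).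
by move=> [x y]; rewrite pairE; congr (_, _); apply: hom_ext.
Qed.
End Pair.

Lemma add_iso (B : pzRingType) (T X Z : lmodType B) (f : hom Z X) :
  bijective f -> add_of T Z -> add_of T X.
Proof.
move=> fB; have [g [fK gK]] := inv_hom fB; have [K [u [uI ue]]] := ex_kernel (hom_id X).
have K0 (k : K) : k = 0 by apply: uI; rewrite hom0; have /ue : exists x, u x = u k by exists k.
apply: (@add_summand _ _ _ K _ (hom_pair f (0 : hom Z K))).
exists (fun z => g z.1) => [z|[x k]]; first by rewrite pairE fK.
by rewrite pairE gK (K0 k).
Qed.

Section Dual.
Variable S : artinAlgebra A.
Notation D := (dreg S : lmodType A).
Notation DM := (dual S M : lmodType (endR M)).

Fact dual_homF_linear : linear (fun h : DM => to_dreg (h : hom _ _) : homF D).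
Proof.
move=> g h h'; apply: hom_ext => m; apply: hom_ext => a.
pose am : M := (a : A) *: m; pose gm : M := (g : hom M M) m.
rewrite -[LHS]/((h : hom (restr_scalars S M) _) ((g : hom M M) am) + (h' : hom (restr_scalars S M) _) am).
rewrite -[RHS]/((h : hom (restr_scalars S M) _) ((a : A) *: gm) + (h' : hom (restr_scalars S M) _) am).
by rewrite (homZ (g : hom M M)).
Qed.
(** The isomorphism D(M) = Hom_A(M, D(A)). *)
Definition dual_homF : hom DM (homF D) := mkhom dual_homF_linear.
Lemma dual_homF_bij : bijective dual_homF.
Proof.
exists (fun f : homF D => from_dreg (f : hom M D) : DM) => [h|f].
  apply: hom_ext => m; rewrite -[LHS]/((h : hom (restr_scalars S M) _) (1 *: (m : M))).
  by rewrite scale1r.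
exact: from_dregK.
Qed.

Lemma add_dreg_homF I : add_of D I -> add_of DM (homF I).
Proof.
elim=> {I} [|X Y _ iX _ iY|X Y Z f fB _ iZ].
- by apply: add_iso dual_homF_bij _; apply: add_self.
- have [g [fK gK]] := inv_hom (homF_split_bij X Y).
  by apply: (add_iso (f := g)); [exists (homF_split X Y)|apply: add_sum].
- have [g [fK gK]] := inv_hom fB.
  have [h [hK kK]] := inv_hom (homF_split_bij X Y).
  apply: (@add_summand _ _ _ (homF Y) _ (hom_comp (homF_split X Y) (homF_map f))) iZ.
  exists (hom_comp (homF_map g) h) => [z|z]; rewrite !homE.
    by rewrite hK; apply: hom_ext => m; rewrite !homF_mapE !homE fK.
  rewrite -[RHS]kK; congr (homF_split _ _ _).
  by apply: hom_ext => m; rewrite !homF_mapE !homE gK.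
Qed.
End Dual.

Section Generator.
Hypothesis genM : is_generator M.

Lemma trace_ex : exists n (a : 'I_n -> hom M A^o) (m : 'I_n -> M),
  forall X (x : X), x = \sum_i hom_comp (hom_at x) (a i) (m i).
Proof.
have [n [a [m am]]] := generator_trace genM; exists n, a, m => X x.
rewrite -[LHS]scale1r -am scaler_suml; apply: eq_bigr => i _.
by rewrite homE pairE.
Qed.

Lemma homF_faithful X Y (f : hom X Y) : (forall g : homF X, homF_map f g = 0) ->
  forall x, f x = 0.
Proof.
move=> f0; have [_ sM] := (generatorP M).1 genM.
apply: sM => g m; have := congr1 (fun h : homF Y => hom_fun h m) (f0 g).
by rewrite homF_mapE homE.
Qed.

(** Since x is the sum of the (a_i x)(m_i), the value of f at x has to be the sum of
the Phi(a_i x)(m_i).  Linearity of Phi over End(M) shows that this f induces Phi. *)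
Lemma homF_full X Y (Phi : hom (homF X) (homF Y)) : exists f : hom X Y,
  forall g, Phi g = homF_map f g.
Proof.
have [n [a [m xE]]] := trace_ex.
pose b X (x : X) i : homF X := hom_comp (hom_at x) (a i).
pose phi x : Y := \sum_i hom_fun (Phi (b X x i)) (m i).
have phiD x y : phi (x + y) = phi x + phi y.
  rewrite -big_split; apply: eq_bigr => i _ /=.
  have -> : b X (x + y) i = b X x i + b X y i.
    by apply: hom_ext => z; rewrite homE pairE scalerDr.
  by rewrite homD.
have phig (g : homF X) z : phi (hom_fun g z) = hom_fun (Phi g) z.
  rewrite [in RHS](xE M z) (hom_sum (Phi g : hom M Y)); apply: eq_bigr => i _.
  have -> : b X (hom_fun g z) i = (b M z i : endR M) *: g.
    by apply: hom_ext => w; rewrite homF_scaleE !homE !pairE (homZ g).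
  by rewrite homZ homF_scaleE homE.
have phi0 : phi 0 = 0 by apply: (addIr (phi 0)); rewrite -phiD !add0r.
have lphi : linear phi.
  move=> c x y; rewrite phiD; congr (_ + _).
  have phi_sum r (F : 'I_n -> X) : phi (\sum_(i <- r) F i) = \sum_(i <- r) phi (F i).
    elim: r => [|i r IH]; first by rewrite !big_nil.
    by rewrite !big_cons phiD IH.
  rewrite {1}(xE X x) scaler_sumr phi_sum scaler_sumr; apply: eq_bigr => i _.
  by rewrite -homZ (phig (b X x i)) homZ.
by exists (mkhom lphi) => g; apply: hom_ext => z; rewrite homF_mapE homE mkhomE phig.
Qed.

Variable S : artinAlgebra A.
Notation D := (dreg S : lmodType A).
Notation DM := (dual S M : lmodType (endR M)).

(** For a direct summand of Hom(M, I), the idempotent that cuts it out comes from an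
idempotent endomorphism of I, whose image is again injective. *)
Lemma add_dual_homF T : add_of DM T ->
  exists I (th : hom (homF I) T) (th' : hom T (homF I)),
    [/\ injective_module I, cancel th th' & cancel th' th].
Proof.
elim=> {T} [|X Y _ [I [th [th' [iI K K']]]] _ [I1 [th1 [th1' [iI1 K1 K1']]]]
  |X Y Z f fB _ [I [th [th' [iI K K']]]]].
- have [g [gK Kg]] := inv_hom (dual_homF_bij S); exists D, g, (dual_homF S); split=> //.
  exact: dreg_injective.
- have [h [hK kK]] := inv_hom (homF_split_bij I I1).
  exists (I * I1)%type, (hom_comp (hom_pair (hom_comp th (hom_fst _ _)) (hom_comp th1 (hom_snd _ _))) (homF_split I I1)).
  exists (hom_comp h (hom_pair (hom_comp th' (hom_fst _ _)) (hom_comp th1' (hom_snd _ _)))).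
  split; first exact: injective_pair.
    move=> g; set z := homF_split I I1 g.
    transitivity (h (th' (th z.1), th1' (th1 z.2))); first by [].
    by rewrite K K1 -surjective_pairing; apply: hK.
  move=> [x y]; set z := (th' x, th1' y) : (homF I * homF I1)%type.
  transitivity (th (homF_split I I1 (h z)).1, th1 (homF_split I I1 (h z)).2); first by [].
  by rewrite kK K' K1'.
- have [g [fK gK]] := inv_hom fB.
  (* the idempotent of Hom(M, I) that cuts out X *)
  pose E := hom_comp th' (hom_comp g (hom_comp (hom_inl X Y) (hom_comp (hom_fst X Y) (hom_comp f th)))).
  have EE z : E z = th' (g ((f (th z)).1, 0)) by [].
  have [ep epE] := homF_full E; have [I' [q [u [qs uI uq]]]] := ex_image ep.
  have epep x : ep (ep x) = ep x.
    apply/eqP; rewrite -subr_eq0; apply/eqP.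
    apply: (homF_faithful (f := hom_comp ep ep - ep)) => h.
    have e1 : homF_map ep (homF_map ep h) = homF_map ep h.
      by rewrite -!epE !EE K' gK.
    apply: hom_ext => m; rewrite -[LHS]/(ep (ep (hom_fun h m)) - ep (hom_fun h m)).
    have := congr1 (fun k : homF I => hom_fun k m) e1; rewrite !homF_mapE !homE => ->.
    by rewrite subrr.
  have qu x : q (u x) = x.
    by have [z <-] := qs x; apply: uI; rewrite !uq epep.
  have iI' : injective_module I' by apply: injective_retract iI; exists u, q.
  exists I', (hom_comp (hom_fst X Y) (hom_comp f (hom_comp th (homF_map u)))).
  exists (hom_comp (homF_map q) (hom_comp th' (hom_comp g (hom_inl X Y)))).
  split=> // z; rewrite !homE !pairE.
    have := EE (homF_map u z); rewrite epE => <-.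
    by apply: hom_ext => m; rewrite !homF_mapE !homE -uq !qu.
  have -> w : homF_map u (homF_map q w) = E w.
    by rewrite epE; apply: hom_ext => m; rewrite !homF_mapE !homE uq.
  by rewrite EE K' gK K' gK.
Qed.

(** The copresentation is the image of an injective copresentation Y -> I -> I1.  The
cokernel C of the first map inherits a copresentation that is one step shorter, and
exactness at E 1 says that Hom(M, I) -> Hom(M, C) is onto. *)
Lemma copresentation_extv n Y (E : nat -> lmodType (endR M)) (e : hom (homF Y) (E 0%N))
    (d : forall i, hom (E i) (E i.+1)) : enough_injectives A ->
  (forall i, (i < n.+2)%N -> add_of DM (E i)) -> injective e -> exact_pair e (d 0%N) ->
  (forall i, (i < n)%N -> exact_pair (d i) (d i.+1)) -> extv n M Y.
Proof.
move=> enough; have [nt [at_ [mt xE]]] := trace_ex.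
elim: n Y E e d => [//|n IH] Y E e d aE eI e0 ed.
have [I [th [th' [iI K K']]]] := add_dual_homF (aE 0%N isT).
have [I1 [th1 [th1' [iI1 K1 K1']]]] := add_dual_homF (aE 1%N isT).
have [I2 [th2 [th2' [iI2 K2 K2']]]] := add_dual_homF (aE 2%N isT).
have [u uE] := homF_full (hom_comp th' e).
have [de deE] := homF_full (hom_comp th1' (hom_comp (d 0%N) th)).
have [de1 de1E] := homF_full (hom_comp th2' (hom_comp (d 1%N) th1)).
have ue y : homF_map u y = th' (e y) by rewrite -uE.
have dee y : homF_map de y = th1' (d 0%N (th y)) by rewrite -deE.
have de1e y : homF_map de1 y = th2' (d 1%N (th1 y)) by rewrite -de1E.
pose bt X (x : X) i : homF X := hom_comp (hom_at x) (at_ i).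
have homF_at X X' (f : hom X X') x i : f x = 0 -> homF_map f (bt _ x i) = 0.
  by move=> fx; apply: hom_ext => m; rewrite homF_mapE !homE pairE homZ fx scaler0.
have uI : injective u.
  apply: injhomP => y uy; rewrite (xE _ y) big1 // => i _.
  have /(congr1 (fun g : homF Y => hom_fun g (mt i))) // : bt _ y i = 0.
  by apply: eI; rewrite hom0 -[LHS]K' -ue homF_at // hom0.
have [C [p [pe ps]]] := ex_coker u.
have deu y : de (u y) = 0.
  apply: (homF_faithful (f := hom_comp de u)) => g.
  have -> : homF_map (hom_comp de u) g = homF_map de (homF_map u g) by apply: hom_ext.
  by rewrite ue dee K' (exact0 _ e0) hom0.
have [|c cE] := factor_surj (p := p) (f := de) ps.
  by move=> x /pe [y <-].
(* Hom(M, -) reflects exactness at I because M is a generator *)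
have cI : injective c.
  apply: injhomP => z; have [x <-] := ps z; rewrite cE => dx.
  have /choice [b bE] : forall i, exists b : homF Y, homF_map u b = bt _ x i.
    move=> i; have /e0 [b bE] : d 0%N (th (bt _ x i)) = 0.
      by rewrite -[LHS]K1' -dee homF_at // hom0.
    by exists b; rewrite ue bE K.
  apply/pe; exists (\sum_i hom_fun (b i) (mt i)); rewrite hom_sum [RHS](xE _ x).
  apply: eq_bigr => i _; have := congr1 (fun g : homF I => hom_fun g (mt i)) (bE i).
  by rewrite homF_mapE homE.
pose e' := hom_comp th1 (homF_map c).
have e'p w : e' (homF_map p (th' w)) = d 0%N w.
  rewrite -[w in RHS]K' -[RHS]K1' -dee homE; congr (th1 _).
  by apply: hom_ext => m; rewrite !homF_mapE !homE cE.
have su : short_exact u p by [].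
have e'I : injective e'.
  move=> g h; rewrite !homE => /(can_inj K1) gh; apply: hom_ext => m; apply: cI.
  by have := congr1 (fun k : homF I1 => hom_fun k m) gh; rewrite !homF_mapE !homE.
have e1 := ed 0%N isT.
have de1c y : de1 (c y) = 0.
  have [x <-] := ps y; rewrite cE.
  apply: (homF_faithful (f := hom_comp de1 de)) => g.
  have -> : homF_map (hom_comp de1 de) g = homF_map de1 (homF_map de g) by apply: hom_ext.
  by rewrite de1e dee K1' (exact0 _ e1) hom0.
have e'e : exact_pair e' (d 1%N).
  move=> y; split=> [/e1 [w <-]|[g <-]]; first by exists (homF_map p (th' w)).
  rewrite -[LHS]K2' homE -de1e (_ : homF_map de1 _ = 0) ?hom0 //.
  by apply: hom_ext => m; rewrite !homF_mapE !homE de1c.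
apply: (extvS enough iI su).
  move=> f; have /e1 [w wE] : d 1%N (e' (f : homF C)) = 0 by apply/e'e; exists f.
  have fE : f = homF_map p (th' w) by apply: e'I; rewrite e'p.
  by exists (th' w) => m; rewrite fE homF_mapE homE.
apply: (IH C (fun i => E i.+1) e' (fun i => d i.+1)) => //.
- by move=> i ni; apply: aE.
- by move=> i ni; apply: ed.
Qed.

Lemma has_copresentation_extv n : enough_injectives A ->
  has_copresentation DM ((endR M)^o : lmodType (endR M)) n.+2 -> extv n M M.
Proof.
move=> enough [E [e [d [aE eI e0 ed]]]].
apply: (copresentation_extv (e := hom_comp e from_homF_self) (d := d)) => //.
- by move=> x y; rewrite !homE => /(eI isT).
- move=> y; rewrite (e0 isT); split=> [[x <-]|[x <-]]; first by exists (to_homF_self x).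
  by exists (from_homF_self x).
Qed.
End Generator.
End HomModule.

(** * Dominant dimension and self-extensions *)

Section Copresentation.
Variables (A : pzRingType) (S : artinAlgebra A) (M : lmodType A).
Hypothesis fgM : fin_gen M.
Notation D := (dreg S : lmodType A).
Notation DM := (dual S M : lmodType (endR M)).

Section Splice.
Variable Xs : nat -> lmodType A.
Hypothesis step : forall i, exists I (up : hom (Xs i) I * hom I (Xs i.+1)),
  add_of D I /\ short_exact up.1 up.2.
Let I i := projT1 (cid (step i)).
Let up i := projT1 (cid (projT2 (cid (step i)))).
Let aI i : add_of D (I i) := (projT2 (cid (projT2 (cid (step i))))).1.
Let se i : short_exact (up i).1 (up i).2 := (projT2 (cid (projT2 (cid (step i))))).2.

Lemma splice_extv i n : extv (i + n) M (Xs 0) -> extv n M (Xs i).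
Proof.
elim: i n => [//|i IH] n; rewrite addSnnS => /IH [_ h].
exact: h (add_dreg_injective (aI i)) (se i).
Qed.

Let E i : lmodType (endR M) := homF M (I i).
Let d i : hom (E i) (E i.+1) := homF_map M (hom_comp (up i.+1).1 (up i).2).

(** The kernel of the differential is Hom(M, -) of the cosyzygy, since Hom(M, -) is left
exact. *)
Lemma splice_exact i (g : E i) : d i g = 0 <-> exists h : homF M (Xs i), homF_map M (up i).1 h = g.
Proof.
have [vI _ _] := se i.+1; have [uI e ps] := se i.
split=> [dg|[h <-]]; last first.
  by apply: hom_ext => m; rewrite !homF_mapE !homE (exact0 _ e) hom0.
have [|h hE] := @factor_inj _ _ _ _ (up i).1 (g : hom M (I i)) uI.
  move=> m; apply/e/(injhom0 vI).
  by have := congr1 (fun k : E i.+1 => hom_fun k m) dg; rewrite homF_mapE !homE.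
by exists h; apply: hom_ext => m; rewrite homF_mapE homE hE.
Qed.

Lemma splice_copresentation n : extv n M (Xs 0) ->
  exists (E : nat -> lmodType (endR M)) (e : hom (homF M (Xs 0)) (E 0%N))
         (d : forall i, hom (E i) (E i.+1)),
    [/\ forall i, add_of DM (E i), injective e, exact_pair e (d 0%N)
      & forall i, (i < n)%N -> exact_pair (d i) (d i.+1)].
Proof.
move=> ex; exists E, (homF_map M (up 0%N).1), d; split.
- by move=> i; apply: add_dreg_homF.
- have [uI _ _] := se 0%N => g h gh; apply: hom_ext => m; apply: uI.
  by have := congr1 (fun k : E 0%N => hom_fun k m) gh; rewrite !homF_mapE !homE.
- by move=> y; apply: splice_exact.
- move=> i i_n y; rewrite splice_exact; split=> [[h <-]|[x <-]]; last first.
    exists (homF_map M (up i).2 x); exact: hom_ext.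
  have [e1 _] : extv 1 M (Xs i).
    by apply: splice_extv; apply: extv_le ex; rewrite addn1.
  have [g gE] := e1 _ _ _ _ (add_dreg_injective (aI i)) (se i) (h : hom M (Xs i.+1)).
  by exists (g : hom M (I i)); apply: hom_ext => m; rewrite !homF_mapE !homE gE.
Qed.
End Splice.

Lemma extv_has_copresentation n : extv n M M ->
  has_copresentation DM ((endR M)^o : lmodType (endR M)) n.+2.
Proof.
move=> ex; pose T := {X : lmodType A | dccR S X}.
pose R (X X' : lmodType A) := exists I (up : hom X I * hom I X'),
  add_of D I /\ short_exact up.1 up.2.
have [f fP] : {f : T -> T & forall x, R (sval x) (sval (f x))}.
  apply: (choice (P := fun x y : T => R (sval x) (sval y))) => -[X dX].
  have [I [C [u [p [aI su dC]]]]] := dcc_coresolution dX.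
  by exists (exist _ C dC), I, (u, p).
pose x0 : T := exist _ M (@dccR_fg A S M fgM).
have [E [e [d [aE eI e0 ed]]]] :=
  @splice_copresentation (fun n => sval (iter n f x0)) (fun i => fP _) n ex.
exists E, (hom_comp e (to_homF_self M)), d; split.
- by move=> i _; apply: aE.
- by move=> _ x y; rewrite !homE => /eI.
- move=> _ y; rewrite (e0 y); split=> [[x <-]|[x <-]]; first by exists (from_homF_self M x).
  by exists (to_homF_self M x).
- by move=> i; rewrite !ltnS => i_n; apply: ed.
Qed.

Lemma copresentation_le (B : pzRingType) (T X : lmodType B) m n : (m <= n)%N ->
  has_copresentation T X n -> has_copresentation T X m.
Proof.
move=> mn [E [e [d [aE eI e0 ed]]]]; exists E, e, d; split.
- by move=> i im; apply: aE; apply: leq_trans mn.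
- by move=> m0; apply: eI; apply: leq_trans mn.
- by move=> m0; apply: e0; apply: leq_trans mn.
- by move=> i im; apply: ed; apply: leq_trans mn.
Qed.

(** The theorem of Mueller on dominant dimension.  Left exactness of Hom(M, -) gives
the first two terms of the copresentation, whence the truncated subtraction. *)
Lemma has_copresentationP n : is_generator M ->
  has_copresentation DM ((endR M)^o : lmodType (endR M)) n <-> extv (n - 2) M M.
Proof.
move=> gM; case: n => [|[|n]]; rewrite ?subSS ?subn0.
- split=> // _; apply: (@copresentation_le _ _ _ 0 2) => //.
  exact: extv_has_copresentation.
- split=> // _; apply: (@copresentation_le _ _ _ 1 2) => //.
  exact: extv_has_copresentation.
- split=> [|/extv_has_copresentation //].
  by apply: has_copresentation_extv => //; apply: artin_enough_injectives S.
Qed.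
End Copresentation.

Lemma gp_projective (A : pzRingType) (P : lmodType A) :
  fin_gen P -> projective P -> gp P.
Proof.
move=> fP pP; exists (fun P => fin_gen P /\ projective P) => //.
move=> X [fX pX]; split=> //.
- have [K [p [pe ps]]] := ex_coker (hom_id X).
  have K0 (k : K) : k = 0 by have [x <-] := ps k; apply/pe; exists x.
  have sp : short_exact (hom_id X) p by split=> // x y.
  exists X, K, (hom_id X), p; split=> //; split; first exact: (fg_surj ps fX).
  by move=> M N g f gs; exists 0 => x; rewrite (K0 x) !hom0.
- have [K [u [uI ue]]] := ex_kernel (hom_id X).
  have K0 (k : K) : k = 0 by apply: uI; rewrite hom0; have /ue : exists x, u x = u k by exists k.
  exists X, K, u, (hom_id X); split=> //; first by split=> // x; exists x.
  split; first by exists 0%N, (fun=> 0) => m; exists (fun => 0); rewrite big_ord0.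
  by move=> M N g f gs; exists 0 => x; rewrite (K0 x) !hom0.
- by move=> Q _ _; apply/extv1/extv_projective.
Qed.

Section Height.
Local Open Scope ereal_scope.
Local Notation "n %:N" := ((n%:Z)%:E : \bar int) (at level 2).

(** The possible suprema of nonempty sets of natural numbers. *)
Definition extnat (v : \bar int) := v = +oo \/ exists n : nat, v = n%:N.

Lemma le_natN (m n : nat) : (m%:N <= n%:N) = (m <= n)%N.
Proof. by rewrite lee_fin lez_nat. Qed.

Lemma extnat_le v w : extnat v -> extnat w ->
  (forall m : nat, m%:N <= v -> m%:N <= w) -> v <= w.
Proof.
move=> [->|[n ->]] [->|[k ->]] h; rewrite ?leey //.
  by have := h k.+1 (leey _); rewrite le_natN ltnn.
exact: h.
Qed.

Lemma extnat_eq v w : extnat v -> extnat w ->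
  (forall m : nat, m%:N <= v <-> m%:N <= w) -> v = w.
Proof.
move=> ev ew h; apply/eqP; rewrite eq_le; apply/andP.
by split; apply: extnat_le => // m /h.
Qed.

Lemma supremum_eq (E : set (\bar int)) s : supremums E s -> (exists v, E v) ->
  supremum 0 E = s.
Proof.
move=> Es [v Ev]; rewrite /supremum; case: ifPn => [/eqP E0|_].
  by move: Ev; rewrite E0.
case: xgetP => [t _ Et|/(_ s) //]; exact: (is_subset1_supremums Et Es).
Qed.

(** A bounded set of natural numbers has a largest element, so that finite lower
bounds of the supremum are attained. *)
Lemma supremum_extnat (E : set (\bar int)) : (exists v, E v) ->
  (forall v, E v -> extnat v) -> extnat (supremum 0 E) /\
  forall m : nat, m%:N <= supremum 0 E <-> exists2 v, E v & m%:N <= v.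
Proof.
move=> E0 EN; have [unb|] := pselect (forall m : nat, exists2 v, E v & m%:N <= v).
  have -> : supremum 0 E = +oo.
    apply: supremum_eq => //; split=> [v _|w uw]; first exact: leey.
    have : exists m : nat, w < m%:N \/ w = +oo.
      case: w uw => [[n|n]||]; [exists n.+1; left|exists 0%N; left|exists 0%N; right|exists 0%N; left] => //.
      by rewrite lte_fin ltz_nat.
    case=> m [wm|-> //]; have [v Ev mv] := unb m.
    by have := uw _ Ev; rewrite leNgt (lt_le_trans wm mv).
  by split=> [|m]; [left|split=> // _; rewrite leey].
move=> /existsNP [b /forall2NP bP].
have bnd v : E v -> exists2 n, (n < b)%N & v = n%:N.
  move=> Ev; have [//|] := bP v; move=> nb; have := EN v Ev.
  case=> [vE|[n vE]]; first by case: nb; rewrite vE leey.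
  by exists n => //; rewrite ltnNge; apply/negP => bn; apply: nb; rewrite vE le_natN.
have exE : exists n, `[< E n%:N >].
  have [v Ev] := E0; have [n _ vE] := bnd v Ev; exists n; apply/asboolP.
  by rewrite -vE.
have ub n : `[< E n%:N >] -> (n <= b)%N.
  by move=> /asboolP /bnd [k kb [->]]; apply: ltnW.
case: (ex_maxnP exE ub) => N /asboolP EN' Nmax.
have le_N v : E v -> v <= N%:N.
  move=> Ev; have [n _ vE] := bnd v Ev; rewrite vE le_natN; apply: Nmax.
  by apply/asboolP; rewrite -vE.
have -> : supremum 0 E = N%:N.
  apply: supremum_eq => //; split=> [v /le_N //|w uw]; exact: uw.
split=> [|m]; first by right; exists N.
by split=> [mN|[v /le_N vN mv]]; [exists N%:N|apply: le_trans vN].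
Qed.

Lemma domdim_extnat (B : pzRingType) (T X : lmodType B) :
  extnat (domdim T X) /\
  forall m : nat, m%:N <= domdim T X <-> has_copresentation T X m.
Proof.
have h0 : has_copresentation T X 0.
  by exists (fun => X), (hom_id X), (fun => hom_id X); split.
have [|v [n _ ->]|eN eP] := @supremum_extnat
  [set v | exists2 n : nat, has_copresentation T X n & v = n%:N].
- by exists 0%:N, 0%N.
- by right; exists n.
split=> // m; rewrite /domdim eP; split=> [[_ [n hn ->]]|hm].
  by rewrite le_natN => mn; apply: copresentation_le hn.
by exists m%:N => //; exists m.
Qed.

Section Grigdim.
Variables (A : pzRingType) (S : artinAlgebra A).

(** A characterization in terms of the ring A alone. *)
Lemma Grigdim_extnat : extnat (Grigdim S) /\
  forall m : nat, m%:N <= Grigdim S <->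
    exists M : lmodType A, [/\ gp M, is_generator M & extv (m - 2) M M].
Proof.
have en := artin_enough_injectives S.
have [||eN eP] := @supremum_extnat [set v | exists2 M : lmodType A,
       gorenstein_projective M /\ is_generator M &
       v = domdim (dual S M : lmodType (endR M)) ((endR M)^o : lmodType (endR M))].
- exists (domdim (dual S A^o : lmodType (endR A^o)) ((endR A^o)^o : lmodType (endR A^o))).
  exists A^o => //; split; last by split; [apply: fg_self|apply: add_self].
  by apply/gorensteinP => //; apply: gp_projective; [apply: fg_self|apply: projective_self].
- by move=> v [M _ ->]; case: (domdim_extnat (dual S M : lmodType (endR M)) (endR M)^o).
split=> // m; rewrite /Grigdim eP; split.
- move=> [_ [M [gM genM] ->]] /(domdim_extnat _ _).2.
  have fM := genM.1; move=> /(has_copresentationP S fM _ genM) ex.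
  by exists M; split=> //; apply/gorensteinP.
- move=> [M [gM genM ex]]; have fM := genM.1.
  exists (domdim (dual S M : lmodType (endR M)) ((endR M)^o : lmodType (endR M))).
    by exists M => //; split=> //; apply/gorensteinP.
  by apply/(domdim_extnat _ _).2/(has_copresentationP S fM _ genM).
Qed.
End Grigdim.
End Height.

(** * Transfer along adjoint functors *)

Section Adjunction.
Variables A B : pzRingType.

Definition preserves_exact (F : moduleFunctor A B) :=
  forall K M C (u : hom K M) (p : hom M C), short_exact u p ->
    short_exact (fmap F u) (fmap F p).
Definition preserves_fg (F : moduleFunctor A B) :=
  forall M, fin_gen M -> fin_gen (F M).
Definition reflects_zero (F : moduleFunctor A B) :=
  forall M N (f : hom M N), (forall x, fmap F f x = 0) -> forall x, f x = 0.
End Adjunction.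

(** Functors between module categories are not assumed to be additive, hence the
field [adj_zero]. *)
Record adjoint (A B : pzRingType) (F : moduleFunctor A B) (G : moduleFunctor B A) :=
  Adjoint {
  adj : forall X Y, hom (F X) Y -> hom X (G Y);
  adj_bij : forall X Y, bijective (@adj X Y);
  adj_zero : forall X Y, adj (0 : hom (F X) Y) = 0;
  adj_natr : forall X Y Y' (g : hom Y Y') (f : hom (F X) Y),
    adj (hom_comp g f) = hom_comp (fmap G g) (adj f);
  adj_natl : forall X' X Y (h : hom X' X) (f : hom (F X) Y),
    adj (hom_comp f (fmap F h)) = hom_comp (adj f) h }.

Section Transfer.
Variables (A B : pzRingType) (F : moduleFunctor A B) (G : moduleFunctor B A).
Variable a : adjoint F G.
Hypotheses (eF : preserves_exact F) (eG : preserves_exact G).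

Lemma adj_surj X Y (h : hom X (G Y)) : exists f, adj a f = h.
Proof. by have [g _ gK] := adj_bij a X Y; exists (g h); apply: gK. Qed.
Lemma adj_inj X Y : injective (@adj _ _ _ _ a X Y).
Proof. exact: bij_inj (adj_bij a X Y). Qed.

Lemma exact_injective M N (u : hom M N) : injective u -> injective (fmap F u).
Proof.
move=> uI; have [C [p [pe ps]]] := ex_coker u.
by have [] : short_exact (fmap F u) (fmap F p) by apply: eF.
Qed.
Lemma exact_surjective M N (p : hom M N) : surjective p -> surjective (fmap G p).
Proof.
move=> ps; have [K [u [uI ue]]] := ex_kernel p.
by have [] : short_exact (fmap G u) (fmap G p) by apply: eG.
Qed.

Lemma adjoint_injective I : injective_module I -> injective_module (G I).
Proof.
move=> iI M N g f gI; have [f' fE] := adj_surj f.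
have [h' hE] := iI _ _ _ f' (exact_injective gI).
exists (adj a h') => x; rewrite -fE -[LHS]homE -adj_natl; congr (hom_fun (adj a _) x).
exact: hom_ext.
Qed.

Lemma adjoint_projective P : projective P -> projective (F P).
Proof.
move=> pP M N g f gs; have [h hE] := pP _ _ _ (adj a f) (exact_surjective gs).
have [h' h'E] := adj_surj h; exists h' => x; rewrite -[LHS]homE.
congr (hom_fun _ x); apply: adj_inj; rewrite adj_natr h'E; exact: hom_ext.
Qed.

(** G preserves embeddings into injective modules, so lifting problems can be moved
from B to A. *)
Lemma adjoint_extv n X Y : extv n X (G Y) -> extv n (F X) Y.
Proof.
elim: n Y => [//|n IH] Y [e1 e2]; split=> I C u p iI su; last first.
  by apply: IH; apply: (e2 _ _ _ _ (adjoint_injective iI) (eG su)).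
move=> f; have [h hE] := e1 _ _ _ _ (adjoint_injective iI) (eG su) (adj a f).
have [h' h'E] := adj_surj h; exists h' => x; rewrite -[LHS]homE.
congr (hom_fun _ x); apply: adj_inj; rewrite adj_natr h'E; exact: hom_ext.
Qed.

Lemma adjoint_separates X : reflects_zero G -> separates X -> separates (F X).
Proof.
move=> rG sX Y Z h h0; apply: rG; apply: sX => f m.
have [f' <-] := adj_surj f; rewrite -[LHS]homE -adj_natr.
have -> : hom_comp h f' = 0 by apply: hom_ext => x; rewrite homE h0.
by rewrite adj_zero.
Qed.

Hypotheses (fF : preserves_fg F) (fG : preserves_fg G).
Hypothesis pG : forall P, projective P -> projective (G P).

(** The images of Gorenstein projective modules form a suitable class, with the
images of syzygies and cosyzygies. *)
Lemma adjoint_gp X : gp X -> gp (F X).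
Proof.
move=> gX; exists (fun Z => exists2 X, gp X & Z = F X); last by exists X.
move=> _ [{gX}X gX ->]; have [fX [P [X1 [u [p [? ? ? ?]]]]]
  [P' [X2 [u' [p' [? ? ? ?]]]]] e] := gp_gp_class gX.
split; first exact: fF.
- exists (F P), (F X1), (fmap F u), (fmap F p); split; [exact: fF| |exact: eF|by exists X1].
  exact: adjoint_projective.
- exists (F P'), (F X2), (fmap F u'), (fmap F p'); split; [exact: fF| |exact: eF|by exists X2].
  exact: adjoint_projective.
- move=> Q fQ pQ; apply/extv1/adjoint_extv/extv1; apply: e; [exact: fG|exact: pG].
Qed.

Lemma adjoint_generator X : reflects_zero G -> is_generator X -> is_generator (F X).
Proof.
move=> rG /generatorP [fX sX]; apply/generatorP; split; first exact: fF.
exact: adjoint_separates.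
Qed.
End Transfer.

(** * Morita equivalence *)

Section FullyFaithful.
Variables (A B : pzRingType) (F : moduleFunctor A B).
Implicit Types M N K C P W X Y : lmodType A.
Hypothesis full : forall M N (g : hom (F M) (F N)), exists f : hom M N, fmap F f = g.
Hypothesis faithful : forall M N (f g : hom M N), fmap F f = fmap F g -> f = g.
Hypothesis dense : forall N : lmodType B, exists M (f : hom (F M) N), bijective f.

(** By fullness the zero endomorphism of F M comes from an endomorphism of M, which can
only be the identity. *)
Lemma fmap_zero_module M N : (forall x : M, x = 0) ->
  fmap F (0 : hom M N) = 0 /\ forall x : F M, x = 0.
Proof.
move=> M0; have FM0 (x : F M) : x = 0.
  have [f fE] := full (0 : hom (F M) (F M)).
  have fid : f = hom_id M by apply: hom_ext => y; rewrite (M0 y) hom0.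
  by have := congr1 (fun h : hom (F M) (F M) => hom_fun h x) fE; rewrite fid fmap_id !homE.
by split=> //; apply: hom_ext => x; rewrite (FM0 x) !hom0.
Qed.

Lemma fmap_zero M N : fmap F (0 : hom M N) = 0.
Proof.
have [K [u [uI ue]]] := ex_kernel (hom_id M).
have K0 (k : K) : k = 0.
  by apply: uI; rewrite hom0; have /ue : exists x, u x = u k by exists k.
have -> : (0 : hom M N) = hom_comp (0 : hom K N) (0 : hom M K) by apply: hom_ext.
by rewrite fmap_comp (fmap_zero_module N K0).1; apply: hom_ext.
Qed.

Lemma ff_reflects : reflects_zero F.
Proof.
move=> M N f f0; have -> : f = 0; last by [].
by apply: faithful; rewrite fmap_zero; apply: hom_ext => x; rewrite f0.
Qed.

Lemma fmap_comp0 M N P (g : hom N P) (f : hom M N) :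
  (forall x, fmap F g (fmap F f x) = 0) -> forall x, g (f x) = 0.
Proof.
move=> h x; rewrite -[LHS]homE; apply: (ff_reflects (f := hom_comp g f)) => y.
by rewrite fmap_comp homE h.
Qed.

(** The module X corresponds to the regular module of B, and b to its unit, so that
elements of F M are the images of b.  This reduces exactness and generation,
which refer to elements, to properties of morphisms. *)
Lemma ff_element : exists (X : lmodType A) (b : F X), 
  (forall M (y : F M), exists f : hom X M, fmap F f b = y) /\
  forall N (g : hom X N), fmap F g b = 0 -> forall x, fmap F g x = 0.
Proof.
have [X [e eB]] := dense B^o; have [e' [eK e'K]] := inv_hom eB.
exists X, (e' 1); split=> [M y|N g gb x].
  have [f fE] := full (hom_comp (hom_at y) e).
  by exists f; rewrite fE homE pairE e'K scale1r.
have -> : x = (e x : B) *: e' 1.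
  by rewrite -homZ -[_ *: _]/(_ * _) mulr1 eK.
by rewrite homZ gb scaler0.
Qed.

Lemma ff_exact : preserves_exact F.
Proof.
move=> K M C u p [uI ue ps].
have [X [b [elt elt0]]] := ff_element.
split.
- apply: injhomP => x ux; have [f fE] := elt _ x.
  have uf0 y : u (f y) = 0.
    rewrite -[LHS]homE; apply: (ff_reflects (f := hom_comp u f)); apply: elt0.
    by rewrite fmap_comp homE fE ux.
  have f0 : f = 0 by apply: hom_ext => y; apply: uI; rewrite uf0 homE hom0.
  by rewrite -fE f0 fmap_zero.
- move=> y; split=> [py|[x <-]]; last first.
    rewrite -[LHS]homE -fmap_comp (_ : hom_comp p u = 0) ?fmap_zero //.
    by apply: hom_ext => z; rewrite homE (exact0 _ ue).
  have [f fE] := elt _ y.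
  have pf0 z : p (f z) = 0.
    rewrite -[LHS]homE; apply: (ff_reflects (f := hom_comp p f)); apply: elt0.
    by rewrite fmap_comp homE fE py.
  have [|k kE] := @factor_inj _ _ _ _ u f uI; first by move=> z; apply/ue.
  exists (fmap F k b); rewrite -[LHS]homE -fmap_comp -fE.
  by congr (hom_fun (fmap F _) b); apply: hom_ext.
- have [C' [c [ce cs]]] := ex_coker (fmap F p).
  have [W [w wB]] := dense C'; have [w' [wK w'K]] := inv_hom wB.
  have [h hE] := full (hom_comp w' c).
  have hp0 x : h (p x) = 0.
    by apply: fmap_comp0 => y; rewrite hE homE (exact0 _ ce) hom0.
  have h0 : h = 0 by apply: hom_ext => y; have [x <-] := ps y; rewrite hp0.
  move=> y; apply/ce; apply: (can_inj w'K); rewrite -[LHS]homE -hE h0 fmap_zero.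
  by rewrite homE hom0.
Qed.

(** The module X of [ff_element] generates all A-modules, so M is generated by the
images of finitely many maps f from X; then the elements F(f)(b) generate F M. *)
Lemma ff_fg : preserves_fg F.
Proof.
move=> M [n [e eP]]; have [X [b [elt elt0]]] := ff_element.
have sX : separates_at X A^o.
  move=> Y h h0; apply: ff_reflects => y; have [f <-] := elt _ y.
  rewrite -[LHS]homE -fmap_comp (_ : hom_comp h f = 0) ?fmap_zero //.
  by apply: hom_ext => z; rewrite homE h0.
have [m [al [x alx]]] := separates_trace sX.
pose f (s : 'I_m * 'I_n) : hom X M := hom_comp (hom_at (e s.2)) (al s.1).
pose g (i : 'I_#|{: 'I_m * 'I_n}|) : F M := fmap F (f (enum_val i)) b.
have [C [c [ce cs]]] := ex_coker (comb g).
have [W [w wB]] := dense C; have [w' [wK w'K]] := inv_hom wB.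
have [h hE] := full (hom_comp w' c).
have hf0 s y : h (f s y) = 0.
  rewrite -[LHS]homE; apply: (ff_reflects (f := hom_comp h (f s))); apply: elt0.
  rewrite fmap_comp homE hE homE -[X in w' X](_ : 0 = _) ?hom0 //; apply/esym/ce.
  exists [ffun i => (i == enum_rank s)%:R]; rewrite combE (bigD1 (enum_rank s)) //=.
  rewrite big1 => [|i ns]; last by rewrite ffunE (negPf ns) scale0r.
  by rewrite ffunE eqxx scale1r addr0 /g enum_rankK.
have h0 : h = 0.
  apply: hom_ext => y; have [k ->] := eP y; rewrite hom_sum big1 // => j _.
  rewrite homZ; have -> : h (e j) = 0; last by rewrite scaler0.
  rewrite -[e j]scale1r -alx scaler_suml hom_sum big1 // => i _.
  by have := hf0 (i, j) (x i); rewrite /f homE pairE.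
have c0 y : c y = 0.
  by apply: (can_inj w'K); rewrite -[LHS]homE -hE h0 fmap_zero homE hom0.
exists #|{: 'I_m * 'I_n}|, g => y; have /ce [k <-] := c0 y.
by exists (fun i => k i); rewrite combE.
Qed.
End FullyFaithful.

Section Morita.
Variables (A B : pzRingType) (F : moduleFunctor A B) (G : moduleFunctor B A).
Variables (eta : forall M, hom M (G (F M))) (eps : forall N, hom (F (G N)) N).
Hypothesis etaB : forall M, bijective (eta M).
Hypothesis epsB : forall N, bijective (eps N).
Hypothesis eta_nat : forall M M' (f : hom M M'),
  hom_comp (eta M') f = hom_comp (fmap G (fmap F f)) (eta M).
Hypothesis eps_nat : forall N N' (f : hom N N'),
  hom_comp f (eps N) = hom_comp (eps N') (fmap F (fmap G f)).

Lemma equiv_faithfulF M N (f g : hom M N) : fmap F f = fmap F g -> f = g.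
Proof.
move=> fg; apply: hom_ext => x; apply: (bij_inj (etaB N)).
by rewrite -[LHS]homE -[RHS]homE !eta_nat fg.
Qed.
Lemma equiv_faithfulG M N (f g : hom M N) : fmap G f = fmap G g -> f = g.
Proof.
move=> fg; have [e' [_ eK]] := inv_hom (epsB M); apply: hom_ext => x.
by rewrite -[x]eK -[LHS]homE -[RHS]homE !eps_nat fg.
Qed.
Lemma equiv_fullG M N (g : hom (G M) (G N)) : exists f : hom M N, fmap G f = g.
Proof.
have [e' [eK Ke]] := inv_hom (epsB M).
exists (hom_comp (eps N) (hom_comp (fmap F g) e')).
apply: equiv_faithfulF; apply: hom_ext => x; apply: (bij_inj (epsB N)).
by rewrite -[LHS]homE -eps_nat !homE eK.
Qed.
Lemma equiv_fullF M N (g : hom (F M) (F N)) : exists f : hom M N, fmap F f = g.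
Proof.
have [e' [eK Ke]] := inv_hom (etaB N).
exists (hom_comp e' (hom_comp (fmap G g) (eta M))).
apply: equiv_faithfulG; apply: hom_ext => x.
have [m' [mK Km]] := inv_hom (etaB M).
rewrite -[x]Km -[LHS]homE -eta_nat homE [in RHS]Km !homE Km; apply: Ke.
Qed.
Lemma equiv_denseF N : exists M (f : hom (F M) N), bijective f.
Proof. by exists (G N), (eps N). Qed.
Lemma equiv_denseG M : exists N (f : hom (G N) M), bijective f.
Proof.
have [e' [eK Ke]] := inv_hom (etaB M); exists (F M), e'; by exists (eta M).
Qed.

(** The adjunction sends f to G(f) eta; it is bijective because G is full and
faithful. *)
Lemma equiv_adjoint : adjoint F G.
Proof.
exists (fun X Y f => hom_comp (fmap G f) (eta X)).
- move=> X Y; have [e' [eK Ke]] := inv_hom (etaB X).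
  have ex (h : hom X (G Y)) : exists f : hom (F X) Y, hom_comp (fmap G f) (eta X) = h.
    have [f fE] := equiv_fullG (hom_comp h e'); exists f.
    by apply: hom_ext => x; rewrite homE fE homE eK.
  have [g gE] := choice ex; exists g => // f.
  apply: equiv_faithfulG; apply: hom_ext => x; rewrite -[x]Ke -[LHS]homE -[RHS]homE.
  by rewrite gE.
- move=> X Y; rewrite (fmap_zero equiv_fullG); exact: hom_ext.
- by move=> X Y Y' g f; rewrite fmap_comp; apply: hom_ext.
- move=> X' X Y h f; rewrite fmap_comp; apply: hom_ext => x; rewrite !homE.
  by rewrite -[X in fmap G f X]homE -eta_nat homE.
Qed.

Lemma equiv_inv N : { e' : hom N (F (G N)) | cancel (eps N) e' /\ cancel e' (eps N)}.
Proof. exact: cid (inv_hom (epsB N)). Qed.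
Lemma equiv_inv' N : { e' : hom (G (F N)) N | cancel (eta N) e' /\ cancel e' (eta N)}.
Proof. exact: cid (inv_hom (etaB N)). Qed.
End Morita.

Definition equivalence_data A B (F : moduleFunctor A B) (G : moduleFunctor B A)
    (eta : forall M, hom M (G (F M))) (eps : forall N, hom (F (G N)) N) :=
  [/\ forall M, bijective (eta M),
      forall N, bijective (eps N),
      forall M M' (f : hom M M'),
        hom_comp (eta M') f = hom_comp (fmap G (fmap F f)) (eta M)
    & forall N N' (f : hom N N'),
        hom_comp f (eps N) = hom_comp (eps N') (fmap F (fmap G f))].

Lemma equivalence_sym A B (F : moduleFunctor A B) (G : moduleFunctor B A) eta eps :
  @equivalence_data A B F G eta eps ->
  exists eta' eps', @equivalence_data B A G F eta' eps'.
Proof.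
move=> [etaB epsB eta_nat eps_nat].
exists (fun N => sval (equiv_inv epsB N)), (fun M => sval (equiv_inv' etaB M)).
split.
- by move=> N; case: equiv_inv => e' [eK Ke] /=; exists (eps N).
- by move=> M; case: equiv_inv' => e' [eK Ke] /=; exists (eta M).
- move=> M M' f; case: equiv_inv => e' [eK Ke]; case: equiv_inv => e1 [eK1 Ke1] /=.
  apply: hom_ext => x; apply: (can_inj eK).
  by rewrite !homE Ke -[RHS]homE -eps_nat homE Ke1.
- move=> M M' f; case: equiv_inv' => e' [eK Ke]; case: equiv_inv' => e1 [eK1 Ke1] /=.
  apply: hom_ext => x; apply: (can_inj eK1).
  by rewrite !homE -[LHS]homE eta_nat homE Ke Ke1.
Qed.

Lemma morita_sym A B : morita_equivalent A B -> morita_equivalent B A.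
Proof.
move=> [F [G [eta [eps FG]]]].
by have [eta' [eps' GF]] := equivalence_sym FG; exists G, F, eta', eps'.
Qed.

Lemma morita_transfer A B n : enough_injectives A -> morita_equivalent A B ->
  (exists M : lmodType A, [/\ gp M, is_generator M & extv n M M]) ->
  exists M : lmodType B, [/\ gp M, is_generator M & extv n M M].
Proof.
move=> enA [F [G [eta [eps FG]]]] [M [gM genM eM]].
have [eta' [eps' [etaB' epsB' eta_nat' eps_nat']]] := equivalence_sym FG.
have [etaB epsB eta_nat eps_nat] := FG.
have eF := ff_exact (equiv_fullF etaB epsB eta_nat eps_nat)
  (equiv_faithfulF etaB eta_nat) (equiv_denseF epsB).
have eG := ff_exact (equiv_fullG etaB epsB eta_nat eps_nat)
  (equiv_faithfulG epsB eps_nat) (equiv_denseG etaB).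
have fF := ff_fg (equiv_fullF etaB epsB eta_nat eps_nat)
  (equiv_faithfulF etaB eta_nat) (equiv_denseF epsB).
have fG := ff_fg (equiv_fullG etaB epsB eta_nat eps_nat)
  (equiv_faithfulG epsB eps_nat) (equiv_denseG etaB).
have aFG := equiv_adjoint etaB epsB eta_nat eps_nat.
have aGF := equiv_adjoint etaB' epsB' eta_nat' eps_nat'.
have pG := adjoint_projective aGF eF.
exists (F M); split.
- exact: (adjoint_gp aFG eF eG fF fG pG gM).
- apply: (adjoint_generator aFG fF) genM.
  apply: ff_reflects; first exact: (equiv_fullG etaB epsB eta_nat eps_nat).
  exact: (equiv_faithfulG epsB eps_nat).
- apply: (adjoint_extv aFG eF eG); apply: (extv_retract enA) eM.
  by have [e' [eK Ke]] := inv_hom (etaB M); exists e', (eta M).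
Qed.

(** * Factors of a product ring *)

Section Factor.
(** A is the factor of E cut out by the central idempotent [s 1]; the section [s]
preserves sums and products but not the unit. *)
Variables (E A : pzRingType) (pr : {rmorphism E -> A}) (s : A -> E).
Hypothesis sD : {morph s : x y / x + y}.
Hypothesis sM : {morph s : x y / x * y}.
Hypothesis sK : cancel s pr.
Hypothesis Ks : forall x, s (pr x) = s 1 * x.
Hypothesis s1C : forall x, s 1 * x = x * s 1.

Definition inflate : moduleFunctor A E.
Proof.
refine (@ModuleFunctor A E (fun M => restr_scalars pr M : lmodType E)
  (fun M N f => restrict_hom pr f) _ _).
- by move=> M; apply: hom_ext.
- by move=> M N P g f; apply: hom_ext.
Defined.

Lemma inflate_scaleE (M : lmodType A) (x : E) (m : inflate M) :
  x *: m = (pr x *: (m : M) : M).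
Proof. by []. Qed.

Section Component.
Variable X : lmodType E.
Definition comp_set : set X := fun x => s 1 *: x = x.
Lemma comp_submodule : submodule comp_set.
Proof.
split; rewrite /comp_set; first by rewrite scaler0.
  by move=> x y ex ey; rewrite scalerDr ex ey.
by move=> a x ex; rewrite scalerA s1C -scalerA ex.
Qed.
Definition compT : Type := submodT comp_submodule.
HB.instance Definition _ := GRing.Zmodule.on compT.
Definition comp_val (x : compT) : X := submod_val x.
Lemma comp_valP x : s 1 *: comp_val x = comp_val x.
Proof. by case: x => x /= /subpredP. Qed.
Lemma comp_val_inj : injective comp_val.
Proof. exact: val_inj. Qed.
Lemma comp_ex x : s 1 *: x = x -> {y | comp_val y = x}.
Proof.
by move=> ex; have xP : x \in subpred comp_submodule by [apply/subpredP];
  exists (SubmodT xP).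
Qed.
Lemma comp_valD x y : comp_val (x + y) = comp_val x + comp_val y.
Proof. by []. Qed.
Lemma comp_scale_subproof a (x : compT) : s 1 *: (s a *: comp_val x) = s a *: comp_val x.
Proof. by rewrite scalerA -sM mul1r. Qed.
Definition comp_scale a x : compT := sval (comp_ex (comp_scale_subproof a x)).
Lemma comp_scaleE a x : comp_val (comp_scale a x) = s a *: comp_val x.
Proof. exact: (svalP (comp_ex (comp_scale_subproof a x))). Qed.
Fact comp_scaleA a b v : comp_scale a (comp_scale b v) = comp_scale (a * b) v.
Proof. by apply: comp_val_inj; rewrite !comp_scaleE sM scalerA. Qed.
Fact comp_scale1 : left_id 1 comp_scale.
Proof. by move=> v; apply: comp_val_inj; rewrite comp_scaleE comp_valP. Qed.
Fact comp_scaleDr : right_distributive comp_scale +%R.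
Proof.
move=> a u v; apply: comp_val_inj.
by rewrite comp_valD !comp_scaleE comp_valD scalerDr.
Qed.
Fact comp_scaleDl v : {morph comp_scale^~ v : a b / a + b}.
Proof.
move=> a b; apply: comp_val_inj.
by rewrite comp_valD !comp_scaleE sD scalerDl.
Qed.
HB.instance Definition _ := GRing.Zmodule_isLmodule.Build A compT
  comp_scaleA comp_scale1 comp_scaleDr comp_scaleDl.
Lemma comp_valZ a (x : compT) : comp_val (a *: x) = s a *: comp_val x.
Proof. exact: comp_scaleE. Qed.

Lemma comp_proj_subproof (x : X) : s 1 *: (s 1 *: x) = s 1 *: x.
Proof. by rewrite scalerA -sM mul1r. Qed.
Definition comp_proj x : compT := sval (comp_ex (comp_proj_subproof x)).
Lemma comp_projE x : comp_val (comp_proj x) = s 1 *: x.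
Proof. exact: (svalP (comp_ex (comp_proj_subproof x))). Qed.
Lemma comp_projK x : comp_proj (comp_val x) = x.
Proof. by apply: comp_val_inj; rewrite comp_projE comp_valP. Qed.
End Component.

Section ComponentMap.
Variables (X Y : lmodType E) (f : hom X Y).
Lemma comp_map_subproof (x : compT X) : s 1 *: f (comp_val x) = f (comp_val x).
Proof. by rewrite -homZ comp_valP. Qed.
Definition comp_map_fun x : compT Y := sval (comp_ex (comp_map_subproof x)).
Lemma comp_map_funE x : comp_val (comp_map_fun x) = f (comp_val x).
Proof. exact: (svalP (comp_ex (comp_map_subproof x))). Qed.
Fact comp_map_linear : linear comp_map_fun.
Proof.
move=> a x y; apply: comp_val_inj.
by rewrite comp_valD comp_valZ !comp_map_funE comp_valD comp_valZ homD homZ.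
Qed.
Definition comp_map : hom (compT X) (compT Y) := mkhom comp_map_linear.
Lemma comp_mapE x : comp_val (comp_map x) = f (comp_val x).
Proof. exact: comp_map_funE. Qed.
End ComponentMap.

Definition component : moduleFunctor E A.
Proof.
refine (@ModuleFunctor E A (fun X => compT X : lmodType A) comp_map _ _).
- by move=> M; apply: hom_ext => x; apply: comp_val_inj; rewrite comp_mapE.
- by move=> M N P g f; apply: hom_ext => x; apply: comp_val_inj; rewrite homE !comp_mapE.
Defined.

Lemma component_mapE (X Y : lmodType E) (f : hom X Y) (x : compT X) :
  comp_val (fmap component f x) = f (comp_val x).
Proof. exact: comp_mapE. Qed.

Lemma inflate_exact : preserves_exact inflate.
Proof. by move=> K M C u p [uI ue ps]; split. Qed.

Lemma component_exact : preserves_exact component.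
Proof.
move=> K M C u p [uI ue ps]; split.
- move=> x y xy; apply/comp_val_inj/uI.
  by rewrite -!component_mapE xy.
- move=> y; split=> [py|[x <-]]; last first.
    by apply: comp_val_inj; rewrite !component_mapE (exact0 _ ue).
  have /ue [x xE] : p (comp_val y) = 0 by rewrite -component_mapE py.
  exists (comp_proj x); apply: comp_val_inj.
  by rewrite component_mapE comp_projE homZ xE comp_valP.
- move=> y; have [x xE] := ps (comp_val y); exists (comp_proj x).
  by apply: comp_val_inj; rewrite component_mapE comp_projE homZ xE comp_valP.
Qed.

Lemma inflate_fg : preserves_fg inflate.
Proof.
move=> M [n [e eP]]; exists n, e => m; have [c cE] := eP m.
exists (fun i => s (c i)); rewrite [LHS]cE; apply: eq_bigr => i _.
by rewrite inflate_scaleE sK.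
Qed.

Lemma comp_val_sum (X : lmodType E) I (r : seq I) (F : I -> compT X) :
  comp_val (\sum_(i <- r) F i) = \sum_(i <- r) comp_val (F i).
Proof. by elim/big_rec2: _ => // i y x _ <-; rewrite comp_valD. Qed.

Lemma component_fg : preserves_fg component.
Proof.
move=> X [n [e eP]]; exists n, (fun i => comp_proj (e i)) => x.
have [c cE] := eP (comp_val x); exists (fun i => pr (c i)).
apply: comp_val_inj; rewrite -comp_valP cE scaler_sumr comp_val_sum.
apply: eq_bigr => i _.
by rewrite comp_valZ comp_projE !scalerA Ks -mulrA -s1C mulrA -sM mul1r.
Qed.

Lemma inflate_reflects : reflects_zero inflate.
Proof. by move=> M N f f0 x; apply: f0. Qed.

Section AdjL.
Variables (M : lmodType A) (X : lmodType E).
Section Fwd.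
Variable f : hom (inflate M) X.
Lemma adjL_subproof (m : M) : s 1 *: f m = f m.
Proof. by rewrite -homZ inflate_scaleE sK scale1r. Qed.
Definition adjL_fun m : compT X := sval (comp_ex (adjL_subproof m)).
Lemma adjL_funE m : comp_val (adjL_fun m) = f m.
Proof. exact: (svalP (comp_ex (adjL_subproof m))). Qed.
Fact adjL_linear : linear adjL_fun.
Proof.
move=> a x y; apply: comp_val_inj; rewrite comp_valD comp_valZ !adjL_funE.
by rewrite -homZ -(homD f); congr (f (_ + _)); rewrite inflate_scaleE sK.
Qed.
Definition adjL : hom M (component X) := mkhom adjL_linear.
End Fwd.
Section Bwd.
Variable g : hom M (component X).
Fact adjL_inv_linear : linear (fun m : inflate M => comp_val (g m)).
Proof.
move=> a x y; rewrite inflate_scaleE homD comp_valD homZ comp_valZ Ks.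
by rewrite s1C -scalerA comp_valP.
Qed.
Definition adjL_inv : hom (inflate M) X := mkhom adjL_inv_linear.
End Bwd.
Lemma adjL_bij : bijective adjL.
Proof.
exists adjL_inv => [f|g]; apply: hom_ext => m; first exact: adjL_funE.
by apply: comp_val_inj; rewrite [LHS]adjL_funE.
Qed.
End AdjL.

(** Linear maps from an inflated module take values in the component cut out by the
idempotent. *)
Lemma inflate_component : adjoint inflate component.
Proof.
exists adjL; first exact: adjL_bij.
- by move=> X Y; apply: hom_ext => x; apply: comp_val_inj; rewrite [LHS]adjL_funE.
- move=> X Y Y' g f; apply: hom_ext => x; apply: comp_val_inj.
  by rewrite [LHS]adjL_funE !homE component_mapE; congr (g _); rewrite [RHS]adjL_funE.
- move=> X' X Y h f; apply: hom_ext => x; apply: comp_val_inj.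
  by rewrite [LHS]adjL_funE [RHS]adjL_funE homE.
Qed.

Section AdjR.
Variables (X : lmodType E) (M : lmodType A).
Section Fwd.
Variable f : hom (component X) M.
Fact adjR_linear : linear (fun x : X => f (comp_proj x) : inflate M).
Proof.
move=> a x y; rewrite inflate_scaleE -homZ -(homD f); congr (f _).
apply: comp_val_inj; rewrite comp_valD comp_valZ !comp_projE scalerDr !scalerA.
by rewrite Ks -mulrA -s1C mulrA -sM mul1r.
Qed.
Definition adjR : hom X (inflate M) := mkhom adjR_linear.
End Fwd.
Section Bwd.
Variable g : hom X (inflate M).
Fact adjR_inv_linear : linear (fun x : compT X => g (comp_val x) : M).
Proof.
by move=> a x y; rewrite comp_valD homD comp_valZ homZ inflate_scaleE sK.
Qed.
Definition adjR_inv : hom (component X) M := mkhom adjR_inv_linear.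
End Bwd.
Lemma adjR_bij : bijective adjR.
Proof.
exists adjR_inv => [f|g]; apply: hom_ext => m.
  by rewrite -[LHS]/(f (comp_proj (comp_val m))) comp_projK.
rewrite -[LHS]/(g (comp_val (comp_proj m))) comp_projE homZ inflate_scaleE sK.
by rewrite scale1r.
Qed.
End AdjR.

(** Linear maps to an inflated module vanish on the complement of the component. *)
Lemma component_inflate : adjoint component inflate.
Proof.
exists adjR; first exact: adjR_bij.
- by move=> X Y; apply: hom_ext.
- by move=> X Y Y' g f; apply: hom_ext.
- move=> X' X Y h f; apply: hom_ext => x.
  rewrite -[LHS]/(f (comp_map h (comp_proj x))) -[RHS]/(f (comp_proj (h x))).
  by congr (f _); apply: comp_val_inj; rewrite comp_mapE !comp_projE homZ.
Qed.

Lemma inflate_projective P : projective P -> projective (inflate P).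
Proof. exact: (adjoint_projective inflate_component component_exact). Qed.
Lemma component_projective P : projective P -> projective (component P).
Proof. exact: (adjoint_projective component_inflate inflate_exact). Qed.

(** The component of X is again a generator without self-extensions, because its
inflation is a direct summand of X. *)
Lemma factor_transfer n : enough_injectives E ->
  (exists M : lmodType E, [/\ gp M, is_generator M & extv n M M]) ->
  exists M : lmodType A, [/\ gp M, is_generator M & extv n M M].
Proof.
move=> enE [X [gX genX eX]]; exists (component X); split.
- exact: (adjoint_gp component_inflate component_exact inflate_exact component_fg
    inflate_fg inflate_projective gX).
- exact: (adjoint_generator component_inflate component_fg inflate_reflects).
- apply: (adjoint_extv component_inflate component_exact inflate_exact).
  apply: extv_retract eX => //.
  have lv : linear (fun x : inflate (component X) => comp_val (x : compT X)).
    move=> a x y; rewrite inflate_scaleE comp_valD comp_valZ Ks s1C -scalerA.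
    by rewrite comp_valP.
  exists (mkhom lv), (adjR (hom_id _)) => x; exact: comp_projK.
Qed.

Lemma inflate_gp X : gp X -> gp (inflate X).
Proof.
exact: (adjoint_gp inflate_component inflate_exact component_exact inflate_fg
  component_fg component_projective).
Qed.

Lemma inflate_extv n X Y : extv n X (component Y) -> extv n (inflate X) Y.
Proof. exact: (adjoint_extv inflate_component inflate_exact component_exact). Qed.

Lemma inflate_separates M (X Y : lmodType E) (h : hom X Y) : separates M ->
  (forall (f : hom (inflate M) X) m, h (f m) = 0) -> forall x, h (s 1 *: x) = 0.
Proof.
move=> sep h0 x; rewrite -comp_projE -component_mapE.
rewrite (_ : fmap component h (comp_proj x) = 0) //; apply: sep => f m.
by apply: comp_val_inj; rewrite component_mapE; apply: (h0 (adjL_inv f) m).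
Qed.
End Factor.

Section Product.
Variables A B : pzRingType.
Let E : pzRingType := (A * B)%type.
Let prA : {rmorphism E -> A} := fst.
Let prB : {rmorphism E -> B} := snd.
Let sA (a : A) : E := (a, 0).
Let sB (b : B) : E := (0, b).

Fact sAD : {morph sA : x y / x + y}.
Proof. by move=> x y; congr (_, _); rewrite /= addr0. Qed.
Fact sAM : {morph sA : x y / x * y}.
Proof. by move=> x y; congr (_, _); rewrite /= mulr0. Qed.
Fact sAK : cancel sA prA. Proof. by []. Qed.
Fact KsA x : sA (prA x) = sA 1 * x.
Proof. by congr (_, _); rewrite /= ?mul1r ?mul0r. Qed.
Fact sA1C x : sA 1 * x = x * sA 1.
Proof. by congr (_, _); rewrite /= ?mul1r ?mul0r ?mulr1 ?mulr0. Qed.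
Fact sBD : {morph sB : x y / x + y}.
Proof. by move=> x y; congr (_, _); rewrite /= addr0. Qed.
Fact sBM : {morph sB : x y / x * y}.
Proof. by move=> x y; congr (_, _); rewrite /= mulr0. Qed.
Fact sBK : cancel sB prB. Proof. by []. Qed.
Fact KsB x : sB (prB x) = sB 1 * x.
Proof. by congr (_, _); rewrite /= ?mul1r ?mul0r. Qed.
Fact sB1C x : sB 1 * x = x * sB 1.
Proof. by congr (_, _); rewrite /= ?mul1r ?mul0r ?mulr1 ?mulr0. Qed.

Notation VA := (inflate prA).
Notation VB := (inflate prB).
Notation UA := (component sAD sAM sA1C).
Notation UB := (component sBD sBM sB1C).

Lemma product_transferA n : enough_injectives E ->
  (exists M : lmodType E, [/\ gp M, is_generator M & extv n M M]) ->
  exists M : lmodType A, [/\ gp M, is_generator M & extv n M M].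
Proof. exact: (factor_transfer sAD sAM sAK KsA sA1C). Qed.
Lemma product_transferB n : enough_injectives E ->
  (exists M : lmodType E, [/\ gp M, is_generator M & extv n M M]) ->
  exists M : lmodType B, [/\ gp M, is_generator M & extv n M M].
Proof. exact: (factor_transfer sBD sBM sBK KsB sB1C). Qed.

Lemma product_transfer n : enough_injectives A -> enough_injectives B ->
  enough_injectives E ->
  (exists M : lmodType A, [/\ gp M, is_generator M & extv n M M]) ->
  (exists M : lmodType B, [/\ gp M, is_generator M & extv n M M]) ->
  exists M : lmodType E, [/\ gp M, is_generator M & extv n M M].
Proof.
move=> enA enB enE [M [gM genM eM]] [N [gN genN eN]].
pose X : lmodType E := (VA M * VB N)%type; have sX := pair_short_exact (VA M) (VB N).
have [_ sM] := (generatorP M).1 genM; have [_ sN] := (generatorP N).1 genN.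
exists X; split.
- apply: (gp_extension enE sX); first exact: (inflate_gp sAD sAM sAK KsA sA1C gM).
  exact: (inflate_gp sBD sBM sBK KsB sB1C gN).
- apply/generatorP; split.
    apply: fg_pair; first exact: (inflate_fg sAK genM.1).
    exact: (inflate_fg sBK genN.1).
  move=> Y Z h h0 y.
  have -> : y = sA 1 *: y + sB 1 *: y.
    by rewrite -scalerDl -[LHS]scale1r; congr (_ *: _); congr (_, _); rewrite /= ?addr0 ?add0r.
  rewrite homD (inflate_separates sAD sAM KsA sA1C sM); last first.
    by move=> f m; have := h0 (hom_comp f (hom_fst (VA M) (VB N))) (m, 0); rewrite !homE.
  rewrite (inflate_separates sBD sBM KsB sB1C sN) ?addr0 // => f m.
  by have := h0 (hom_comp f (hom_snd (VA M) (VB N))) (0, m); rewrite !homE.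
- apply: (extv_extension sX).
  + apply: (@inflate_extv _ _ _ _ sAD sAM sAK KsA sA1C); apply: (extv_retract enA) eM.
    have la : linear (fun x : UA X => (comp_val x).1 : M).
      by move=> a x y; rewrite comp_valD comp_valZ.
    have lb : linear (fun m : M => comp_proj sAM sA1C ((m, 0) : X) : UA X).
      move=> a x y; apply: comp_val_inj; rewrite comp_valD comp_valZ !comp_projE.
      by congr (_, _); rewrite /= ?inflate_scaleE /= ?scale1r ?scale0r ?scaler0 ?addr0.
    exists (mkhom la), (mkhom lb) => x; apply: comp_val_inj.
    rewrite !mkhomE comp_projE -[RHS]comp_valP; congr (_, _) => //.
    by rewrite inflate_scaleE /= scaler0 inflate_scaleE scale0r.
  + apply: (@inflate_extv _ _ _ _ sBD sBM sBK KsB sB1C); apply: (extv_retract enB) eN.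
    have la : linear (fun x : UB X => (comp_val x).2 : N).
      by move=> a x y; rewrite comp_valD comp_valZ.
    have lb : linear (fun m : N => comp_proj sBM sB1C ((0, m) : X) : UB X).
      move=> a x y; apply: comp_val_inj; rewrite comp_valD comp_valZ !comp_projE.
      by congr (_, _); rewrite /= ?inflate_scaleE /= ?scale1r ?scale0r ?scaler0 ?addr0.
    exists (mkhom la), (mkhom lb) => x; apply: comp_val_inj.
    rewrite !mkhomE comp_projE -[RHS]comp_valP; congr (_, _) => //.
    by rewrite inflate_scaleE /= scaler0 inflate_scaleE scale0r.
Qed.
End Product.

(** * Families indexed by finite types *)

Section FinIndex.
Variable A : pzRingType.
Implicit Types M P : lmodType A.

Lemma fg_fin (T : finType) M (e : T -> M) :
  (forall m, exists c : T -> A, m = \sum_j c j *: e j) -> fin_gen M.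
Proof.
move=> eP; exists #|T|, (fun i => e (enum_val i)) => m; have [c ->] := eP m.
exists (fun i => c (enum_val i)).
exact: (reindex _ (onW_bij _ (@enum_val_bij T))).
Qed.

Lemma dual_basis_fin (T : finType) P (e : T -> P) (xi : T -> hom P A^o) :
  (forall x, x = \sum_j (xi j x : A) *: e j) ->
  dual_basis (fun i : 'I_#|T| => e (enum_val i)) (fun i => xi (enum_val i)).
Proof.
move=> eP x; rewrite [LHS]eP.
exact: (reindex _ (onW_bij _ (@enum_val_bij T))).
Qed.

End FinIndex.

Lemma fg_restrict (R A : pzRingType) (s : {rmorphism R -> A}) (M : lmodType A) :
  fin_gen (restr_scalars s (A^o : lmodType A)) -> fin_gen M -> fin_gen (restr_scalars s M).
Proof.
move=> [n [a aP]] [m [e eP]].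
apply: (@fg_fin R ('I_m * 'I_n)%type (restr_scalars s M)
  (fun ij => ((a ij.2 : A) *: e ij.1 : M))) => x.
have [c cE] := eP x; have [r rE] := choice (fun i => aP (c i)).
exists (fun ij => r ij.1 ij.2); rewrite [LHS]cE.
rewrite -(pair_bigA_idem (addr0 0) (fun i j => (r i j *: ((a j : A) *: e i : restr_scalars s M)) : restr_scalars s M)) /=.
apply: eq_bigr => i _; rewrite {1}(rE i) scaler_suml; apply: eq_bigr => j _.
by rewrite -[in LHS]scalerA.
Qed.

(** * Linear algebra over a field *)

Section Field.
Variable k : fieldType.
Implicit Types V W : lmodType k.

(** A spanning family of least size is linearly independent. *)
Lemma field_dual_basis V : fin_gen V -> exists n (e : 'I_n -> V) xi, dual_basis e xi.
Proof.
move=> fV; pose P n := `[< exists e : 'I_n -> V, forall m, exists c : 'I_n -> k, m = \sum_i c i *: e i >].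
have exP : exists n, P n by have [n en] := fV; exists n; apply/asboolP.
case: (ex_minnP exP) => n /asboolP [e eP] nmin.
have indep (c : 'I_n -> k) : \sum_i c i *: e i = 0 -> forall i, c i = 0.
  move=> c0 j; apply/eqP/negP => /negP cj; case: n => [|n] in e eP nmin c c0 j cj *.
    by case: j cj.
  suff : P n by move/nmin; rewrite ltnn.
  apply/asboolP; exists (fun i => e (lift j i)) => m; have [d ->] := eP m.
  exists (fun i => d (lift j i) - d j * (c j)^-1 * c (lift j i)).
  have ej : e j = - \sum_(i < n) ((c j)^-1 * c (lift j i)) *: e (lift j i).
    have := c0; rewrite (bigD1_ord j) //= => /(congr1 (fun x => (c j)^-1 *: x)).
    rewrite scalerDr scaler0 scalerA mulVf // scale1r scaler_sumr => /eqP.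
    rewrite addr_eq0 => /eqP ->; congr (- _); apply: eq_bigr => i _.
    by rewrite scalerA.
  rewrite (bigD1_ord j) //= ej scalerN scaler_sumr addrC -sumrB.
  by apply: eq_bigr => i _; rewrite scalerBl scalerA mulrA.
have [||| s sE] := @ex_hom_rel _ _ (free k n) (fun v c => comb e c = v).
- move=> v; have [c ->] := eP v; exists [ffun i => c i]; rewrite combE.
  by apply: eq_bigr => i _; rewrite ffunE.
- move=> v c c' cv c'v; apply/ffunP => i; apply/eqP; rewrite -subr_eq0; apply/eqP.
  apply: (indep (fun i => c i - c' i)).
  rewrite (eq_bigr (fun i => c i *: e i - c' i *: e i)) => [|j _]; last by rewrite scalerBl.
  by rewrite sumrB -!combE cv c'v subrr.
- by move=> a v v' c c' <- <-; rewrite homD homZ.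
exists n, e, (fun i => hom_comp (@hom_coord k n i) s) => v; rewrite -[LHS]sE combE.
by apply: eq_bigr.
Qed.

Lemma field_projective V : fin_gen V -> projective V.
Proof. by case/field_dual_basis => n [e [xi db]]; apply: dual_basis_projective db. Qed.

(** Finitely many functionals without common zeros bound the dimension; this covers
subspaces and spaces of linear maps at once. *)
Lemma fg_functionals V n (f : 'I_n -> hom V k^o) :
  (forall x, (forall i, f i x = 0) -> x = 0) -> fin_gen V.
Proof.
elim: n V f => [|n IH] V f f0.
  exists 0%N, (fun=> 0) => m; exists (fun => 0); rewrite big_ord0.
  by apply: f0 => -[].
have [K [u [uI ue]]] := ex_kernel (f ord0).
have fK : fin_gen K.
  apply: (IH K (fun i => hom_comp (f (lift ord0 i)) u)) => x h; apply: (injhom0 uI).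
  apply: f0 => i; case: (unliftP ord0 i) => [j ->|->]; first exact: h.
  exact: exact0 ue.
have [[v fv]|nv] := pselect (exists v, f ord0 v <> 0).
  apply: (fg_extension (u := u) (p := f ord0)) fK (@fg_self _); split=> // r.
  exists ((r / f ord0 v : k) *: v); rewrite homZ -[_ *: _]/(_ * _ : k) mulfVK //.
  exact/eqP.
apply: (fg_surj (p := u)) fK => v.
suff /ue : f ord0 v = 0 by [].
by apply: contrapT => fv; apply: nv; exists v.
Qed.

Lemma fg_functionals_fin V (T : finType) (f : T -> hom V k^o) :
  (forall x, (forall i, f i x = 0) -> x = 0) -> fin_gen V.
Proof.
move=> f0; apply: (fg_functionals (f := fun i : 'I_#|T| => f (enum_val i))) => x h.
by apply: f0 => i; rewrite -[i]enum_rankK; apply: h.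
Qed.

Definition homk V W : Type := hom V W.
HB.instance Definition _ V W := GRing.Zmodule.on (homk V W).
Section HomK.
Variables V W : lmodType k.
Fact homk_scale_linear (r : k) (f : homk V W) : linear (fun x => r *: (f : hom V W) x).
Proof. by move=> a x y; rewrite homD homZ scalerDr !scalerA mulrC. Qed.
Definition homk_scale r f : homk V W := mkhom (homk_scale_linear r f).
Fact homk_scaleA a b v : homk_scale a (homk_scale b v) = homk_scale (a * b) v.
Proof. by apply: hom_ext => x; rewrite !mkhomE scalerA. Qed.
Fact homk_scale1 : left_id 1 homk_scale.
Proof. by move=> v; apply: hom_ext => x; rewrite mkhomE scale1r. Qed.
Fact homk_scaleDr : right_distributive homk_scale +%R.
Proof. by move=> a u v; apply: hom_ext => x; rewrite mkhomE homE scalerDr. Qed.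
Fact homk_scaleDl v : {morph homk_scale^~ v : a b / a + b}.
Proof. by move=> a b; apply: hom_ext => x; rewrite mkhomE scalerDl. Qed.
HB.instance Definition _ := GRing.Zmodule_isLmodule.Build k (homk V W)
  homk_scaleA homk_scale1 homk_scaleDr homk_scaleDl.
Definition evk (f : homk V W) : hom V W := f.
Lemma homk_scaleE r (f : homk V W) x : evk (r *: f) x = r *: evk f x.
Proof. by []. Qed.
Lemma homk_addE (f g : homk V W) x : evk (f + g) x = evk f x + evk g x.
Proof. by []. Qed.
Lemma homk_ext (f g : homk V W) : (forall x, evk f x = evk g x) -> f = g.
Proof. exact: hom_ext. Qed.
Lemma homk_sum I (r : seq I) (F : I -> homk V W) x :
  evk (\sum_(i <- r) F i) x = \sum_(i <- r) evk (F i) x.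
Proof. by elim/big_rec2: _ => // i y f _ <-; rewrite homk_addE. Qed.
End HomK.

Lemma fg_homk V W : fin_gen V -> fin_gen W -> fin_gen (homk V W).
Proof.
move=> /field_dual_basis [n [e [xi db]]] /field_dual_basis [m [f [eta db']]].
have lf i j : linear (fun h : homk V W => eta j (evk h (e i))).
  by move=> a h h'; rewrite homk_addE homk_scaleE homD homZ.
apply: (fg_functionals_fin (f := fun ij : 'I_n * 'I_m => mkhom (lf ij.1 ij.2))).
move=> h h0; apply: homk_ext => x; rewrite (db x) !hom_sum big1 => [|i _].
  by rewrite big1 // => i _; rewrite homZ -[evk _ _]/(0 : W) scaler0.
rewrite homZ (db' (evk h (e i))) big1 ?scaler0 // => j _.
by have -> : eta j (evk h (e i)) = 0; [exact: (h0 (i, j))|rewrite scale0r].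
Qed.

Lemma fg_sub V W (u : hom V W) : injective u -> fin_gen W -> fin_gen V.
Proof.
move=> uI /field_dual_basis [m [f [eta db]]].
apply: (fg_functionals (f := fun j => hom_comp (eta j) u)) => x h.
apply: (injhom0 uI); rewrite (db (u x)) big1 // => j _.
by have -> : eta j (u x) = 0; [exact: h|rewrite scale0r].
Qed.

Lemma field_split V' V V'' (u : hom V' V) (p : hom V V'') : fin_gen V'' ->
  short_exact u p -> exists (r : hom V V') (s : hom V'' V),
    [/\ cancel u r, cancel s p & forall x, u (r x) + s (p x) = x].
Proof.
move=> /field_projective pV [uI ue ps].
have [s sE] := pV _ _ p (hom_id V'') ps.
have [|r rE] := @factor_inj _ _ _ _ u (hom_id V - hom_comp s p) uI.
  by move=> x; apply/ue; rewrite !homE homB sE subrr.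
exists r, s; split=> [x|x|x]; last by rewrite rE !homE subrK.
- by apply: uI; rewrite rE !homE (exact0 _ ue) hom0 subr0.
- by rewrite sE.
Qed.
End Field.

(** * Tensor products over a field *)

Section TensorSpace.
Variable k : fieldType.
Implicit Types V W Z : lmodType k.
Notation "V ^*" := (homk V k^o).

(** The tensor product of V and W, realized as Hom(Hom(V, k), W) for a
finite-dimensional V.  It is functorial in V and W without any choice of bases. *)
Definition tensk V W : Type := homk (homk V k^o) W.
HB.instance Definition _ V W := GRing.Lmodule.on (tensk V W).
Definition evt V W (F : tensk V W) (xi : homk V k^o) : W := evk F xi.

Lemma tensk_ext V W (F G : tensk V W) : (forall xi, evt F xi = evt G xi) -> F = G.
Proof. exact: hom_ext. Qed.

Section Pure.
Variables V W : lmodType k.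
Fact pure_linear (v : V) (w : W) : linear (fun xi : homk V k^o => (evk xi v : k) *: w).
Proof. by move=> a x y; rewrite homk_addE homk_scaleE scalerDl scalerA. Qed.
Definition pure v w : tensk V W := mkhom (pure_linear v w).
Lemma pureE v w xi : evt (pure v w) xi = (evk xi v : k) *: w.
Proof. by []. Qed.
Lemma pureDl v v' w : pure (v + v') w = pure v w + pure v' w.
Proof. by apply: tensk_ext => xi; rewrite [RHS]homk_addE !pureE homD scalerDl. Qed.
Lemma pureDr v w w' : pure v (w + w') = pure v w + pure v w'.
Proof. by apply: tensk_ext => xi; rewrite [RHS]homk_addE !pureE scalerDr. Qed.
Lemma pure0l w : pure 0 w = 0.
Proof. by apply: (addIr (pure 0 w)); rewrite -pureDl !add0r. Qed.
Lemma pure0r v : pure v 0 = 0.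
Proof. by apply: (addIr (pure v 0)); rewrite -pureDr !add0r. Qed.
Lemma pure_suml I (r : seq I) (F : I -> V) w :
  pure (\sum_(i <- r) F i) w = \sum_(i <- r) pure (F i) w.
Proof. by elim/big_rec2: _ => [|i y x _ <-]; rewrite ?pure0l ?pureDl. Qed.
Lemma pure_sumr I (r : seq I) v (F : I -> W) :
  pure v (\sum_(i <- r) F i) = \sum_(i <- r) pure v (F i).
Proof. by elim/big_rec2: _ => [|i y x _ <-]; rewrite ?pure0r ?pureDr. Qed.

(** A dual basis of V expands every tensor into finitely many pure ones. *)
Lemma pure_expand n (e : 'I_n -> V) xi : dual_basis e xi ->
  forall F : tensk V W, F = \sum_i pure (e i) (evt F (xi i)).
Proof.
move=> db F; apply: tensk_ext => eta; rewrite [RHS]homk_sum.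
have etaE : eta = \sum_i (evk eta (e i) : k) *: (xi i : homk V k^o).
  apply: homk_ext => v; rewrite {1}(db v) hom_sum homk_sum; apply: eq_bigr => i _.
  by rewrite homk_scaleE homZ -[LHS]/(_ * _) mulrC.
rewrite {1}etaE -[LHS]/(evk F _) hom_sum; apply: eq_bigr => i _.
by rewrite homZ -[RHS]pureE.
Qed.
End Pure.

Lemma pure_span V W Z : fin_gen V -> forall f g : hom (tensk V W) Z,
  (forall v w, f (pure v w) = g (pure v w)) -> forall F, f F = g F.
Proof.
move=> /field_dual_basis [n [e [xi db]]] f g fg F.
by rewrite (pure_expand db F) !hom_sum; apply: eq_bigr => i _.
Qed.

Lemma tensk_universal V W Z (b : V -> W -> Z) : fin_gen V -> bilinear_map b ->
  exists g : hom (tensk V W) Z, forall v w, g (pure v w) = b v w.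
Proof.
move=> /field_dual_basis [n [e [xi db]]] [bl br].
have lg : linear (fun F : tensk V W => \sum_i b (e i) (evt F (xi i))).
  move=> a F G; rewrite scaler_sumr -big_split; apply: eq_bigr => i _ /=.
  by rewrite -br; congr b.
exists (mkhom lg) => v w; rewrite mkhomE.
pose bw := mkhom (bl w); rewrite -[RHS]/(bw v) {2}(db v) hom_sum.
apply: eq_bigr => i _; rewrite homZ pureE.
by rewrite -[LHS]/((mkhom (br (e i))) (_ *: w)) homZ.
Qed.

Section Map.
Variables (V V' W W' : lmodType k).
Fact precomp_linear (f : hom V V') :
  linear (fun xi : homk V' k^o => hom_comp (evk xi) f : homk V k^o).
Proof. by move=> a x y; apply: homk_ext. Qed.
Definition precomp f : hom (homk V' k^o) (homk V k^o) := mkhom (precomp_linear f).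
Fact mapk_linear (f : hom V V') (g : hom W W') :
  linear (fun F : tensk V W => hom_comp g (hom_comp (evk F) (precomp f)) : tensk V' W').
Proof.
move=> a F G; apply: tensk_ext => xi; rewrite -[LHS]/(g (a *: evt F _ + evt G _)).
by rewrite homD homZ.
Qed.
Definition mapk f g : hom (tensk V W) (tensk V' W') := mkhom (mapk_linear f g).
Lemma mapkE f g F xi : evt (mapk f g F) xi = g (evt F (precomp f xi)).
Proof. by []. Qed.
Lemma precompE f xi v : evk (precomp f xi) v = evk xi (f v).
Proof. by []. Qed.
Lemma mapk_pure f g v w : mapk f g (pure v w) = pure (f v) (g w).
Proof. by apply: tensk_ext => xi; rewrite mapkE !pureE homZ. Qed.
End Map.

Lemma mapk_comp V V' V'' W W' W'' (f : hom V V') (f' : hom V' V'')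
    (g : hom W W') (g' : hom W' W'') F :
  mapk f' g' (mapk f g F) = mapk (hom_comp f' f) (hom_comp g' g) F.
Proof.
apply: tensk_ext => xi; rewrite !mapkE homE.
by congr (g' (g (evt F _))); apply: homk_ext.
Qed.
Lemma mapk_id V W (F : tensk V W) : mapk (hom_id V) (hom_id W) F = F.
Proof.
by apply: tensk_ext => xi; rewrite mapkE homE; congr evt; apply: homk_ext.
Qed.
Lemma eq_mapk V V' W W' (f f' : hom V V') (g g' : hom W W') F :
  (forall x, f x = f' x) -> (forall x, g x = g' x) -> mapk f g F = mapk f' g' F.
Proof. by move=> /hom_ext -> /hom_ext ->. Qed.
Lemma mapkDl V V' W W' (f f' : hom V V') (g : hom W W') F :
  mapk (f + f') g F = mapk f g F + mapk f' g F.
Proof.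
apply: tensk_ext => xi; rewrite [RHS]homk_addE -![evk (mapk _ _ _) _]/(evt _ _) !mapkE.
rewrite -homD; congr (g _); rewrite -[RHS](homD (evk F)); congr (evk F _).
by apply: homk_ext => v; rewrite homk_addE !precompE -(homD (evk xi)).
Qed.
Lemma mapkDr V V' W W' (f : hom V V') (g g' : hom W W') F :
  mapk f (g + g') F = mapk f g F + mapk f g' F.
Proof. by apply: tensk_ext. Qed.
Lemma mapkZl V V' W W' r (f : homk V V') (g : hom W W') F :
  mapk (r *: f : homk V V') g F = r *: mapk f g F.
Proof.
apply: tensk_ext => xi; rewrite [RHS]homk_scaleE -[evk (mapk _ _ _) _]/(evt _ _) !mapkE.
rewrite -homZ; congr (g _); rewrite -[RHS](homZ (evk F)); congr (evk F _).
by apply: homk_ext => v; rewrite homk_scaleE !precompE -(homZ (evk xi)).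
Qed.
Lemma mapkZr V V' W W' r (f : hom V V') (g : homk W W') F :
  mapk f (r *: g : homk W W') F = r *: mapk f g F.
Proof. by apply: tensk_ext. Qed.

(** The sequence splits over the field, and splittings are preserved by any additive
functor. *)
Lemma mapk_exactl V' V V'' W (u : hom V' V) (p : hom V V'') : fin_gen V'' ->
  short_exact u p -> short_exact (mapk u (hom_id W)) (mapk p (hom_id W)).
Proof.
move=> fV sup; have [r [s [ru ps rs]]] := field_split fV sup.
have [uI ue _] := sup; split.
- apply: (can_inj (g := mapk r (hom_id W))) => F.
  by rewrite mapk_comp -[RHS]mapk_id; apply: eq_mapk => x; rewrite ?homE.
- move=> F; split=> [pF|[G <-]].
    exists (mapk r (hom_id W) F); rewrite -[RHS]mapk_id.
    rewrite (@eq_mapk _ _ _ _ (hom_id V) (hom_comp u r + hom_comp s p) (hom_id W) (hom_id W)) //.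
      rewrite mapkDl (_ : mapk (hom_comp s p) (hom_id W) F = 0).
        by rewrite addr0 mapk_comp; apply: eq_mapk.
      rewrite -(hom0 (mapk s (hom_id W))) -[in RHS]pF mapk_comp.
      exact: eq_mapk.
    by move=> x; rewrite !homE rs.
  rewrite mapk_comp; apply: tensk_ext => xi; rewrite mapkE !homE.
  have -> : precomp (hom_comp p u) xi = 0; last exact: (hom0 (evk G)).
  by apply: homk_ext => v; rewrite precompE homE (exact0 _ ue) hom0.
- move=> F; exists (mapk s (hom_id W) F).
  by rewrite mapk_comp -[RHS]mapk_id; apply: eq_mapk => x; rewrite ?homE.
Qed.

Lemma mapk_exactr V W' W W'' (u : hom W' W) (p : hom W W'') : fin_gen W'' ->
  short_exact u p -> short_exact (mapk (hom_id V) u) (mapk (hom_id V) p).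
Proof.
move=> fV sup; have [r [s [ru ps rs]]] := field_split fV sup.
have [uI ue _] := sup; split.
- apply: (can_inj (g := mapk (hom_id V) r)) => F.
  by rewrite mapk_comp -[RHS]mapk_id; apply: eq_mapk => x; rewrite ?homE.
- move=> F; split=> [pF|[G <-]].
    exists (mapk (hom_id V) r F); apply: tensk_ext => xi.
    have pFx : p (evt F (precomp (hom_id V) xi)) = 0 :=
      congr1 (fun G : tensk V W'' => evt G xi) pF.
    rewrite !mapkE.
    have -> : precomp (hom_id V) (precomp (hom_id V) xi) = precomp (hom_id V) xi by apply: homk_ext.
    rewrite -[LHS]addr0 -(hom0 s) -pFx rs.
    by congr evt; apply: homk_ext.
  by apply: tensk_ext => xi; rewrite !mapkE (exact0 _ ue).
- move=> F; exists (mapk (hom_id V) s F).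
  by rewrite mapk_comp -[RHS]mapk_id; apply: eq_mapk => x; rewrite ?homE.
Qed.
End TensorSpace.

(** * Tensor products of modules over a tensor product of algebras *)

Section TensorModule.
Variables (k : fieldType) (A B C : pzRingType).
Variables (iA : algebraOver k A) (iB : algebraOver k B) (iC : algebraOver k C).
Variable t : A -> B -> C.
Hypothesis tens : tensor_algebra iA iB iC t.

Section OverK.
Variables (D : pzRingType) (iD : algebraOver k D).
Definition kmod (M : lmodType D) : lmodType k := restr_scalars iD M.
Definition khom (M N : lmodType D) (f : hom M N) : hom (kmod M) (kmod N) :=
  restrict_hom iD f.
Lemma kmod_scaleE (M : lmodType D) (r : k) (x : kmod M) : r *: x = (iD r *: (x : M) : M).
Proof. by []. Qed.
Lemma khomE (M N : lmodType D) (f : hom M N) (x : M) : khom f x = f x.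
Proof. by []. Qed.
Lemma khom_id (M : lmodType D) : khom (hom_id M) = hom_id (kmod M).
Proof. exact: hom_ext. Qed.
Fact lact_linear (M : lmodType D) (a : D) : linear (fun x : kmod M => a *: (x : M) : kmod M).
Proof.
move=> r x y; rewrite kmod_scaleE (scalerDr a) (scalerA a) -alg_central -scalerA.
by rewrite kmod_scaleE.
Qed.
Definition lact (M : lmodType D) (a : D) : hom (kmod M) (kmod M) := mkhom (lact_linear a).
Lemma lactE (M : lmodType D) a (x : M) : lact M a x = a *: x.
Proof. by []. Qed.
Lemma khom_exact K M N (u : hom K M) (p : hom M N) :
  short_exact u p -> short_exact (khom u) (khom p).
Proof. by []. Qed.
End OverK.

Notation kA := (kmod iA).
Notation kB := (kmod iB).
Notation kC := (kmod iC).

Lemma t_linl b : linear ((fun a => t a b) : kA A^o -> kC C^o).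
Proof. exact: (tensor_bilinear tens).1. Qed.
Lemma t_linr a : linear ((fun b => t a b) : kB B^o -> kC C^o).
Proof. exact: (tensor_bilinear tens).2. Qed.
Definition t_l b : hom (kA A^o) (kC C^o) := mkhom (t_linl b).
Definition t_r a : hom (kB B^o) (kC C^o) := mkhom (t_linr a).

Lemma tZl r a b : t (iA r * a) b = iC r * t a b.
Proof. exact: (homZ (t_l b) r a). Qed.
Lemma t_suml I (r : seq I) (F : I -> A) b : t (\sum_(i <- r) F i) b = \sum_(i <- r) t (F i) b.
Proof. exact: (hom_sum (t_l b)). Qed.
Lemma t_sumr I (r : seq I) a (F : I -> B) : t a (\sum_(i <- r) F i) = \sum_(i <- r) t a (F i).
Proof. exact: (hom_sum (t_r a)). Qed.
Lemma t_scalar r : t (iA r) 1 = iC r.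
Proof. by rewrite -[iA r]mulr1 tZl (tensor_one tens) mulr1. Qed.

(** The uniqueness part of the universal property: linear maps on C are determined by
their values on pure tensors. *)
Lemma tensor_uniq (Z : lmodType k) (f g : hom (kC C^o) Z) :
  (forall a b, f (t a b) = g (t a b)) -> forall c, f c = g c.
Proof.
move=> fg c; have bl : @bilinear_map k (kA A^o) (kB B^o) Z (fun a b => f (t a b)).
  split=> [b r a a'|a r b b'].
    by rewrite -[t _ _]/(t_l b _) (homD (t_l b)) homD (homZ (t_l b)) homZ.
  by rewrite -[t _ _]/(t_r a _) (homD (t_r a)) homD (homZ (t_r a)) homZ.
have [h [_ hu]] := tensor_universal tens bl.
by rewrite -(hu f) // -(hu g) // => a b; rewrite fg.
Qed.

Section Object.
Variables (M : lmodType A) (N : lmodType B).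
(** The tensor product structure on C is an argument, so that the action of C can be
inferred from the type. *)
Definition tensT : Type := (fun _ : tensor_algebra iA iB iC t => tensk (kA M) (kB N)) tens.
HB.instance Definition _ := GRing.Zmodule.copy tensT (tensk (kA M) (kB N)).

Let T := tensk (kA M) (kB N).
Definition tact a b : homk T T := mapk (lact iA M a) (lact iB N b).

Lemma tact_bilinear : @bilinear_map k (kA A^o) (kB B^o) (homk T T : lmodType k) tact.
Proof.
split=> [b r a a'|a r b b']; apply: homk_ext => F; rewrite homk_addE homk_scaleE.
- rewrite -mapkZl -mapkDl; apply: eq_mapk => // x.
  rewrite homE !lactE scalerDl; congr (_ + _); apply: esym.
  exact: (scalerA (iA r) (a : A) (x : M)).
- rewrite -mapkZr -mapkDr; apply: eq_mapk => // x.
  rewrite homE !lactE scalerDl; congr (_ + _); apply: esym.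
  exact: (scalerA (iB r) (b : B) (x : N)).
Qed.

(** The action of C, obtained from the universal property applied to the operators
a (x) b on M (x) N. *)
Definition rho : hom (kC C^o) (homk T T : lmodType k) :=
  projT1 (cid (tensor_universal tens tact_bilinear)).
Lemma rhoE a b : rho (t a b) = tact a b.
Proof. by have [h _] := projT2 (cid (tensor_universal tens tact_bilinear)); apply: h. Qed.

Lemma tact_comp a b a' b' F : evk (tact a b) (evk (tact a' b') F) = evk (tact (a * a') (b * b')) F.
Proof.
by rewrite /tact mapk_comp; apply: eq_mapk => x; rewrite homE !lactE scalerA.
Qed.

Lemma rho1 F : evk (rho 1) F = F.
Proof.
rewrite -(tensor_one tens) rhoE -[RHS]mapk_id; apply: eq_mapk => x;
by rewrite lactE scale1r.
Qed.

(** Both sides are linear in c and in c', so it is enough to consider pure tensors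
for one of them after the other. *)
Lemma rhoM c c' F : evk (rho (c * c')) F = evk (rho c) (evk (rho c') F).
Proof.
have l1 c2 : linear (fun c : kC C^o => evk (rho (c * c2 : C)) F).
  move=> r x y; rewrite mulrDl homD homk_addE; congr (_ + _).
  by rewrite -homk_scaleE -homZ; congr (evk (rho _) F); rewrite !kmod_scaleE -mulrA.
have l2 c2 : linear (fun c : kC C^o => evk (rho c) (evk (rho c2) F)).
  by move=> r x y; rewrite homD homk_addE homZ homk_scaleE.
have l3 c1 : linear (fun c : kC C^o => evk (rho (c1 * c : C)) F).
  move=> r x y; rewrite mulrDr homD homk_addE; congr (_ + _).
  rewrite -homk_scaleE -homZ; congr (evk (rho _) F).
  by rewrite !kmod_scaleE -[_ *: _ in LHS]/(iC r * _) -[RHS]/(iC r * _) !mulrA alg_central.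
have l4 c1 : linear (fun c : kC C^o => evk (rho c1) (evk (rho c) F)).
  by move=> r x y; rewrite homD homk_addE homZ homk_scaleE homD homZ.
rewrite -[LHS]/(mkhom (l1 c') c) -[RHS]/(mkhom (l2 c') c).
apply: tensor_uniq => a b; rewrite !mkhomE.
rewrite -[LHS]/(mkhom (l3 (t a b)) c') -[RHS]/(mkhom (l4 (t a b)) c').
apply: tensor_uniq => a' b'; rewrite !mkhomE.
by rewrite (tensor_mul tens) !rhoE tact_comp.
Qed.

Definition tscale (c : C) (F : tensT) : tensT := evk (rho c) F.
Fact tscaleA a b v : tscale a (tscale b v) = tscale (a * b) v.
Proof. by rewrite /tscale rhoM. Qed.
Fact tscale1 : left_id 1 tscale.
Proof. exact: rho1. Qed.
Fact tscaleDr : right_distributive tscale +%R.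
Proof. by move=> a u v; apply: (homD (evk (rho a))). Qed.
Fact tscaleDl v : {morph tscale^~ v : a b / a + b}.
Proof. by move=> a b; rewrite /tscale homD. Qed.
HB.instance Definition _ := GRing.Zmodule_isLmodule.Build C tensT
  tscaleA tscale1 tscaleDr tscaleDl.

Definition tensor : lmodType C := tensT.

Lemma tensor_actE a b (F : tensor) : t a b *: F = mapk (lact iA M a) (lact iB N b) F.
Proof. by rewrite -[LHS]/(evk (rho (t a b)) F) rhoE. Qed.

Lemma tensor_kE (r : k) (F : kC tensor) : r *: F = (r *: (F : T) : T).
Proof.
rewrite kmod_scaleE -t_scalar tensor_actE -[in RHS](mapk_id (F : T)) -mapkZl.
by apply: eq_mapk => x; rewrite ?lactE ?scale1r.
Qed.

Definition tpure (m : M) (n : N) : tensor := pure (m : kA M) (n : kB N).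
Lemma tpure_act a b m n : t a b *: tpure m n = tpure (a *: m) (b *: n).
Proof. by rewrite tensor_actE mapk_pure. Qed.

(** Both sides of the linearity condition are k-linear in the scalar c, so linearity
needs to be checked for pure tensors c only. *)
Lemma tensor_hom (Z : lmodType C) (f : hom (T : lmodType k) (kC Z)) :
  (forall a b F, f (mapk (lact iA M a) (lact iB N b) F) = (t a b *: (f F : Z) : Z)) ->
  exists g : hom tensor Z, forall F, g F = f F.
Proof.
move=> fP; apply: (ex_hom (f := fun F : tensor => (f F : Z))) => c F G.
rewrite (homD f); congr (_ + _).
have l1 : linear (fun c : kC C^o => f (evk (rho c) F)).
  by move=> r x y; rewrite homD homk_addE homD homZ homk_scaleE homZ.
have l2 : linear (fun c : kC C^o => (c : C) *: (f F : Z) : kC Z).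
  by move=> r x y; rewrite scalerDl kmod_scaleE -scalerA.
apply: (tensor_uniq (f := mkhom l1) (g := mkhom l2)) => a b.
by rewrite !mkhomE rhoE fP.
Qed.

Fact tensor_toK_linear (Z : lmodType C) (g : hom tensor Z) :
  linear (fun F : T => (g F : kC Z)).
Proof.
move=> r F G; rewrite (homD g); congr (_ + _).
by rewrite -[r *: F]tensor_kE kmod_scaleE homZ.
Qed.
Definition tensor_toK Z (g : hom tensor Z) : hom (T : lmodType k) (kC Z) :=
  mkhom (tensor_toK_linear g).

Hypothesis fM : fin_gen (kA M).

Lemma tensor_span Z (f g : hom tensor Z) :
  (forall m n, f (tpure m n) = g (tpure m n)) -> forall F, f F = g F.
Proof. exact: (pure_span fM (f := tensor_toK f) (g := tensor_toK g)). Qed.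

End Object.

Section TensorMap.
Variables (M M' : lmodType A) (N N' : lmodType B) (f : hom M M') (g : hom N N').
Fact tmap_subproof : exists h : hom (tensor M N) (tensor M' N'),
  forall F, h F = mapk (khom iA f) (khom iB g) F.
Proof.
have lf : linear (fun F : tensk (kA M) (kB N) => mapk (khom iA f) (khom iB g) F : kC (tensor M' N')).
  by move=> r x y; rewrite homD homZ tensor_kE.
have [|h hE] := @tensor_hom M N (tensor M' N') (mkhom lf).
  move=> a b F; rewrite tensor_actE.
  rewrite -[LHS]/(mapk (khom iA f) (khom iB g) (mapk (lact iA M a) (lact iB N b) F)).
  rewrite -[RHS]/(mapk (lact iA M' a) (lact iB N' b) (mapk (khom iA f) (khom iB g) F)).
  by rewrite !mapk_comp; apply: eq_mapk => x; rewrite !homE !khomE !lactE homZ.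
by exists h => F; rewrite hE.
Qed.
Definition tmap : hom (tensor M N) (tensor M' N') := projT1 (cid tmap_subproof).
Lemma tmapE F : tmap F = mapk (khom iA f) (khom iB g) F.
Proof. exact: (projT2 (cid tmap_subproof)). Qed.
Lemma tmap_pure m n : tmap (tpure m n) = tpure (f m) (g n).
Proof. by rewrite tmapE mapk_pure. Qed.
End TensorMap.

Hypothesis fA : fin_gen (kA A^o).
Hypothesis fB : fin_gen (kB B^o).

Lemma fg_kA M : fin_gen M -> fin_gen (kA M).
Proof. exact: fg_restrict. Qed.
Lemma fg_kB N : fin_gen N -> fin_gen (kB N).
Proof. exact: fg_restrict. Qed.

Lemma tmap_exactl M' M M'' N (u : hom M' M) (p : hom M M'') : fin_gen M'' ->
  short_exact u p -> short_exact (tmap u (hom_id N)) (tmap p (hom_id N)).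
Proof.
move=> fM sup; have [uI ue ps] := mapk_exactl (kB N) (fg_kA fM) (khom_exact iA sup).
split.
- by move=> x y xy; apply: uI; rewrite !tmapE khom_id in xy; exact: xy.
- move=> F; rewrite tmapE khom_id; split=> [FE|[G GE]].
    by have [G GE] := (ue F).1 FE; exists G; rewrite tmapE khom_id; exact: GE.
  by apply: (ue F).2; exists G; rewrite -GE tmapE khom_id.
- by move=> F; have [G GE] := ps F; exists G; rewrite tmapE khom_id; exact: GE.
Qed.

Lemma tmap_exactr M N' N N'' (u : hom N' N) (p : hom N N'') : fin_gen N'' ->
  short_exact u p -> short_exact (tmap (hom_id M) u) (tmap (hom_id M) p).
Proof.
move=> fM sup; have [uI ue ps] := mapk_exactr (kA M) (fg_kB fM) (khom_exact iB sup).
split.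
- by move=> x y xy; apply: uI; rewrite !tmapE khom_id in xy; exact: xy.
- move=> F; rewrite tmapE khom_id; split=> [FE|[G GE]].
    by have [G GE] := (ue F).1 FE; exists G; rewrite tmapE khom_id; exact: GE.
  by apply: (ue F).2; exists G; rewrite -GE tmapE khom_id.
- by move=> F; have [G GE] := ps F; exists G; rewrite tmapE khom_id; exact: GE.
Qed.

(** The regular module of C as the tensor product of the regular modules. *)
Lemma tensor_regular : exists ka : hom (tensor A^o B^o) C^o,
  forall a b, ka (tpure a b) = t a b.
Proof.
have [g gE] := tensk_universal (fA) (tensor_bilinear tens : @bilinear_map k (kA A^o) (kB B^o) (kC C^o) t).
have [|h hE] := @tensor_hom A^o B^o C^o g; last by exists h => a b; rewrite hE gE.
move=> a b F; pose f1 := hom_comp g (mapk (lact iA A^o a) (lact iB B^o b)).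
have l2 : linear (fun x : kC C^o => (t a b * (x : C)) : kC C^o).
  move=> r x y; rewrite mulrDr; congr (_ + _).
  by rewrite !kmod_scaleE -[_ *: _ in LHS]/(iC r * _) -[RHS]/(iC r * _) !mulrA alg_central.
rewrite -[LHS]/(f1 F) -[RHS]/(hom_comp (mkhom l2) g F).
apply: (pure_span fA) => x y; rewrite /f1 !homE mapk_pure !gE mkhomE.
by rewrite (tensor_mul tens).
Qed.

Lemma tpure_suml (M : lmodType A) (N : lmodType B) I (r : seq I) (F : I -> M) (n : N) :
  tpure (\sum_(i <- r) F i) n = \sum_(i <- r) tpure (F i) n.
Proof. exact: (pure_suml (V := kA M) (W := kB N)). Qed.
Lemma tpure_sumr (M : lmodType A) (N : lmodType B) I (r : seq I) (m : M) (F : I -> N) :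
  tpure m (\sum_(i <- r) F i) = \sum_(i <- r) tpure m (F i).
Proof. exact: (pure_sumr (V := kA M) (W := kB N)). Qed.

(** The tensor products of two dual bases form a dual basis. *)
Lemma tensor_dual_basis P Q : fin_gen P -> projective P -> fin_gen Q -> projective Q ->
  exists n (e : 'I_n -> tensor P Q) xi, dual_basis e xi.
Proof.
move=> fP pP fQ pQ.
have [n [e [xi db]]] := projective_dual_basis fP pP.
have [m [e' [xi' db']]] := projective_dual_basis fQ pQ.
have [ka kaE] := tensor_regular.
pose E (ij : 'I_n * 'I_m) := tpure (e ij.1) (e' ij.2).
pose X (ij : 'I_n * 'I_m) := hom_comp ka (tmap (xi ij.1) (xi' ij.2)).
suff dbE F : F = \sum_ij (X ij F : C) *: E ij.
  by do 3!eexists; apply: dual_basis_fin dbE.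
pose h : hom (tensor P Q) (tensor P Q) := \sum_ij hom_comp (hom_at (E ij)) (X ij).
have hE G : h G = \sum_ij (X ij G : C) *: E ij.
  by rewrite /h; elim/big_rec2: _ => // i y z _ <-; rewrite !homE pairE.
rewrite -hE; apply: (tensor_span (fg_kA fP) (f := hom_id _)) => p q.
rewrite homE hE {1}(db p) {1}(db' q) tpure_suml -(pair_bigA _ (fun i j => (X (i, j) (tpure p q) : C) *: E (i, j))).
apply: eq_bigr => i _; rewrite tpure_sumr; apply: eq_bigr => j _.
by rewrite -tpure_act /X homE tmap_pure kaE.
Qed.

Lemma tensor_fg M N : fin_gen M -> fin_gen N -> fin_gen (tensor M N).
Proof.
move=> fM fN; have [P [q [fP pP qs]]] := fg_cover fM; have [Q [r [fQ pQ rs]]] := fg_cover fN.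
have [n [e [xi db]]] := tensor_dual_basis fP pP fQ pQ.
have [K [u [uI ue]]] := ex_kernel q; have [L [v [vI ve]]] := ex_kernel r.
have [_ _ s1] : short_exact (tmap u (hom_id Q)) (tmap q (hom_id Q)) by apply: tmap_exactl.
have [_ _ s2] : short_exact (tmap (hom_id M) v) (tmap (hom_id M) r) by apply: tmap_exactr.
by apply: (fg_surj s2); apply: (fg_surj s1); apply: dual_basis_fg db.
Qed.

Lemma tensor_projective P Q : fin_gen P -> projective P -> fin_gen Q -> projective Q ->
  projective (tensor P Q).
Proof.
move=> fP pP fQ pQ; have [n [e [xi db]]] := tensor_dual_basis fP pP fQ pQ.
exact: dual_basis_projective db.
Qed.
End TensorModule.

(** * Ext and Gorenstein projectivity of tensor products *)

Section Kunneth.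
Variables (k : fieldType) (A B C : pzRingType).
Variables (iA : algebraOver k A) (iB : algebraOver k B) (iC : algebraOver k C).
Variable t : A -> B -> C.
Hypothesis tens : tensor_algebra iA iB iC t.
Hypothesis fA : fin_gen (kmod iA (A^o : lmodType A)).
Hypothesis fB : fin_gen (kmod iB (B^o : lmodType B)).
Notation kA := (kmod iA).
Notation kB := (kmod iB).
Notation tensor := (tensor tens).
Notation tpure := (tpure tens).
Notation tmap := (tmap tens).

Implicit Types (M P K : lmodType A) (N Q L : lmodType B).

Lemma evt_act M N (F : tensor M N) a b xi :
  evt (t a b *: F : tensk (kA M) (kB N)) xi =
  (b *: (evt (F : tensk (kA M) (kB N)) (precomp (lact iA M a) xi) : N) : N).
Proof. by rewrite tensor_actE mapkE lactE. Qed.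

Lemma tpure_Dl M N (m m' : M) (n : N) : tpure (m + m') n = tpure m n + tpure m' n.
Proof. exact: (pureDl (V := kA M) (W := kB N)). Qed.
Lemma tpure_Dr M N (m : M) (n n' : N) : tpure m (n + n') = tpure m n + tpure m n'.
Proof. exact: (pureDr (V := kA M) (W := kB N)). Qed.

(** For x in M and a functional xi on M', the map sending y to the contraction of
f (x (x) y) with xi is B-linear.  Expand it in a basis h_s of Hom_B(N, N').  Its
coefficients are linear in xi, so they are values xi (phi_s x) with phi_s x in M'. *)
Lemma hom_tensor M N M' N' (f : hom (tensor M N) (tensor M' N')) :
  fin_gen M' -> fin_gen N -> fin_gen N' ->
  exists n (phi : 'I_n -> hom M M') (h : 'I_n -> hom N N'),
    forall x y, f (tpure x y) = \sum_s tpure (phi s x) (h s y).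
Proof.
move=> fM' fN fN'.
(* Hom_B(N, N') as a k-subspace of Hom_k(N, N') *)
pose S : set (homk (kB N) (kB N')) := fun h => forall b (y : N),
  evk h (b *: y : N) = (b *: (evk h y : N') : N').
have sS : submodule S.
  split.
  - by move=> b y; rewrite -![evk _ _]/(0 : N') scaler0.
  - by move=> g h Sg Sh b y; rewrite !homk_addE Sg Sh (scalerDr b).
  - move=> r h Sh b y; rewrite !homk_scaleE Sh !kmod_scaleE (scalerA b) -alg_central.
    by rewrite -(scalerA (iB r)).
have [W [u [uI uS]]] := ex_submodule sS.
have fW : fin_gen W.
  apply: (fg_sub uI); apply: fg_homk; exact: (fg_restrict fB).
have [d [w [eta dbW]]] := field_dual_basis fW.
have [q [e [est dbM]]] := field_dual_basis (fg_restrict fA fM' : fin_gen (kA M')).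
have /choice [kap kapE] : forall p : M * homk (kA M') k^o, exists x : W,
    forall y : N, evk (u x) y = evt (f (tpure p.1 y) : tensk (kA M') (kB N')) p.2.
  move=> [x xi].
  have lh : linear (fun y : kB N => evt (f (tpure x (y : N)) : tensk (kA M') (kB N')) xi : kB N').
    move=> r y z; rewrite kmod_scaleE tpure_Dr (homD f) [LHS]homk_addE; congr (_ + _).
    rewrite -{1}[x]scale1r -(tpure_act tens) homZ.
    rewrite -[LHS]/(evt (t 1 (iB r) *: f (tpure x y) : tensk (kA M') (kB N')) xi).
    rewrite evt_act kmod_scaleE; congr (_ *: _).
    by congr evt; apply: homk_ext => z'; rewrite precompE lactE scale1r.
  have /uS [x' x'E] : S (mkhom lh).
    move=> b y.
    transitivity (evt (t 1 b *: f (tpure x y) : tensk (kA M') (kB N')) xi).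
      by rewrite -homZ (tpure_act tens) scale1r.
    rewrite evt_act; congr (b *: (evt (f (tpure x y) : tensk (kA M') (kB N')) _ : N')).
    by apply: homk_ext => z'; rewrite precompE lactE scale1r.
  by exists x' => y; rewrite x'E.
have uext (x x' : W) : (forall y : N, evk (u x) y = evk (u x') y) -> x = x'.
  by move=> h; apply: uI; apply: homk_ext.
pose c s x xi : k := eta s (kap (x, xi)).
have clin x s r xi xi' : c s x (r *: xi + xi') = r * c s x xi + c s x xi'.
  transitivity (eta s (r *: kap (x, xi) + kap (x, xi')) : k); last by rewrite homD homZ.
  congr (eta s _); apply: uext => y.
  rewrite kapE homD homZ homk_addE homk_scaleE !kapE.
  by rewrite -[LHS]/(evk (f (tpure x y) : tensk (kA M') (kB N')) _) homD homZ.
have c0 x s : c s x 0 = 0.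
  by have := clin x s (-1) 0 0; rewrite scaler0 add0r mulN1r addNr.
have c_sum x s (I : finType) (r : I -> k) (F : I -> homk (kA M') k^o) :
    c s x (\sum_i r i *: F i) = \sum_i r i * c s x (F i).
  elim/big_rec2: _ => [|i y z _ IH]; first exact: c0.
  by rewrite clin IH.
(* the functional c s x on the dual of M' is evaluation at phi s x *)
pose phi s (x : M) : kA M' := \sum_j c s x (est j : homk (kA M') k^o) *: e j.
have phiE s x (xi : homk (kA M') k^o) : evk xi (phi s x) = c s x xi.
  rewrite /phi hom_sum (eq_bigr (fun j => evk xi (e j) * c s x (est j : homk (kA M') k^o))).
    rewrite -c_sum; congr c; apply: homk_ext => z; rewrite homk_sum {2}(dbM z) hom_sum.
    by apply: eq_bigr => j _; rewrite homk_scaleE homZ -[LHS]/(_ * _) mulrC.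
  by move=> j _; rewrite homZ -[LHS]/(_ * _) mulrC.
have sep (x y : kA M') : (forall xi : homk (kA M') k^o, evk xi x = evk xi y) -> x = y.
  move=> h; rewrite (dbM x) (dbM y); apply: eq_bigr => j _; congr (_ *: _).
  exact: (h (est j)).
have lphi s : linear (fun x : M => (phi s x : M')).
  move=> a x y; apply: sep => xi; rewrite (homD (evk xi)) !phiE.
  have -> : evk xi (a *: (phi s x : M') : M') = c s x (precomp (lact iA M' a) xi).
    by rewrite -phiE precompE lactE.
  rewrite /c -(homD (eta s)); congr (eta s _); apply: uext => z.
  rewrite homD homk_addE !kapE /= tpure_Dl (homD f) [LHS]homk_addE; congr (_ + _).
  rewrite -{1}[z]scale1r -(tpure_act tens) homZ.
  rewrite -[LHS]/(evt (t a 1 *: f (tpure x z) : tensk (kA M') (kB N')) xi).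
  by rewrite evt_act scale1r.
have lh s : linear (fun y : N => (evk (u (w s)) y : N')).
  have /uS Sw : exists x, u x = u (w s) by exists (w s).
  by move=> b y z; rewrite (homD (evk (u (w s)))) Sw.
exists d, (fun s => mkhom (lphi s)), (fun s => mkhom (lh s)) => x y.
apply: tensk_ext => xi.
transitivity (evk (u (kap (x, xi))) y : N'); first by rewrite kapE.
rewrite [in LHS](dbW (kap (x, xi))) hom_sum homk_sum.
rewrite [RHS](homk_sum (V := homk (kA M') k^o) (W := kB N')); apply: eq_bigr => s _.
by rewrite homZ homk_scaleE -[X in X *: _]/(c s x xi) -phiE.
Qed.

Lemma hom_sumE (D : pzRingType) (X Y : lmodType D) I (r : seq I) (F : I -> hom X Y) x :
  (\sum_(i <- r) F i : hom X Y) x = \sum_(i <- r) F i x.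
Proof. by elim/big_rec2: _ => // i y f _ <-; rewrite homE. Qed.

Lemma tensor_eq M N (Z : lmodType C) (f g : hom (tensor M N) Z) : fin_gen M ->
  (forall m n, f (tpure m n) = g (tpure m n)) -> forall F, f F = g F.
Proof. by move=> fM; apply: tensor_span; exact: fg_restrict fM. Qed.

Lemma extends_tensorl K P N M' N' (u : hom K P) : fin_gen K -> fin_gen N ->
  fin_gen M' -> fin_gen N' -> extends u M' ->
  extends (tmap u (hom_id N)) (tensor M' N').
Proof.
move=> fK fN fM' fN' ex f.
have [n [phi [h fE]]] := hom_tensor f fM' fN fN'.
have [psi psiE] := choice (fun s => ex (phi s)).
exists (\sum_s tmap (psi s) (h s)) => F; rewrite -[LHS]homE.
apply: tensor_eq => // x y; rewrite homE tmap_pure hom_sumE fE.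
by apply: eq_bigr => s _; rewrite tmap_pure psiE.
Qed.

Lemma extends_tensorr L Q M M' N' (u : hom L Q) : fin_gen L -> fin_gen M ->
  fin_gen M' -> fin_gen N' -> extends u N' ->
  extends (tmap (hom_id M) u) (tensor M' N').
Proof.
move=> fL fM fM' fN' ex f.
have [n [phi [h fE]]] := hom_tensor f fM' fL fN'.
have [psi psiE] := choice (fun s => ex (h s)).
exists (\sum_s tmap (phi s) (psi s)) => F; rewrite -[LHS]homE.
apply: tensor_eq => // x y; rewrite homE tmap_pure hom_sumE fE.
by apply: eq_bigr => s _; rewrite tmap_pure psiE.
Qed.

Hypotheses (enA : enough_injectives A) (enB : enough_injectives B)
  (enC : enough_injectives C).

(** Induction along the syzygies of M; tensor products of projectives are projective. *)
Lemma kunneth_projective n M Q M' N' : gp M -> fin_gen Q -> projective Q ->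
  fin_gen M' -> fin_gen N' -> extv n M M' -> extv n (tensor M Q) (tensor M' N').
Proof.
move=> gM fQ pQ fM' fN'; elim: n M gM => [//|n IH] M gM eM.
have [fM _ [P [K [u [p [fP pP sup gK]]]]] _] := gp_gp_class gM.
have [fK _ _ _] := gp_gp_class gK.
apply: (extv_quotient (tmap_exactl tens fA Q fM sup)).
- apply: extv_projective; exact: tensor_projective.
- apply: IH => //; exact: extv_syzygy sup eM.
- apply: extends_tensorl => //; apply: (ext1_extends enA sup).
  by case: eM.
Qed.

(** The short exact sequence M (x) L -> M (x) Q -> M (x) N shifts the degree down by one,
because Ext vanishes on the middle term by [kunneth_projective]. *)
Lemma kunneth n M N M' N' : gp M -> gp N -> fin_gen M' -> fin_gen N' ->
  extv n M M' -> extv n N N' -> extv n (tensor M N) (tensor M' N').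
Proof.
move=> gM gN fM' fN'; elim: n N gN => [//|n IH] N gN eM eN.
have [fN _ [Q [L [u [p [fQ pQ sup gL]]]]] _] := gp_gp_class gN.
have [fL _ _ _] := gp_gp_class gL; have [fM _ _ _] := gp_gp_class gM.
apply: (extv_quotient (tmap_exactr tens fB M fN sup)).
- exact: kunneth_projective.
- apply: IH => //; first exact: extvW.
  exact: extv_syzygy sup eN.
- apply: extends_tensorr => //; apply: (ext1_extends enB sup).
  by case: eN.
Qed.

(** Maps to Q are assembled from their coordinates along a dual basis. *)
Lemma ext1_dual_basis (D : pzRingType) (X Q : lmodType D) : fin_gen X ->
  enough_injectives D -> fin_gen Q -> projective Q -> ext1 X D^o -> ext1 X Q.
Proof.
move=> fX enD fQ pQ e; have [P [q [fP pP qs]]] := fg_cover fX.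
have [n [b [xi db]]] := projective_dual_basis fQ pQ.
have [K [u [uI ue]]] := ex_kernel q; have sq : short_exact u q by [].
apply: (projective_extends_ext1 pP sq) => f.
have [g gE] := choice (fun i => ext1_extends enD sq e (hom_comp (xi i) f)).
exists (\sum_i hom_comp (hom_at (b i)) (g i)) => x; rewrite hom_sumE [RHS]db.
by apply: eq_bigr => i _; rewrite homE pairE gE homE.
Qed.

Lemma regular_retract : retract (C^o : lmodType C) (tensor A^o B^o).
Proof.
have [ka kaE] := tensor_regular tens fA.
exists (hom_at (tpure (1 : A^o) (1 : B^o) : tensor A^o B^o)), ka => c.
by rewrite pairE homZ kaE (tensor_one tens) -[LHS]/(_ * _) mulr1.
Qed.

(** For cosyzygies M1 of M and N1 of N, with projective middle terms P and Q, the
cokernel of M (x) N -> P (x) Q is an extension of P (x) N1 by M1 (x) N; dually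
for syzygies.  So the extension closure of the tensor products is a suitable class. *)
Lemma tensor_gp M N : gp M -> gp N -> gp (tensor M N).
Proof.
move=> gM gN; pose F X := exists M N, [/\ gp M, gp N & X = tensor M N].
exists (ext_closure F); last by apply: ext_base; exists M, N.
apply: ext_closure_gp => // _ [{gM}M [{gN}N [gM gN ->]]].
have [fM [P [M1 [u [p [fP pP sup gM1]]]]]
  [P' [M2 [u' [p' [fP' pP' sup' gM2]]]]] eM] := gp_gp_class gM.
have [fN [Q [N1 [v [q [fQ pQ svq gN1]]]]]
  [Q' [N2 [v' [q' [fQ' pQ' svq' gN2]]]]] eN] := gp_gp_class gN.
have [fM1 _ _ _] := gp_gp_class gM1; have [fN1 _ _ _] := gp_gp_class gN1.
have gP := gp_projective fP pP; have gQ' := gp_projective fQ' pQ'.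
have FT M0 N0 : gp M0 -> gp N0 -> ext_closure F (tensor M0 N0).
  by move=> g1 g2; apply: ext_base; exists M0, N0.
split.
- exact: tensor_fg.
- have [X [r [a [b [sr sab]]]]] := coker_comp (tmap_exactl tens fA N fM1 sup)
    (tmap_exactr tens fB P fN1 svq).
  exists (tensor P Q), X, (hom_comp (tmap (hom_id P) v) (tmap u (hom_id N))), r; split=> //.
  + exact: tensor_fg.
  + exact: tensor_projective.
  + by apply: ext_step sab _ _; apply: FT.
- have [X [r [a [b [sr sab]]]]] := ker_comp (tmap_exactr tens fB M fN svq')
    (tmap_exactl tens fA Q' fM sup').
  exists (tensor P' Q'), X, r, (hom_comp (tmap (hom_id M) q') (tmap p' (hom_id Q'))); split=> //.
  + exact: tensor_fg.
  + exact: tensor_projective.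
  + by apply: ext_step sab _ _; apply: FT.
- move=> Z fZ pZ; apply: ext1_dual_basis => //; first exact: tensor_fg.
  apply/extv1/(extv_retract enC regular_retract).
  apply: kunneth => //; try exact: fg_self.
    apply/extv1/eM; [exact: fg_self|exact: projective_self].
  apply/extv1/eN; [exact: fg_self|exact: projective_self].
Qed.

Lemma tensor_generator M N : is_generator M -> is_generator N ->
  is_generator (tensor M N).
Proof.
move=> gM gN; apply/generatorP; split; first by apply: tensor_fg => //; [case: gM|case: gN].
move=> Y Z h h0 y.
have [n [a [x ax]]] := generator_trace gM; have [m [b [z bz]]] := generator_trace gN.
have [ka kaE] := tensor_regular tens fA.
pose f i j : hom (tensor M N) Y := hom_comp (hom_at y) (hom_comp ka (tmap (a i) (b j))).
have yE : y = \sum_i \sum_j f i j (tpure (x i) (z j)).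
  rewrite -{1}[y]scale1r -(tensor_one tens) -ax -bz (t_suml tens) scaler_suml.
  apply: eq_bigr => i _; rewrite (t_sumr tens) scaler_suml; apply: eq_bigr => j _.
  by rewrite /f !homE pairE tmap_pure kaE.
by rewrite yE hom_sum big1 // => i _; rewrite hom_sum big1.
Qed.

Lemma tensor_transfer n :
  (exists M : lmodType A, [/\ gp M, is_generator M & extv n M M]) ->
  (exists M : lmodType B, [/\ gp M, is_generator M & extv n M M]) ->
  exists M : lmodType C, [/\ gp M, is_generator M & extv n M M].
Proof.
move=> [M [gM genM eM]] [N [gN genN eN]]; exists (tensor M N); split.
- exact: tensor_gp.
- exact: tensor_generator.
- by apply: kunneth => //; [case: genM|case: genN].
Qed.
End Kunneth.

Theorem proposition3p5 (A B : pzRingType)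
    (SA : artinAlgebra A) (SB : artinAlgebra B) :
  (forall SAB : artinAlgebra (A * B)%type,
     Grigdim SAB = Order.min (Grigdim SA) (Grigdim SB))
  /\
  (forall (k : fieldType) (iA : algebraOver k A) (iB : algebraOver k B)
     (C : pzRingType) (iC : algebraOver k C) (t : A -> B -> C)
     (SC : artinAlgebra C),
     perfect_field k ->
     fin_gen (restr_scalars iA A^o) ->
     fin_gen (restr_scalars iB B^o) ->
     tensor_algebra iA iB iC t ->
     (Order.min (Grigdim SA) (Grigdim SB) <= Grigdim SC)%O)
  /\
  (morita_equivalent A B -> Grigdim SA = Grigdim SB).
Proof.
have [nA lA] := Grigdim_extnat SA; have [nB lB] := Grigdim_extnat SB.
have enA := artin_enough_injectives SA; have enB := artin_enough_injectives SB.
have nmin : extnat (Order.min (Grigdim SA) (Grigdim SB)).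
  by rewrite minEle; case: ifP.
split; [|split].
- move=> SAB; have [nE lE] := Grigdim_extnat SAB.
  have enE := artin_enough_injectives SAB.
  apply: extnat_eq => // m; rewrite le_min lE; split.
    move=> h; apply/andP; split; [apply/lA|apply/lB].
      exact: product_transferA h.
    exact: product_transferB h.
  by move=> /andP [/lA hA /lB hB]; apply: product_transfer.
- move=> k iA iB C iC t SC _ fA fB tens; have [nC lC] := Grigdim_extnat SC.
  have enC := artin_enough_injectives SC.
  apply: extnat_le => // m; rewrite le_min => /andP [/lA hA /lB hB].
  by apply/lC; apply: (tensor_transfer tens).
- move=> AB; apply: extnat_eq => // m; split=> [/lA h|/lB h].
    by apply/lB; apply: morita_transfer AB h.
  by apply/lA; apply: morita_transfer (morita_sym AB) h.
Qed.
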